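(* (1) ${\mathbb{I}_1^0}^{-1}F=F$ but $F\subsetneqq F{\mathbb{I}_1^0}^{-1}$. (2) The multiplicatively closed set $\mathbb{I}_1^0$ is a right but not left Ore subset of $\mathbb{I}_1$ and $\mathbb{I}_1{\mathbb{I}_1^0}^{-1}\simeq\widetilde{\mathbb{I}}_1$. (3) $F{\mathbb{I}_1^0}^{-1}$ is the only proper ideal of the algebra $\widetilde{\mathbb{I}}_1$, and $(F{\mathbb{I}_1^0}^{-1})^2=F{\mathbb{I}_1^0}^{-1}$. (4) $\widetilde{\mathbb{I}}_1/F{\mathbb{I}_1^0}^{-1}\simeq\mathrm{Frac}(A_1)$. (5) $\mathcal{C}(\widetilde{\mathbb{I}}_1)=F{\mathbb{I}_1^0}^{-1}$ (where $\mathcal{C}(\widetilde{\mathbb{I}}_1):=\widetilde{\mathbb{I}}_1\cap\mathcal{C}(K[x])$). (6) $\mathrm{frac}_{K[x]}(\widetilde{\mathbb{I}}_1)\simeq\widetilde{\mathbb{I}}_1/\mathcal{C}(\widetilde{\mathbb{I}}_1)\simeq\mathrm{Frac}(A_1)$. (7) (a) There are only two (up to isomorphism) simple left $\widetilde{\mathbb{I}}_1$-modules, $K[x]$ and $\mathrm{Frac}(A_1)=\widetilde{\mathbb{I}}_1/\mathcal{C}(\widetilde{\mathbb{I}}_1)$. The first one is faithful and the second one is not. (b) There are only two (up to isomorphism) simple right $\widetilde{\mathbb{I}}_1$-modules, $(\mathbb{I}_1/\int\mathbb{I}_1){\mathbb{I}_1^0}^{-1}\simeq K[\partial]{\mathbb{I}_1^0}^{-1}$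 and $\mathrm{Frac}(A_1)$. The first one is faithful and the second one is not. (8) ${}_{\widetilde{\mathbb{I}}_1}F=\bigoplus_{i\in\mathbb{N}}E_{\mathbb{N},i}$ is an infinite direct sum of nonzero left ideals $E_{\mathbb{N},i}=Fe_{0i}\simeq K[x]$, therefore the algebra $\widetilde{\mathbb{I}}_1$ is not left Noetherian. $F{\mathbb{I}_1^0}^{-1}=(\bigoplus_{i\in\mathbb{N}}E_{i,\mathbb{N}}){\mathbb{I}_1^0}^{-1}\simeq\bigoplus_{i\in\mathbb{N}}E_{i,\mathbb{N}}{\mathbb{I}_1^0}^{-1}$ is an infinite direct sum of nonzero right ideals $E_{i,\mathbb{N}}{\mathbb{I}_1^0}^{-1}$ where $E_{i,\mathbb{N}}=e_{i0}F$, therefore the algebra $\widetilde{\mathbb{I}}_1$ is not right Noetherian.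
   Context: $K$ is a field of characteristic zero, $\mathbb{N}=\{0,1,\ldots\}$. $\mathbb{I}_1$ is the subalgebra of $\mathrm{End}_K(K[x])$ generated by (multiplication by) $x$, $\partial=\frac{d}{dx}$ and $\int: x^n\mapsto \frac{x^{n+1}}{n+1}$; $A_1=K\langle x,\partial\rangle$ is the first Weyl algebra and $\mathrm{Frac}(A_1)$ its skew field of fractions. Put $e_{ij}:=\int^i\partial^j-\int^{i+1}\partial^{j+1}$ ($i,j\ge0$) and $F:=\bigoplus_{i,j\ge0}Ke_{ij}$, an ideal of $\mathbb{I}_1$; $E_{\mathbb{N},i}:=\bigoplus_{j\ge0}Ke_{ji}$, $E_{i,\mathbb{N}}:=\bigoplus_{j\ge0}Ke_{ij}$. The right $\mathbb{I}_1$-module $\mathbb{I}_1/\int\mathbb{I}_1$ is identified with $K[\partial]$ via $p\mapsto p+\int\mathbb{I}_1$. $\mathbb{I}_1^0:=\mathbb{I}_1\cap\mathrm{Aut}_K(K[x])$ (elements of $\mathbb{I}_1$ acting bijectively on $K[x]$), ${\mathbb{I}_1^0}^{-1}=\{s^{-1}\mid s\in\mathbb{I}_1^0\}\subseteq\mathrm{Aut}_K(K[x])$, and $\widetilde{\mathbb{I}}_1$ is the subalgebra of $\mathrm{End}_K(K[x])$ generated by $\mathbb{I}_1$ and ${\mathbb{I}_1^0}^{-1}$. ${\mathbb{I}_1^0}^{-1}F=\{s^{-1}f\}$ and $F{\mathbb{I}_1^0}^{-1}=\{fs^{-1}\}$ with $s\in\mathbb{I}_1^0,f\in F$; for a right module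 $N$, $N{\mathbb{I}_1^0}^{-1}$ denotes its right localization at $\mathbb{I}_1^0$, and $\mathbb{I}_1{\mathbb{I}_1^0}^{-1}$ is the right localization of $\mathbb{I}_1$. A proper ideal is a two-sided ideal different from $0$ and the whole algebra. A multiplicatively closed $S\subseteq R$ is a right (left) Ore set if $rS\cap sR\ne\emptyset$ (resp. $Sr\cap Rs\neq\emptyset$) for all $r\in R,s\in S$. For an infinite dimensional vector space $V$, $\mathcal{C}(V)$ is the ideal of $\mathrm{End}_K(V)$ of maps with finite dimensional image and $\mathcal{F}(V)$ the monoid of maps with finite dimensional kernel and cokernel. The image $\mathcal{G}(V)$ of $\mathcal{F}(V)$ in $\mathrm{End}_K(V)/\mathcal{C}(V)$ is a group. For a subalgebra $A\subseteq\mathrm{End}_K(V)$ with $A\setminus(A\cap\mathcal{C}(V))\subseteq\mathcal{F}(V)$, let $\overline{A}$ be the image of $A$ in $\mathrm{End}_K(V)/\mathcal{C}(V)$ (so $\overline{A}\subseteq\mathcal{G}(V)\cup\{0\}$); $\mathrm{frac}_V(A)$ is the subalgebra contained in $\mathcal{G}(V)\cup\{0\}$ (if it exists) generated by $\overline{A}$ and the inverses of its nonzero elements, i.e. the intersection of all subalgebras contained in $\mathcal{G}(V)\cup\{0\}$ that contain these elements. *)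

(* Defs.v *)
From HB Require Import structures.
From mathcomp Require Import all_boot all_order all_algebra.
From mathcomp Require Import boolp classical_sets.

Set Implicit Arguments.
Unset Strict Implicit.
Unset Printing Implicit Defensive.

Import GRing.Theory.
Local Open Scope ring_scope.
Local Open Scope classical_set_scope.
Local Open Scope quotient_scope.

Section FiniteDimension.
Variables (K : fieldType) (V : lmodType K).

Definition lspan (s : seq V) : set V :=
  [set v | exists c : nat -> K, v = \sum_(i < size s) c i *: s`_i].

Definition findim (W : set V) : Prop := exists s : seq V, W = lspan s.

(* The quotient space V / W is spanned by the classes of finitely many vectors. *)
Definition fincodim (W : set V) : Prop :=
  exists s : seq V, forall v, exists2 w, W w & lspan s (v - w).

Lemma lspan_cons a s v :
  lspan (a :: s) v <-> exists k, lspan s (v - k *: a).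
Proof.
split=> [[c ->]|[k [c e]]].
  exists (c 0%N); exists (fun i => c i.+1).
  by rewrite big_ord_recl /= addrC addKr.
exists (fun i => if i is j.+1 then c j else k).
by rewrite big_ord_recl /= -e addrC subrK.
Qed.

Lemma lspan_submod s : submod_closed (mem (lspan s)).
Proof.
split; first by rewrite inE; exists (fun=> 0); rewrite big1 // => i _; rewrite scale0r.
move=> a u v; rewrite !inE => -[c ->] [d ->].
exists (fun i => a * c i + d i); rewrite scaler_sumr -big_split /=.
by apply: eq_bigr => i _; rewrite scalerA scalerDl.
Qed.

Lemma sub_findim (W : set V) s :
  submod_closed (mem W) -> W `<=` lspan s -> findim W.
Proof.
elim: s W => [|a s IH] W Wc Ws.
  exists [::]; apply/seteqP; split=> // v [c ->]; rewrite big_ord0.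
  by case: Wc; rewrite inE.
have [W0 Wl] := Wc.
have [t Et] : findim (W `&` lspan s).
  apply: IH; last by move=> v [].
  have [s0 sl] := lspan_submod s.
  split; first by rewrite inE; split; [move: W0|move: s0]; rewrite inE.
  move=> k u v; rewrite !inE => -[Wu su] [Wv sv]; split.
    by have := Wl k u v; rewrite !inE; apply.
  by have := sl k u v; rewrite !inE; apply.
have [[w Ww sw]|nW] := pselect (exists2 w, W w & ~ lspan s w); last first.
  exists t; rewrite -Et; apply/seteqP; split=> [v Wv|v []//]; split=> //.
  by apply: contrapT => nsv; apply: nW; exists v.
have /lspan_cons[k sk] := Ws _ Ww.
have k0 : k != 0 by apply/eqP => k0; apply: sw; rewrite k0 scale0r subr0 in sk.
have tW v : lspan t v -> W v by rewrite -Et => -[].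
exists (w :: t); apply/seteqP; split=> v.
  move=> Wv; have /lspan_cons[l sl] := Ws _ Wv.
  apply/lspan_cons; exists (l / k); rewrite -Et; split.
    have := Wl (- (l / k)) w v; rewrite !inE scaleNr addrC; exact.
  have -> : v - (l / k) *: w = - (l / k) *: (w - k *: a) + (v - l *: a).
    by rewrite scalerBr scalerA mulNr divfK // !scaleNr opprK addrACA subrr addr0 addrC.
  by have := (lspan_submod s).2 (- (l / k)) (w - k *: a) (v - l *: a); rewrite !inE; apply.
move=> /lspan_cons[l /tW Wt].
by have := Wl l w (v - l *: w); rewrite !inE subrKC; apply.
Qed.

Lemma lspan_cat s t v w :
  lspan s v -> lspan t w -> lspan (s ++ t) (v + w).
Proof.
elim: s v => [|a s IH] v /=; first by case=> c ->; rewrite big_ord0 add0r.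
move=> /lspan_cons[k sv] tw; apply/lspan_cons; exists k.
by rewrite addrAC; apply: IH.
Qed.

End FiniteDimension.

HB.mixin Record isInfDim (K : fieldType) V of GRing.Lmodule K V := {
  infdim : ~ findim [set: V]
}.
#[short(type="infLmodType")]
HB.structure Definition InfLmodule (K : fieldType) :=
  {V of isInfDim K V & GRing.Lmodule K V}.

Section PolyInfDim.
Variable K : fieldType.
Lemma poly_infdim : ~ findim [set: {poly K}].
Proof.
case=> s E.
pose n := \max_(i < size s) size (s`_i : {poly K})%R.
have : lspan s 'X^n by rewrite -E.
case=> c Ec; have := coefXn K n n; rewrite eqxx Ec coef_sum big1 => [/eqP|i _].
  by rewrite eq_sym oner_eq0.
by rewrite coefZ nth_default ?mulr0 //; exact: (leq_bigmax i).
Qed.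
HB.instance Definition _ := isInfDim.Build K {poly K} poly_infdim.
End PolyInfDim.

Definition End (K : fieldType) (V : infLmodType K) : Type := {linear V -> V}.

Section EndAlgebra.
Variables (K : fieldType) (V : infLmodType K).
Implicit Types f g h : End V.

HB.instance Definition _ := gen_eqMixin (End V).
HB.instance Definition _ := gen_choiceMixin (End V).

Lemma EndP f g : (forall v, f v = g v) -> f = g.
Proof.
move=> e; have {e} : (f : V -> V) = (g : V -> V) by apply/funext.
case: f g => [f [[?] [?]]] [g [[?] [?]]] /= e; subst g.
congr GRing.Linear.Pack; congr GRing.Linear.Class.
  by congr Algebra.isNmodMorphism.Axioms_; apply: Prop_irrelevance.
by congr GRing.isScalable.Axioms_; apply: Prop_irrelevance.
Qed.

Definition mkEnd (f : V -> V) (lf : linear f) : End V :=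
  HB.pack f (GRing.isLinear.Build K V V _ f lf).

Lemma end_linear f : linear f. Proof. exact: linearP. Qed.

Fact end_zero_linear : linear (fun _ : V => 0 : V).
Proof. by move=> a u v; rewrite scaler0 addr0. Qed.
Fact end_one_linear : linear (id : V -> V). Proof. by []. Qed.
Fact end_opp_linear f : linear (fun v => - f v).
Proof. by move=> a u v; rewrite end_linear opprD scalerN. Qed.
Fact end_add_linear f g : linear (fun v => f v + g v).
Proof. by move=> a u v; rewrite !end_linear scalerDr addrACA. Qed.
Fact end_mul_linear f g : linear (fun v => f (g v)).
Proof. by move=> a u v; rewrite !end_linear. Qed.
Fact end_scale_linear k f : linear (fun v => k *: f v).
Proof. by move=> a u v; rewrite end_linear scalerDr !scalerA mulrC. Qed.

Let zero : End V := mkEnd end_zero_linear.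
Let one : End V := mkEnd end_one_linear.
Let opp f : End V := mkEnd (end_opp_linear f).
Let add f g : End V := mkEnd (end_add_linear f g).
Let mul f g : End V := mkEnd (end_mul_linear f g).
Let scale k f : End V := mkEnd (end_scale_linear k f).

Fact end_addA : associative add.
Proof. by move=> f g h; apply: EndP => v; apply: addrA. Qed.
Fact end_addC : commutative add.
Proof. by move=> f g; apply: EndP => v; apply: addrC. Qed.
Fact end_add0 : left_id zero add.
Proof. by move=> f; apply: EndP => v; apply: add0r. Qed.
Fact end_addN : left_inverse zero opp add.
Proof. by move=> f; apply: EndP => v; apply: addNr. Qed.
HB.instance Definition _ :=
  GRing.isZmodule.Build (End V) end_addA end_addC end_add0 end_addN.

Fact end_mulA : associative mul.
Proof. by move=> f g h; apply: EndP. Qed.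
Fact end_mul1 : left_id one mul.
Proof. by move=> f; apply: EndP. Qed.
Fact end_1mul : right_id one mul.
Proof. by move=> f; apply: EndP. Qed.
Fact end_mulDl : left_distributive mul +%R.
Proof. by move=> f g h; apply: EndP. Qed.
Fact end_mulDr : right_distributive mul +%R.
Proof. by move=> f g h; apply: EndP => v; apply: raddfD. Qed.
Fact end_one_neq0 : one != 0.
Proof.
apply/eqP => e.
apply: (@infdim K V); exists [::]; apply/seteqP; split=> // v _.
exists (fun=> 0); rewrite big_ord0.
exact: (congr1 (fun f : End V => (f : V -> V) v) e).
Qed.
HB.instance Definition _ := GRing.Zmodule_isNzRing.Build (End V)
  end_mulA end_mul1 end_1mul end_mulDl end_mulDr end_one_neq0.

Fact end_scaleA a b f : scale a (scale b f) = scale (a * b) f.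
Proof. by apply: EndP => v; apply: scalerA. Qed.
Fact end_scale1 : left_id 1 scale.
Proof. by move=> f; apply: EndP => v; apply: scale1r. Qed.
Fact end_scaleDr : right_distributive scale +%R.
Proof. by move=> a f g; apply: EndP => v; apply: scalerDr. Qed.
Fact end_scaleDl f : {morph scale^~ f : a b / a + b}.
Proof. by move=> a b; apply: EndP => v; apply: scalerDl. Qed.
HB.instance Definition _ := GRing.Zmodule_isLmodule.Build K (End V)
  end_scaleA end_scale1 end_scaleDr end_scaleDl.

Fact end_scaleAl (a : K) f g : a *: (f * g) = (a *: f) * g.
Proof. exact: EndP. Qed.
HB.instance Definition _ := GRing.Lmodule_isLalgebra.Build K (End V) end_scaleAl.
Fact end_scaleAr (a : K) f g : a *: (f * g) = f * (a *: g).
Proof. by apply: EndP => v; rewrite /GRing.mul /= linearZ. Qed.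
HB.instance Definition _ := GRing.Lalgebra_isAlgebra.Build K (End V) end_scaleAr.

Lemma end_mulE f g v : (f * g) v = f (g v). Proof. by []. Qed.
Lemma end_addE f g v : (f + g) v = f v + g v. Proof. by []. Qed.
Lemma end_oppE f v : (- f) v = - f v. Proof. by []. Qed.
Lemma end_scaleE (a : K) f v : (a *: f) v = a *: f v. Proof. by []. Qed.
Lemma end_1E v : (1 : End V) v = v. Proof. by []. Qed.
Lemma end_0E v : (0 : End V) v = 0. Proof. by []. Qed.

(* The units are the bijective maps; non-units are their own junk inverse. *)
Definition end_unit : pred (End V) := fun f => `[< bijective f >].

Fact end_inv_ex f : exists g : End V, bijective f -> cancel f g /\ cancel g f.
Proof.
have [[g fK gK]|nf] := pselect (bijective f); last by exists f.
have lg : linear g.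
  by move=> a u v; apply: (can_inj fK); rewrite gK linearP !gK.
by exists (mkEnd lg).
Qed.
Definition end_inv f : End V :=
  if end_unit f then sval (cid (end_inv_ex f)) else f.

Fact end_mulVr : {in end_unit, left_inverse 1 end_inv *%R}.
Proof.
move=> f uf; rewrite /end_inv ifT //; case: cid => g /= [|fK _]; first exact/asboolP.
exact: EndP.
Qed.
Fact end_mulrV : {in end_unit, right_inverse 1 end_inv *%R}.
Proof.
move=> f uf; rewrite /end_inv ifT //; case: cid => g /= [|_ gK]; first exact/asboolP.
exact: EndP.
Qed.
Fact end_unitP f g : g * f = 1 /\ f * g = 1 -> end_unit f.
Proof.
case=> gf fg; apply/asboolP; exists g => v.
  by rewrite -end_mulE gf.
by rewrite -end_mulE fg.
Qed.
Fact end_inv_out : {in [predC end_unit], end_inv =1 id}.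
Proof. by move=> f nf; rewrite /end_inv ifN. Qed.
HB.instance Definition _ := GRing.NzRing_hasMulInverse.Build (End V)
  end_mulVr end_mulrV end_unitP end_inv_out.

End EndAlgebra.


Section Subalgebras.
Variables (K : fieldType) (A : algType K).

Definition is_subalg (B : set A) : Prop := subalg_closed (mem B).

Record subalg := Subalg {
  subalg_set :> set A;
  subalg_closedP : is_subalg subalg_set
}.

Definition meet_set (P : set (set A)) : set A :=
  [set a | forall B, is_subalg B -> P B -> B a].

Fact meet_closed P : is_subalg (meet_set P).
Proof.
split=> [|k a b|a b]; rewrite !inE.
- by move=> B Bs _; case: Bs; rewrite inE.
- move=> Pa Pb B Bs PB; case: (Bs) => _ + _ => /(_ k a b).
  by rewrite !inE; apply; [apply: Pa|apply: Pb].
- move=> Pa Pb B Bs PB; case: (Bs) => _ _ /(_ a b).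
  by rewrite !inE; apply; [apply: Pa|apply: Pb].
Qed.

(* The intersection of all the subalgebras satisfying P. *)
Definition subalg_meet P : subalg := Subalg (meet_closed P).

Definition subalg_gen (X : set A) : subalg := subalg_meet [set B | X `<=` B].

Record alg_of (S : subalg) := AlgOf {
  alg_val :> A;
  alg_valP : alg_val \in subalg_set S
}.

Section Instances.
Variable S : subalg.
HB.instance Definition _ := [isSub for @alg_val S].
HB.instance Definition _ := [Choice of alg_of S by <:].
HB.instance Definition _ :=
  GRing.SubChoice_isSubAlgebra.Build K A (fun x => x \in subalg_set S) (alg_of S)
    (GRing.subalg_closed_semi (subalg_closedP S)).
End Instances.

End Subalgebras.

Section AlgInclusion.
Variables (K : fieldType) (A : algType K) (S T : subalg A).
Hypothesis ST : S `<=` T.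

Fact alg_incl_subproof (a : alg_of S) : (a : A) \in subalg_set T.
Proof. by rewrite inE; apply: ST; have := alg_valP a; rewrite inE. Qed.

Definition alg_incl (a : alg_of S) : alg_of T := AlgOf (alg_incl_subproof a).

Fact alg_incl_linear : linear alg_incl.
Proof. by move=> k a b; apply: val_inj. Qed.
Fact alg_incl_monoid : monoid_morphism alg_incl.
Proof. by split=> [|a b]; apply: val_inj. Qed.
HB.instance Definition _ :=
  GRing.isLinear.Build K (alg_of S) (alg_of T) _ alg_incl alg_incl_linear.
HB.instance Definition _ :=
  GRing.isMonoidMorphism.Build (alg_of S) (alg_of T) alg_incl alg_incl_monoid.
End AlgInclusion.

Section Ideals.
Variable R : pzRingType.
Implicit Types J : set R.

Definition left_ideal J : Prop :=
  zmod_closed (mem J) /\ forall r a, J a -> J (r * a).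
Definition right_ideal J : Prop :=
  zmod_closed (mem J) /\ forall r a, J a -> J (a * r).
Definition two_sided_ideal J : Prop := left_ideal J /\ right_ideal J.

Definition proper_two_sided_ideal J : Prop :=
  [/\ two_sided_ideal J, J <> [set 0] & J <> [set: R]].

Definition ideal_prod (I J : set R) : set R :=
  [set c | exists n (a b : 'I_n -> R),
     [/\ forall i, I (a i), forall i, J (b i) & c = \sum_i a i * b i]].

Definition left_noetherian : Prop :=
  forall I : nat -> set R, (forall n, left_ideal (I n)) ->
    (forall n, I n `<=` I n.+1) -> exists N, forall n, (N <= n)%N -> I n = I N.
Definition right_noetherian : Prop :=
  forall I : nat -> set R, (forall n, right_ideal (I n)) ->
    (forall n, I n `<=` I n.+1) -> exists N, forall n, (N <= n)%N -> I n = I N.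

Definition right_ore (S : set R) : Prop :=
  forall r s, S s -> exists r' s', S s' /\ r * s' = s * r'.
Definition left_ore (S : set R) : Prop :=
  forall r s, S s -> exists r' s', S s' /\ s' * r = r' * s.

Definition invertible (a : R) : Prop := exists b, a * b = 1 /\ b * a = 1.
End Ideals.

(* Two-sided ideals by which the quotient is again a nonzero algebra. *)
Record algideal (R : nzRingType) := AlgIdeal {
  algideal_set :> set R;
  algideal_ideal : two_sided_ideal algideal_set;
  algideal_neqT : algideal_set <> [set: R]
}.

Section QuotientAlgebra.
Variables (K : fieldType) (A : algType K) (J : algideal A).

Definition algideal_pred : pred A := fun a => a \in algideal_set J.
Fact algideal_zmod : zmod_closed algideal_pred.
Proof. by case: (algideal_ideal J) => -[]. Qed.
Definition algideal_zmodClosed : zmodClosed A :=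
  HB.pack algideal_pred (GRing.isZmodClosed.Build A algideal_pred algideal_zmod).

Definition quot_alg : Type := {ideal_quot algideal_zmodClosed}.
HB.instance Definition _ := GRing.Zmodule.on quot_alg.

Definition quot_class (a : A) : quot_alg := \pi_{ideal_quot algideal_zmodClosed} a.

Lemma quot_class_surj (x : quot_alg) : exists a, x = quot_class a.
Proof. by exists (repr x); rewrite /quot_class reprK. Qed.

Lemma quot_classP a b : quot_class a = quot_class b <-> algideal_set J (a - b).
Proof.
rewrite -[algideal_set J _]in_setE -[_ \in _]/((a - b) \in algideal_zmodClosed) Quotient.idealrBE.
by split=> [|/eqP]// /eqP.
Qed.

Lemma quot_classB a b : quot_class (a - b) = quot_class a - quot_class b.
Proof. by rewrite /quot_class !piE. Qed.
Lemma quot_classD a b : quot_class (a + b) = quot_class a + quot_class b.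
Proof. by rewrite /quot_class !piE. Qed.

Let one : quot_alg := quot_class 1.
Let mul (x y : quot_alg) : quot_alg := quot_class (repr x * repr y).
Let scale (k : K) (x : quot_alg) : quot_alg := quot_class (k *: repr x).

Fact quot_mulE a b : mul (quot_class a) (quot_class b) = quot_class (a * b).
Proof.
have H c : algideal_set J (repr (quot_class c) - c).
  by apply/quot_classP; rewrite /quot_class reprK.
apply/quot_classP; case: (algideal_ideal J) => [[[J0 JB] JL] [_ JR]].
set a' := repr _; set b' := repr _.
have -> : a' * b' - a * b = a' * (b' - b) - (a - a') * b.
  by rewrite mulrBr mulrBl opprB addrA subrK.
have := JB (a' * (b' - b)) ((a - a') * b); rewrite !inE; apply.
  by apply/JL/H.
apply: JR; rewrite -opprB -sub0r.
by have := JB 0 (a' - a); rewrite !inE; apply; [rewrite inE in J0|apply: H].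
Qed.

Fact quot_scaleE k a : scale k (quot_class a) = quot_class (k *: a).
Proof.
rewrite /scale -mulr_algl -[k *: a]mulr_algl; apply/quot_classP; rewrite -mulrBr.
case: (algideal_ideal J) => [[_ JL] _]; apply: JL.
by apply/quot_classP; rewrite /quot_class reprK.
Qed.

Fact quot_mulA : associative mul.
Proof.
move=> x y z; have [a ->] := quot_class_surj x; have [b ->] := quot_class_surj y.
by have [c ->] := quot_class_surj z; rewrite !quot_mulE mulrA.
Qed.
Fact quot_mul1 : left_id one mul.
Proof. by move=> x; have [a ->] := quot_class_surj x; rewrite quot_mulE mul1r. Qed.
Fact quot_1mul : right_id one mul.
Proof. by move=> x; have [a ->] := quot_class_surj x; rewrite quot_mulE mulr1. Qed.
Fact quot_mulDl : left_distributive mul +%R.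
Proof.
move=> x y z; have [a ->] := quot_class_surj x; have [b ->] := quot_class_surj y.
by have [c ->] := quot_class_surj z; rewrite -quot_classD !quot_mulE -quot_classD mulrDl.
Qed.
Fact quot_mulDr : right_distributive mul +%R.
Proof.
move=> x y z; have [a ->] := quot_class_surj x; have [b ->] := quot_class_surj y.
by have [c ->] := quot_class_surj z; rewrite -quot_classD !quot_mulE -quot_classD mulrDr.
Qed.
Fact quot_one_neq0 : one != 0.
Proof.
apply/eqP; rewrite -(subrr (quot_class 0)) -quot_classB subrr => /quot_classP.
rewrite subr0 => J1; apply: (algideal_neqT (a := J)); apply/seteqP; split=> // a _.
by case: (algideal_ideal J) => [[_ JL] _]; rewrite -[a]mulr1; apply: JL.
Qed.
HB.instance Definition _ := GRing.Zmodule_isNzRing.Build quot_alg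
  quot_mulA quot_mul1 quot_1mul quot_mulDl quot_mulDr quot_one_neq0.

Fact quot_scaleA a b x : scale a (scale b x) = scale (a * b) x.
Proof. by have [c ->] := quot_class_surj x; rewrite !quot_scaleE scalerA. Qed.
Fact quot_scale1 : left_id 1 scale.
Proof. by move=> x; have [c ->] := quot_class_surj x; rewrite quot_scaleE scale1r. Qed.
Fact quot_scaleDr : right_distributive scale +%R.
Proof.
move=> k x y; have [a ->] := quot_class_surj x; have [b ->] := quot_class_surj y.
by rewrite -quot_classD !quot_scaleE -quot_classD scalerDr.
Qed.
Fact quot_scaleDl x : {morph scale^~ x : a b / a + b}.
Proof.
move=> a b; have [c ->] := quot_class_surj x.
by rewrite !quot_scaleE -quot_classD scalerDl.
Qed.
HB.instance Definition _ := GRing.Zmodule_isLmodule.Build K quot_alg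
  quot_scaleA quot_scale1 quot_scaleDr quot_scaleDl.

Lemma quot_classM a b : quot_class (a * b) = quot_class a * quot_class b.
Proof. exact: esym (quot_mulE a b). Qed.
Lemma quot_classZ (k : K) a : quot_class (k *: a) = k *: quot_class a.
Proof. exact: esym (quot_scaleE k a). Qed.

Fact quot_scaleAl (a : K) (x y : quot_alg) : a *: (x * y) = (a *: x) * y.
Proof.
have [b ->] := quot_class_surj x; have [c ->] := quot_class_surj y.
by rewrite -quot_classM -!quot_classZ -quot_classM scalerAl.
Qed.
HB.instance Definition _ := GRing.Lmodule_isLalgebra.Build K quot_alg quot_scaleAl.
Fact quot_scaleAr (a : K) (x y : quot_alg) : a *: (x * y) = x * (a *: y).
Proof.
have [b ->] := quot_class_surj x; have [c ->] := quot_class_surj y.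
by rewrite -quot_classM -!quot_classZ -quot_classM scalerAr.
Qed.
HB.instance Definition _ := GRing.Lalgebra_isAlgebra.Build K quot_alg quot_scaleAr.

Fact quot_class_linear : linear quot_class.
Proof. by move=> k a b; rewrite quot_classD quot_classZ. Qed.
Fact quot_class_monoid : monoid_morphism quot_class.
Proof. by split=> // a b; rewrite quot_classM. Qed.
HB.instance Definition _ :=
  GRing.isLinear.Build K A quot_alg _ quot_class quot_class_linear.
HB.instance Definition _ :=
  GRing.isMonoidMorphism.Build A quot_alg quot_class quot_class_monoid.

End QuotientAlgebra.

Section QuotientModule.
Variables (R : pzRingType) (M : lmodType R).

Record submod := Submod {
  submod_set :> set M;
  submod_closedP : submod_closed (mem submod_set)
}.

Variable N : submod.

Definition submod_pred : pred M := fun a => a \in submod_set N.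
Fact submod_zmod : zmod_closed submod_pred.
Proof. exact: GRing.submod_closedB (submod_closedP N). Qed.
Definition submod_zmodClosed : zmodClosed M :=
  HB.pack submod_pred (GRing.isZmodClosed.Build M submod_pred submod_zmod).

Definition quot_mod : Type := {ideal_quot submod_zmodClosed}.
HB.instance Definition _ := GRing.Zmodule.on quot_mod.

Definition qmod_class (a : M) : quot_mod := \pi_{ideal_quot submod_zmodClosed} a.

Lemma qmod_class_surj (x : quot_mod) : exists a, x = qmod_class a.
Proof. by exists (repr x); rewrite /qmod_class reprK. Qed.

Lemma qmod_classP a b : qmod_class a = qmod_class b <-> submod_set N (a - b).
Proof.
rewrite -[submod_set N _]in_setE -[_ \in _]/((a - b) \in submod_zmodClosed) Quotient.idealrBE.
by split=> [|/eqP]// /eqP.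
Qed.

Lemma qmod_classD a b : qmod_class (a + b) = qmod_class a + qmod_class b.
Proof. by rewrite /qmod_class !piE. Qed.

Let scale (k : R) (x : quot_mod) : quot_mod := qmod_class (k *: repr x).

Fact qmod_scaleE k a : scale k (qmod_class a) = qmod_class (k *: a).
Proof.
apply/qmod_classP; rewrite -scalerBr -[_ *: _]addr0.
have [N0 NL] := submod_closedP N.
have := NL k (repr (qmod_class a) - a) 0; rewrite !inE; apply; last by rewrite inE in N0.
by apply/qmod_classP; rewrite /qmod_class reprK.
Qed.

Fact qmod_scaleA a b x : scale a (scale b x) = scale (a * b) x.
Proof. by have [c ->] := qmod_class_surj x; rewrite !qmod_scaleE scalerA. Qed.
Fact qmod_scale1 : left_id 1 scale.
Proof. by move=> x; have [c ->] := qmod_class_surj x; rewrite qmod_scaleE scale1r. Qed.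
Fact qmod_scaleDr : right_distributive scale +%R.
Proof.
move=> k x y; have [a ->] := qmod_class_surj x; have [b ->] := qmod_class_surj y.
by rewrite -qmod_classD !qmod_scaleE -qmod_classD scalerDr.
Qed.
Fact qmod_scaleDl x : {morph scale^~ x : a b / a + b}.
Proof.
move=> a b; have [c ->] := qmod_class_surj x.
by rewrite !qmod_scaleE -qmod_classD scalerDl.
Qed.
HB.instance Definition _ := GRing.Zmodule_isLmodule.Build R quot_mod
  qmod_scaleA qmod_scale1 qmod_scaleDr qmod_scaleDl.

Fact qmod_class_linear : linear qmod_class.
Proof. by move=> k a b; rewrite qmod_classD; congr (_ + _); apply: esym (qmod_scaleE k a). Qed.
HB.instance Definition _ :=
  GRing.isLinear.Build R M quot_mod _ qmod_class qmod_class_linear.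

End QuotientModule.

Section IdealModules.
Variables (R : nzRingType) (J : algideal R).

Lemma algidealD (a b : R) : algideal_set J a -> algideal_set J b -> algideal_set J (a + b).
Proof.
have [[[J0 JB] _] _] := algideal_ideal J => Ja Jb.
have JBP x y : algideal_set J x -> algideal_set J y -> algideal_set J (x - y).
  by have := JB x y; rewrite !inE.
by rewrite -[b]opprK; apply: (JBP) => //; rewrite -sub0r; apply: (JBP) => //; rewrite inE in J0.
Qed.
Fact algideal_lsubmod : @submod_closed R R^o (mem (algideal_set J)).
Proof.
have [[[J0 _] JL] _] := algideal_ideal J; split=> // r a b; rewrite !inE => Ja Jb.
by apply: algidealD => //; apply: JL.
Qed.
Fact algideal_rsubmod : @submod_closed R^c (R^c)^o (mem (algideal_set J)).
Proof.
have [[[J0 _] _] [_ JR]] := algideal_ideal J; split=> // r a b; rewrite !inE => Ja Jb.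
by apply: algidealD => //; apply: JR.
Qed.

(* R / J as a left and as a right R-module; right R-modules are left modules
   over the converse ring R^c. *)
Definition quot_lmod : lmodType R :=
  quot_mod (@Submod R R^o (algideal_set J) algideal_lsubmod).
Definition quot_rmod : lmodType R^c :=
  quot_mod (@Submod R^c (R^c)^o (algideal_set J) algideal_rsubmod).
End IdealModules.

Section Modules.
Variable R : pzRingType.

Definition simple_module (M : lmodType R) : Prop :=
  (exists m : M, m <> 0) /\
  forall N : set M, submod_closed (mem N) -> N = [set 0] \/ N = [set: M].

Definition faithful_module (M : lmodType R) : Prop :=
  forall r : R, (forall m : M, r *: m = 0) -> r = 0.

Definition mod_iso (M N : lmodType R) : Prop :=
  exists f : {linear M -> N}, bijective f.
End Modules.

Definition alg_iso (K : fieldType) (A B : algType K) : Prop :=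
  exists f : {lrmorphism A -> B}, bijective f.

Section Fractions.
Variable K : fieldType.

(* theta exhibits Q as a skew field of (left and right) fractions of A. *)
Definition is_skew_fractions (A Q : algType K) (theta : {lrmorphism A -> Q}) :=
  [/\ injective theta,
      forall q : Q, q <> 0 -> invertible q,
      forall q : Q, exists a s, s <> 0 /\ q * theta s = theta a
    & forall q : Q, exists a s, s <> 0 /\ theta s * q = theta a].

(* B is isomorphic to Frac(A): such a skew field exists, and any is isomorphic
   to B (skew fields of fractions are unique up to isomorphism). *)
Definition iso_Frac (B A : algType K) : Prop :=
  (exists (Q : algType K) (theta : {lrmorphism A -> Q}), is_skew_fractions theta) /\
  (forall (Q : algType K) (theta : {lrmorphism A -> Q}),
     is_skew_fractions theta -> alg_iso B Q).

(* theta exhibits L as the right localization (right Ore quotient ring) of A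
   at S: S becomes invertible, the elements of L are the theta(a) theta(s)^-1,
   and the kernel of theta is the S-torsion of A. *)
Definition is_right_localization (A L : algType K) (S : set A)
    (theta : {lrmorphism A -> L}) : Prop :=
  [/\ forall s, S s -> invertible (theta s),
      forall l, exists a s, S s /\ l * theta s = theta a
    & forall a, theta a = 0 <-> exists s, S s /\ a * s = 0].

(* For a right module N over R, (r : R^c) *: n is the product n r.  Here
   phi : R -> RS is the right localization of R at S, so that S acts invertibly
   on every RS-module; theta exhibits L as the right localization of N at S: the
   elements of L are the theta(n) s^-1, and the kernel of theta is the S-torsion
   of N. *)
Definition is_right_module_localization (R RS : nzRingType) (S : set R)
    (phi : {rmorphism R -> RS}) (N : lmodType R^c) (L : lmodType RS^c)
    (theta : {additive N -> L}) : Prop :=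
  [/\ forall (r : R) n, theta ((r : R^c) *: n) = (phi r : RS^c) *: theta n,
      forall l, exists n s, S s /\ (phi s : RS^c) *: l = theta n
    & forall n, theta n = 0 <-> exists2 s : R, S s & (s : R^c) *: n = 0].
End Fractions.

(* B is the right localization of A at S by way of iota : A -> B. *)
Definition iso_right_localization (K : fieldType) (A B : algType K) (S : set A)
    (iota : {lrmorphism A -> B}) : Prop :=
  (exists (L : algType K) (theta : {lrmorphism A -> L}),
     is_right_localization S theta) /\
  (forall (L : algType K) (theta : {lrmorphism A -> L}),
     is_right_localization S theta ->
     exists2 g : {lrmorphism L -> B}, bijective g & forall a, g (theta a) = iota a).

(* The sum of the U i, which are meant to be additive subgroups of M, is direct
   and equal to W. *)
Definition direct_sum (M : zmodType) (U : nat -> set M) (W : set M) : Prop :=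
  W = [set w | exists n (u : nat -> M),
         (forall i, U i (u i)) /\ w = \sum_(i < n) u i] /\
  (forall n (u : nat -> M), (forall i, U i (u i)) -> \sum_(i < n) u i = 0 ->
     forall i, (i < n)%N -> u i = 0).

Section Calkin.
Variables (K : fieldType) (V : infLmodType K).

Definition finrank : set (End V) := [set f | findim (range f)].

Lemma range_submod (f : End V) : submod_closed (mem (range f)).
Proof.
split=> [|a u v]; rewrite !inE; first by exists 0 => //; rewrite linear0.
by move=> [x _ <-] [y _ <-]; exists (a *: x + y) => //; rewrite linearP.
Qed.

Lemma finrankP (f : End V) : finrank f <-> exists s, forall v, lspan s (f v).
Proof.
split=> [[s E]|[s H]].
  by exists s => v; rewrite -E; exists v.
by apply: (sub_findim (s := s) (range_submod f)) => _ [v _ <-].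
Qed.

Fact finrank_ideal : two_sided_ideal finrank.
Proof.
have Z : zmod_closed (mem finrank).
  split=> [|f g]; rewrite !inE.
    by apply/finrankP; exists [::] => v; exists (fun=> 0); rewrite big_ord0.
  move=> /finrankP[s Hs] /finrankP[t Ht]; apply/finrankP; exists (s ++ t) => v.
  apply: lspan_cat => //; rewrite end_oppE -scaleN1r -[_ *: _]addr0.
  have [t0 tl] := lspan_submod t.
  by have := tl (-1) (g v) 0; rewrite !inE; apply; [apply: Ht|rewrite inE in t0].
split; split=> // r f /finrankP[s Hs]; apply/finrankP.
  exists (map r s) => v; have [c E] := Hs v; exists c.
  rewrite end_mulE E linear_sum size_map; apply: eq_bigr => i _.
  by rewrite linearZ (nth_map 0).
by exists s => v; apply: Hs.
Qed.
Fact finrank_neqT : finrank <> [set: End V].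
Proof.
move=> E; have : finrank 1 by rewrite E.
case=> s Es; apply: (@infdim K V); exists s; rewrite -Es.
by apply/seteqP; split=> // v _; exists v.
Qed.

(* C(V), and C(A) for a subalgebra A of End(V) *)
Definition finrank_algideal : algideal (End V) :=
  AlgIdeal finrank_ideal finrank_neqT.

Section SubFinrank.
Variable A : subalg (End V).

Definition sub_finrank : set (alg_of A) := [set a : alg_of A | finrank (alg_val a)].

Fact sub_finrank_ideal : two_sided_ideal sub_finrank.
Proof.
have [[[F0 FB] FL] [_ FR]] := finrank_ideal.
have Z : zmod_closed (mem sub_finrank).
  split=> [|a b]; rewrite !inE; first by move: F0; rewrite inE.
  by have := FB (val a) (val b); rewrite !inE.
by split; split=> // r a Fa; [apply: FL|apply: FR].
Qed.
Fact sub_finrank_neqT : sub_finrank <> [set: alg_of A].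
Proof.
move=> E; apply: finrank_neqT; apply/seteqP; split=> // f _.
have [[_ FL] _] := finrank_ideal; rewrite -[f]mulr1; apply: FL.
by have : sub_finrank 1 by rewrite E.
Qed.
Definition sub_finrank_algideal : algideal (alg_of A) :=
  AlgIdeal sub_finrank_ideal sub_finrank_neqT.
End SubFinrank.

(* F(V) *)
Definition fredholm : set (End V) :=
  [set f | findim [set v | f v = 0] /\ fincodim (range f)].

Definition calkin : algType K := quot_alg finrank_algideal.
Definition calkin_class : End V -> calkin := @quot_class K (End V) finrank_algideal.

(* G(V) *)
Definition calkin_group : set calkin := calkin_class @` fredholm.

Section FracV.
Variable A : subalg (End V).

Definition calkin_image : set calkin := calkin_class @` A.

Definition frac_family : set (set calkin) :=
  [set B | [/\ B `<=` calkin_group `|` [set 0], calkin_image `<=` B &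
    forall a b, calkin_image a -> a <> 0 -> a * b = 1 -> b * a = 1 -> B b]].

(* frac_V(A) makes sense and exists. *)
Definition frac_defined : Prop :=
  (forall f, subalg_set A f -> ~ finrank f -> fredholm f) /\
  exists B, is_subalg B /\ frac_family B.

Definition fracV : subalg calkin := subalg_meet frac_family.
End FracV.

Section NaturalModule.

(* V as a left A-module *)
Definition nat_module (A : subalg (End V)) : Type := V.

Variable A : subalg (End V).
Local Notation natA := (nat_module A).
HB.instance Definition _ := GRing.Zmodule.on natA.

Let scale (a : alg_of A) (v : natA) : natA := (alg_val a : End V) v.

Fact nat_scaleA a b v : scale a (scale b v) = scale (a * b) v.
Proof. by []. Qed.
Fact nat_scale1 : left_id 1 scale.
Proof. by []. Qed.
Fact nat_scaleDr : right_distributive scale +%R.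
Proof. by move=> a v w; rewrite /scale linearD. Qed.
Fact nat_scaleDl v : {morph scale^~ v : a b / a + b}.
Proof. by []. Qed.
HB.instance Definition _ := GRing.Zmodule_isLmodule.Build (alg_of A) natA
  nat_scaleA nat_scale1 nat_scaleDr nat_scaleDl.
End NaturalModule.

End Calkin.

Section IntegroDifferential.
Variable K : fieldType.
Local Notation E := (End {poly K}).

Definition integ (p : {poly K}) : {poly K} :=
  \sum_(i < size p) (p`_i / i.+1%:R) *: 'X^(i.+1).

Lemma coef_integ p i : (integ p)`_i = if i is j.+1 then p`_j / j.+1%:R else 0.
Proof.
rewrite coef_sum; case: i => [|j].
  by rewrite big1 // => i _; rewrite coefZ coefXn mulr0.
have [lt|ge] := ltnP j (size p).
  rewrite (bigD1 (Ordinal lt)) //= coefZ coefXn eqxx mulr1 big1 ?addr0 // => i ne.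
  rewrite coefZ coefXn eqSS; case: eqP => [e|_]; last by rewrite mulr0.
  by case/eqP: ne; apply: val_inj.
rewrite nth_default // mul0r big1 // => i _; rewrite coefZ coefXn eqSS.
by rewrite gtn_eqF ?mulr0 // (leq_trans (ltn_ord i)).
Qed.

Fact integ_linear : linear integ.
Proof.
move=> a p q; apply/polyP=> -[|i]; rewrite coefD coefZ !coef_integ.
  by rewrite mulr0 addr0.
by rewrite coefD coefZ mulrDl mulrA.
Qed.
Fact mulX_linear : linear (fun p : {poly K} => 'X * p).
Proof. by move=> a p q; rewrite mulrDr -scalerAr. Qed.
Fact deriv_linear : linear (@deriv K).
Proof. exact: linearP. Qed.

Definition opX : E := mkEnd mulX_linear.
Definition opD : E := mkEnd deriv_linear.
Definition opI : E := mkEnd integ_linear.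

Definition I1 : subalg E := subalg_gen [set opX; opD; opI].
Definition weylA1 : subalg E := subalg_gen [set opX; opD].

Definition eij (i j : nat) : E := opI ^+ i * opD ^+ j - opI ^+ i.+1 * opD ^+ j.+1.

Definition idealF : set E :=
  [set f | exists n (c : nat -> nat -> K),
     f = \sum_(i < n) \sum_(j < n) c i j *: eij i j].
(* E_{N,i} and E_{i,N} *)
Definition Ecol (i : nat) : set E :=
  [set f | exists n (c : nat -> K), f = \sum_(j < n) c j *: eij j i].
Definition Erow (i : nat) : set E :=
  [set f | exists n (c : nat -> K), f = \sum_(j < n) c j *: eij i j].

(* I_1^0; for a bijective s, s^-1 is the inverse map. *)
Definition I10 : set E := [set s | subalg_set I1 s /\ bijective s].

(* The elements s^-1 f and f s^-1.  For a right I_1-submodule X of End(K[x]), the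
   set of the f s^-1 is a right localization of X at I_1^0, as X has no
   I_1^0-torsion. *)
Definition lfractions (X : set E) : set E :=
  [set g | exists s f, [/\ I10 s, X f & g = s^-1 * f]].
Definition rfractions (X : set E) : set E :=
  [set g | exists s f, [/\ I10 s, X f & g = f * s^-1]].

Definition tI1 : subalg E := subalg_gen (I1 `|` [set s^-1 | s in I10]).

(* The elements of A that lie in X, as a subset of the type of A *)
Definition inside (A : subalg E) (X : set E) : set (alg_of A) :=
  [set a | X (alg_val a)].

Fact I1_sub_tI1 : I1 `<=` tI1.
Proof. by move=> f If B Bs; apply; left. Qed.
Definition I1_incl : {lrmorphism alg_of I1 -> alg_of tI1} := alg_incl I1_sub_tI1.

Lemma gen_sub (X : set E) : X `<=` subalg_gen X.
Proof. by move=> f Xf B Bs; apply. Qed.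

Definition Kd : subalg E := subalg_gen [set opD].

Fact Kd_sub_I1 : Kd `<=` I1.
Proof.
move=> f; apply; first exact: subalg_closedP.
by move=> _ ->; apply: gen_sub; left; right.
Qed.

Fact opI_I1 : opI \in subalg_set I1.
Proof. by rewrite inE; apply: gen_sub; right. Qed.
Definition opI1 : alg_of I1 := AlgOf opI_I1.

(* The right ideal of I_1 generated by the integral, as a submodule of the
   right regular module. *)
Definition int_I1 : set (alg_of I1) := [set b | exists a, b = opI1 * a].
Fact int_I1_submod :
  @submod_closed (alg_of I1)^c ((alg_of I1)^c)^o (mem int_I1).
Proof.
split=> [|r a b]; rewrite !inE; first by exists 0; rewrite mulr0.
move=> [a' ->] [b' ->]; exists (a' * r + b').
by rewrite mulrDr mulrA.
Qed.
Definition int_I1_mod : submod ((alg_of I1)^c)^o := Submod int_I1_submod.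

Definition I1_mod_int : lmodType (alg_of I1)^c := quot_mod int_I1_mod.

Definition Kd_class (p : alg_of Kd) : I1_mod_int :=
  qmod_class int_I1_mod (alg_incl Kd_sub_I1 p).

Lemma Kd_horner (p : E) : subalg_set Kd p -> exists q : {poly K}, p = horner_alg opD q.
Proof.
move=> Kp; apply: (Kp [set p | exists q : {poly K}, p = horner_alg opD q]).
  split=> [|k a b|a b]; rewrite !inE; first by exists 1; rewrite rmorph1.
    by move=> [q ->] [r ->]; exists (k *: q + r);
    rewrite -mul_polyC rmorphD rmorphM /= horner_algC mulr_algl.
  by move=> [q ->] [r ->]; exists (q * r); rewrite rmorphM.
by move=> _ ->; exists 'X; rewrite /= horner_algX.
Qed.

Lemma horner_opD (q : {poly K}) :
  horner_alg opD q = \sum_(i < size q) q`_i *: opD ^+ i.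
Proof.
rewrite /horner_alg /= /horner_morph horner_coef size_map_poly.
apply: eq_bigr => i _.
by rewrite coef_map /= mulr_algl.
Qed.

Lemma opD_exp i (p : {poly K}) : (opD ^+ i) p = p^`(i).
Proof.
by elim: i => [|i IH] //; rewrite exprS end_mulE IH derivnS.
Qed.

Lemma opDI (charK0 : [pchar K] =i pred0) : opD * opI = 1 :> E.
Proof.
apply: EndP => p; rewrite end_mulE; apply/polyP=> i.
rewrite coef_deriv coef_integ /= -[LHS]mulr_natr divfK //.
by have /pcharf0P -> := charK0.
Qed.

(* I_1 is the direct sum of K[D] and I I_1, where D and I are the derivation
   and the integral. *)
Section Decomposition.
Hypothesis charK0 : [pchar K] =i pred0.

Let natK_neq0 n : n.+1%:R != 0 :> K.
Proof. by have /pcharf0P -> := charK0. Qed.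

Lemma opIDX : opI * (opD * opX) = opX.
Proof.
apply: EndP => p; rewrite !end_mulE; apply/polyP=> -[|i]; rewrite /= coef_integ ?coefXM //.
by rewrite coef_deriv -[X in X / _]mulr_natr mulfK ?coefXM.
Qed.

Lemma opDnX i : opD ^+ i.+1 * opX = opX * opD ^+ i.+1 + i.+1%:R *: opD ^+ i.
Proof.
apply: EndP => p; rewrite end_addE end_scaleE !end_mulE !opD_exp /=.
elim: i => [|i IH].
  by rewrite !derivn0 derivM derivX mul1r scale1r addrC.
rewrite derivnS IH derivD derivM derivX mul1r derivZ -!derivnS [p^`(i.+1) + _]addrC -addrA.
by congr (_ + _); rewrite -{1}[p^`(i.+1)]scale1r -scalerDl -[i.+2%:R]natr1 addrC.
Qed.

Let D : set E :=
  [set f | exists p a, [/\ subalg_set Kd p, subalg_set I1 a & f = p + opI * a]].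

Let DP f (p a : E) : subalg_set Kd p -> subalg_set I1 a -> f = p + opI * a -> D f.
Proof. by move=> *; exists p, a. Qed.

Let sub1 (S : subalg E) : subalg_set S 1.
Proof. by have [] := subalg_closedP S; rewrite inE. Qed.
Let subL (S : subalg E) k a b : subalg_set S a -> subalg_set S b -> subalg_set S (k *: a + b).
Proof. by have [_ + _] := subalg_closedP S; move=> /(_ k a b); rewrite !inE; apply. Qed.
Let subM (S : subalg E) a b : subalg_set S a -> subalg_set S b -> subalg_set S (a * b).
Proof. by have [_ _] := subalg_closedP S; move=> /(_ a b); rewrite !inE; apply. Qed.
Let sub0 (S : subalg E) : subalg_set S 0.
Proof. by have := subL (-1) (sub1 S) (sub1 S); rewrite scaleN1r addNr. Qed.
Let subX (S : subalg E) a n : subalg_set S a -> subalg_set S (a ^+ n).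
Proof. by move=> Sa; elim: n => [|n IH]; [exact: sub1|rewrite exprS; apply: subM]. Qed.

Let KdD : subalg_set Kd opD.
Proof. exact: gen_sub. Qed.
Let I1X : subalg_set I1 opX.
Proof. by apply: gen_sub; left; left. Qed.
Let I1D : subalg_set I1 opD.
Proof. by apply: gen_sub; left; right. Qed.
Let I1I : subalg_set I1 opI.
Proof. by apply: gen_sub; right. Qed.

Let DL k f g : D f -> D g -> D (k *: f + g).
Proof.
move=> [p [a [Kp Ia ->]]] [q [b [Kq Ib ->]]].
apply: (@DP _ (k *: p + q) (k *: a + b)); rewrite ?subL //.
  exact: subL.
  exact: subL.
by rewrite scalerDr addrACA mulrDr scalerAr.
Qed.

Let D0 : D 0.
Proof. by apply: (@DP _ 0 0); rewrite ?mulr0 ?addr0. Qed.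

Let Dpow g : (forall i, D (opD ^+ i * g)) -> subalg_set I1 g ->
  forall f, D f -> D (f * g).
Proof.
move=> Dg Ig _ [p [a [/Kd_horner[q ->] Ia ->]]].
rewrite mulrDl -[X in X + _]scale1r; apply: DL; last first.
  by apply: (@DP _ 0 (a * g)); rewrite ?add0r ?mulrA //; apply: subM.
rewrite horner_opD mulr_suml.
apply: (big_ind D) => [|x y Dx Dy|i _] //.
  by rewrite -[x]scale1r; apply: DL.
by rewrite -scalerAl -[_ *: _]addr0; apply: DL.
Qed.

Let I1_D f : subalg_set I1 f -> D f.
Proof.
move=> If; pose T : set E := [set b | forall c, D c -> D (c * b)].
suff Tf : T f.
  by rewrite -[f]mul1r; apply: Tf; apply: (@DP _ 1 0); rewrite ?mulr0 ?addr0.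
apply: (If T).
  split=> [|k a b|a b]; rewrite !inE.
  - by move=> c Dc; rewrite mulr1.
  - move=> Ta Tb c Dc; rewrite mulrDr -scalerAr.
    by apply: DL; [apply: Ta|apply: Tb].
  - by move=> Ta Tb c Dc; rewrite mulrA; apply: Tb; apply: Ta.
move=> _ [[->|->]|->] c Dc; apply: Dpow Dc => //; case=> [|i].
- rewrite mul1r -opIDX; apply: (@DP _ 0 (opD * opX)); rewrite ?add0r //.
  exact: subM.
- rewrite opDnX addrC; apply: DL.
    by apply: (@DP _ (opD ^+ i) 0); rewrite ?mulr0 ?addr0 //; apply: subX.
  apply: (@DP _ 0 (opD * opX * opD ^+ i.+1)); rewrite ?add0r //.
    by apply: subM; [apply: subM|apply: subX].
  by rewrite mulrA opIDX.
- by apply: (@DP _ opD 0); rewrite ?mul1r ?mulr0 ?addr0.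
- by apply: (@DP _ (opD ^+ i.+2) 0); rewrite -?exprSr ?mulr0 ?addr0 //; apply: subX.
- by apply: (@DP _ 0 1); rewrite ?mul1r ?mulr1 ?add0r.
- apply: (@DP _ (opD ^+ i) 0); rewrite ?mulr0 ?addr0 //; first exact: subX.
  by rewrite exprSr -mulrA opDI ?mulr1.
Qed.

Let Kd_int0 (p a : E) : subalg_set Kd p -> p = opI * a -> p = 0.
Proof.
move=> /Kd_horner[q Ep] Ea.
suff q0 : q = 0 by rewrite Ep q0 rmorph0.
apply/polyP=> n; rewrite coef0.
have [lt|/leq_sizeP->//] := ltnP n (size q).
have : (p 'X^n)`_0 = 0 by rewrite Ea end_mulE /= coef_integ.
rewrite Ep horner_opD.
have sumE (m : nat) (F : 'I_m -> E) v : (\sum_i F i) v = \sum_i (F i v).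
  elim: m F => [|m IH] F; first by rewrite !big_ord0.
  by rewrite !big_ord_recl end_addE IH.
rewrite sumE coef_sum (bigD1 (Ordinal lt)) //= big1 => [|i ne].
  rewrite addr0 opD_exp coefZ coef_derivn addn0 coefXn eqxx ffactnn.
  move=> /eqP; rewrite mulf_eq0 => /orP[/eqP//|].
  have /pcharf0P -> := charK0; by rewrite eqn0Ngt fact_gt0.
rewrite opD_exp coefZ coef_derivn addn0 coefXn.
by rewrite (negbTE (_ : nat_of_ord i != n)) ?mul0rn ?mulr0.
Qed.

Lemma Kd_class_bij : bijective (@Kd_class).
Proof.
have sur x : exists p, x = Kd_class p.
  have [b ->] := qmod_class_surj x.
  have [|p [a [Kp Ia Eb]]] := I1_D (f := alg_val b).
    by have := alg_valP b; rewrite inE.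
  have Kp' : p \in subalg_set Kd by rewrite inE.
  have Ia' : a \in subalg_set I1 by rewrite inE.
  exists (AlgOf Kp'); apply/qmod_classP; exists (AlgOf Ia').
  suff e : alg_val b - p = opI * a by apply: val_inj; apply: e.
  by rewrite Eb addrC addKr.
exists (fun x => sval (cid (sur x))) => [p|x]; last by case: cid => q /= ->.
case: cid => q /= /qmod_classP[a Ea].
have {}Ea : alg_val p - alg_val q = opI * alg_val a by exact: (congr1 val Ea).
apply: val_inj => /=; apply/eqP; rewrite eq_sym -subr_eq0; apply/eqP.
apply: Kd_int0 Ea; rewrite addrC -scaleN1r.
by apply: subL; [have := alg_valP q|have := alg_valP p]; rewrite inE.
Qed.

End Decomposition.

(* K[D] with the right I_1-module structure of I_1 / I I_1 transported along
   the bijection p |-> p + I I_1. *)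
Definition Kd_mod (charK0 : [pchar K] =i pred0) : Type := alg_of Kd.

Section KdModule.
Variable charK0 : [pchar K] =i pred0.
Local Notation Kd' := (Kd_mod charK0).
HB.instance Definition _ := GRing.Zmodule.on Kd'.

Definition Kd_class_inv (x : I1_mod_int) : Kd' :=
  let: exist g _ := cid (let: Bijective g gK Kg := Kd_class_bij charK0 in
    ex_intro (fun g => cancel Kd_class g /\ cancel g Kd_class) g (conj gK Kg))
  in g x.

Lemma Kd_classK : cancel Kd_class Kd_class_inv.
Proof. by rewrite /Kd_class_inv; case: cid => g []. Qed.
Lemma Kd_class_invK : cancel Kd_class_inv Kd_class.
Proof. by rewrite /Kd_class_inv; case: cid => g []. Qed.

Lemma Kd_classD (p q : alg_of Kd) : Kd_class (p + q) = Kd_class p + Kd_class q.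
Proof. by rewrite /Kd_class raddfD qmod_classD. Qed.

Let scale (r : (alg_of I1)^c) (p : Kd') : Kd' := Kd_class_inv (r *: Kd_class p).

Fact Kd_scaleA a b p : scale a (scale b p) = scale (a * b) p.
Proof. by rewrite /scale Kd_class_invK scalerA. Qed.
Fact Kd_scale1 : left_id 1 scale.
Proof. by move=> p; rewrite /scale scale1r Kd_classK. Qed.
Fact Kd_scaleDr : right_distributive scale +%R.
Proof.
move=> a p q; apply: (can_inj Kd_classK).
by rewrite Kd_classD !Kd_class_invK Kd_classD scalerDr.
Qed.
Fact Kd_scaleDl p : {morph scale^~ p : a b / a + b}.
Proof.
move=> a b; apply: (can_inj Kd_classK).
by rewrite Kd_classD !Kd_class_invK scalerDl.
Qed.
HB.instance Definition _ := GRing.Zmodule_isLmodule.Build (alg_of I1)^c Kd'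
  Kd_scaleA Kd_scale1 Kd_scaleDr Kd_scaleDl.
End KdModule.

(* L is a right localization of N at I_1^0. *)
Definition I10_localization (N : lmodType (alg_of I1)^c)
    (L : lmodType (alg_of tI1)^c) : Prop :=
  exists theta : {additive N -> L},
    is_right_module_localization (inside (A := I1) I10) I1_incl theta.

End IntegroDifferential.

Arguments I10 K : clear implicits.
Arguments idealF K : clear implicits.
Arguments Ecol K i : clear implicits.
Arguments Erow K i : clear implicits.
Arguments eij K i j : clear implicits.
Arguments inside {K} A X.

(* Main.v *)
Require Import Defs.
From HB Require Import structures.
From mathcomp Require Import all_boot all_order all_algebra.
From mathcomp Require Import boolp classical_sets.
From mathcomp Require Import zify.

(** Let D, I and X be the derivation, the integral and the multiplication by x, and
let u_k = x^k / k!.  Then I u_k = u_(k+1), D u_(k+1) = u_k, D u_0 = 0 and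
e_ij u_k = (j == k) u_i, so that F is the set of maps whose matrix in the basis
(u_k) has finitely many nonzero entries.  As every vector is a finite combination
of the u_k, F is exactly the set of the f with f I^N = 0 for some N (idealFP); in
particular F is a left ideal of the algebra of all endomorphisms.

The structure of I_1 is reduced to that of the algebra T of the band operators
sum_(i < n) I^i p_i(H), where p(H) multiplies u_k by p(k): for each a in I_1 there
is an N with a I^N in T (I1_opIn_lower), and a is determined by a I^N modulo F.
A nonzero element of T raises all large degrees by the same n (lower_alg_growth),
as its top nonzero coefficient p_i has finitely many roots among the integers.  Two facts
follow.  For a in I_1 outside F, one can correct a multiple of a by an element
of F so as to get a map that preserves degrees, hence is bijective:
a r + g is in I_1^0 (I1_Fredholm).  And T is a domain in which the sums with
i < n and deg p_i < n form a space of dimension n^2; since 2 n^2 exceeds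
(n + m)^2 for n > 3 m, two nonzero elements have nonzero common multiples on each side
(lower_alg_right_ore, lower_alg_left_ore).

The Ore condition for I_1^0 follows: to give a common multiple a denominator in
I_1^0, it is corrected by an element of F, and s^-1 F is contained in F.  Thus every element of
tI_1 has the form a s^-1 (tI1P), its elements of finite rank are those of
F I_1^0^-1 (rfractionsF), and all others are invertible modulo finite rank
(tI1_inv).  With C the ideal of the elements of finite rank, tI_1 / C is therefore
a skew field.  Multiplying by a power of D moves I_1
into A_1 + F (I1_weylr, I1_weyll), whence the elements of this skew field are left
and right fractions of elements of A_1.

The rest uses only the matrix units e_ij.  Any nonzero two-sided ideal contains
them, hence C.  A simple module either is killed by e_00, hence by C, and is then
the skew field, or contains a nonzero m = e_00 m whose annihilator is that of e_00
(two_simple_modules); applied to tI_1 and to its converse this classifies the simple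
modules on both sides.  On the left the second module is K[x] = tI_1 u_0, on the
right it is e_00 tI_1, the localization of I_1 / I I_1, since
e_00 = 1 - I D has the right annihilator I I_1 in I_1. *)

Set Implicit Arguments.
Unset Strict Implicit.
Unset Printing Implicit Defensive.

Import GRing.Theory.
Local Open Scope ring_scope.
Local Open Scope classical_set_scope.

(** * Isomorphisms given by their graphs *)

(** A correspondence is the natural form of an isomorphism between two modules of
fractions: numerators and denominators are related before any choice is made. *)
Lemma mod_iso_graph (R : pzRingType) (M N : lmodType R) (G : M -> N -> Prop) :
  (forall a u v u' v', G u u' -> G v v' -> G (a *: u + v) (a *: u' + v')) ->
  (forall u, exists u', G u u') -> (forall u', exists u, G u u') ->
  (forall u u', G u u' -> (u = 0 <-> u' = 0)) ->
  exists2 f : {linear M -> N}, bijective f & forall u, G u (f u).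
Proof.
move=> Glin Gtot Gsurj G0.
have Guniq u u' v v' : G u u' -> G v v' -> (u = v <-> u' = v').
  move=> Gu Gv; have := G0 _ _ (Glin (-1) _ _ _ _ Gu Gv).
  by rewrite !scaleN1r ![- _ + _]addrC => e; split=> [/eqP|/eqP];
    rewrite eq_sym -subr_eq0 => /eqP/e/eqP; rewrite subr_eq0 => /eqP.
pose f u := sval (cid (Gtot u)); have fP u : G u (f u) := svalP (cid (Gtot u)).
have lf : linear f.
  move=> a u v; apply/(Guniq _ _ _ _ (fP _) (Glin a _ _ _ _ (fP u) (fP v))) => //.
pose F : {linear M -> N} := HB.pack f (GRing.isLinear.Build R M N _ f lf).
exists F => //; exists (fun u' => sval (cid (Gsurj u'))) => u /=.
  by case: cid => v /= Gv; apply/(Guniq _ _ _ _ Gv (fP u)).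
by case: cid => v /= Gv; apply/(Guniq _ _ _ _ (fP v) Gv).
Qed.

Lemma alg_iso_graph (K : fieldType) (A B : algType K) (G : A -> B -> Prop) :
  (forall (k : K) u v u' v', G u u' -> G v v' -> G (k *: u + v) (k *: u' + v')) ->
  G 1 1 -> (forall u v u' v', G u u' -> G v v' -> G (u * v) (u' * v')) ->
  (forall u, exists u', G u u') -> (forall u', exists u, G u u') ->
  (forall u u', G u u' -> (u = 0 <-> u' = 0)) ->
  exists2 f : {lrmorphism A -> B}, bijective f & forall u, G u (f u).
Proof.
move=> Glin G1 Gmul Gtot Gsurj G0.
have [f fb fP] := mod_iso_graph Glin Gtot Gsurj G0.
have Guniq u u' v' : G u u' -> G u v' -> u' = v'.
  move=> Gu Gv; have := G0 _ _ (Glin (-1) _ _ _ _ Gu Gv).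
  rewrite !scaleN1r addNr => -[/(_ erefl)/eqP + _].
  by rewrite addrC subr_eq0 eq_sym => /eqP.
have fm : monoid_morphism f.
  by split=> [|u v]; [apply: (Guniq 1)|apply: (Guniq (u * v)) => //; apply: Gmul].
pose F : {lrmorphism A -> B} :=
  HB.pack (f : A -> B) (GRing.isLinear.Build K A B _ f (linearP f))
    (GRing.isMonoidMorphism.Build A B f fm).
by exists F.
Qed.

Lemma mod_iso_sym (R : pzRingType) (M N : lmodType R) : mod_iso M N -> mod_iso N M.
Proof.
move=> [f [g fK gK]].
have gl : linear g by move=> a u v; apply: (can_inj fK); rewrite linearP !gK.
pose G : {linear N -> M} := HB.pack g (GRing.isLinear.Build R N M _ g gl).
by exists G; exists f => x; rewrite ?fK ?gK /= ?fK ?gK.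
Qed.

Lemma mod_iso_trans (R : pzRingType) (M N P : lmodType R) :
  mod_iso M N -> mod_iso N P -> mod_iso M P.
Proof.
by move=> [f fb] [g gb]; exists (g \o f : {linear M -> P}); apply: bij_comp.
Qed.

Lemma simple_mod_iso (R : pzRingType) (M N : lmodType R) :
  mod_iso M N -> simple_module M -> simple_module N.
Proof.
move=> [f [g fK gK]] [[m m0] sM]; split.
  by exists (f m) => fm; apply: m0; rewrite -[m]fK fm -(linear0 f) fK.
move=> P [P0 PL]; have := sM (f @^-1` P); case.
- split=> [|a u v]; first by move: P0; rewrite !inE /= linear0.
  by have := PL a (f u) (f v); rewrite !inE /= linearP.
- move=> E; left; apply/seteqP; split=> [p Pp|_ ->]; last by rewrite inE in P0.
  have : (f @^-1` P) (g p) by rewrite /= gK.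
  by rewrite E /= => g0; rewrite -[p]gK g0 linear0.
move=> E; right; apply/seteqP; split=> // p _.
have : (f @^-1` P) (g p) by rewrite E.
by rewrite /= gK.
Qed.

Lemma faithful_mod_iso (R : pzRingType) (M N : lmodType R) :
  mod_iso M N -> faithful_module M -> faithful_module N.
Proof.
move=> [f [g fK gK]] FM r rN; apply: FM => m.
by apply: (can_inj fK); rewrite linear0 linearZ_LR; apply: rN.
Qed.

Lemma simple_gen (R : pzRingType) (M : lmodType R) (m : M) :
  simple_module M -> m <> 0 -> forall u, exists r, u = r *: m.
Proof.
move=> [_ sM] m0 u; have := sM [set u | exists r, u = r *: m]; case.
- split=> [|a v w]; rewrite !inE; first by exists 0; rewrite scale0r.
  by move=> [r ->] [s ->]; exists (a * r + s); rewrite scalerDl scalerA.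
- move=> E; case: m0; have : [set u | exists r, u = r *: m] m by exists 1; rewrite scale1r.
  by rewrite E.
by move=> E; have : [set u | exists r, u = r *: m] u by rewrite E.
Qed.

Lemma simple_iso_ann (R : pzRingType) (M N : lmodType R) (m : M) (n : N) :
  simple_module M -> simple_module N -> m <> 0 -> n <> 0 ->
  (forall r : R, r *: m = 0 <-> r *: n = 0) -> mod_iso M N.
Proof.
move=> sM sN m0 n0 mn; have [||||h hb _] := @mod_iso_graph R M N
  (fun u v => exists r, u = r *: m /\ v = r *: n); last by exists h.
- move=> a u v u' v' [r [-> ->]] [s [-> ->]]; exists (a * r + s).
  by rewrite !scalerDl !scalerA.
- by move=> u; have [r ->] := simple_gen sM m0 u; exists (r *: n), r.
- by move=> u; have [r ->] := simple_gen sN n0 u; exists (r *: m), r.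
- by move=> u v [x [-> ->]]; apply: mn.
Qed.

(** The annihilators of m and of n are both the set of the r with r e = 0: if r e
is nonzero, then s r m = s r e m = e m = m for a suitable s, so r m is nonzero. *)
Lemma simple_iso_idem (R : pzRingType) (M N : lmodType R) (e : R) (m : M) (n : N) :
  simple_module M -> simple_module N -> m <> 0 -> n <> 0 ->
  e *: m = m -> e *: n = n ->
  (forall r : R, r * e <> 0 -> exists s, s * (r * e) = e) -> mod_iso M N.
Proof.
move=> sM sN m0 n0 em en he.
have ann (P : lmodType R) (p : P) : p <> 0 -> e *: p = p ->
    forall r : R, r *: p = 0 <-> r * e = 0.
  move=> p0 ep r; split=> [rp|re0]; last by rewrite -ep scalerA re0 scale0r.
  apply: contrapT => /he[s se]; apply: p0.
  by rewrite -ep -se -!scalerA ep rp scaler0.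
apply: (simple_iso_ann sM sN m0 n0) => r.
by rewrite (ann _ _ m0 em) (ann _ _ n0 en).
Qed.

(** * Uniqueness of localizations *)

(** Two elements correspond when they have a common numerator and denominator.
Writing theta(s)^-1 theta(r) as a fraction gives common multiples of r and s, up to
elements of the kernel, which is the same for theta and theta'. *)
Lemma right_localization_uniq (K : fieldType) (A L L' : algType K) (S : set A)
    (theta : {lrmorphism A -> L}) (theta' : {lrmorphism A -> L'}) :
  mulr_closed (mem S) ->
  is_right_localization S theta -> is_right_localization S theta' ->
  exists2 g : {lrmorphism L -> L'}, bijective g & forall a, g (theta a) = theta' a.
Proof.
move=> [S1 SM] [inv frac ker] [inv' frac' ker'].
rewrite inE in S1; have {}SM s t : S s -> S t -> S (s * t).
  by have := SM s t; rewrite !inE.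
have th_eq a b : theta a = theta b <-> theta' a = theta' b.
  have : theta (a - b) = 0 <-> theta' (a - b) = 0 by rewrite ker ker'.
  rewrite !raddfB => e; split=> /eqP; rewrite -subr_eq0 => /eqP/e/eqP;
  by rewrite subr_eq0 => /eqP.
have cancr s x y : S s -> x * theta s = y * theta s -> x = y.
  move=> /inv[b [sb _]] E.
  by rewrite -[x]mulr1 -[y]mulr1 -sb !mulrA E.
have cancr' s x y : S s -> x * theta' s = y * theta' s -> x = y.
  move=> /inv'[b [sb _]] E.
  by rewrite -[x]mulr1 -[y]mulr1 -sb !mulrA E.
have thM a b : theta (a * b) = theta a * theta b := rmorphM theta a b.
have thM' a b : theta' (a * b) = theta' a * theta' b := rmorphM theta' a b.
have ore r s : S s -> exists c w, [/\ S w, theta r * theta w = theta s * theta c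
    & theta' r * theta' w = theta' s * theta' c].
  move=> Ss; have [b [sb bs]] := inv s Ss.
  have [c [w [Sw E]]] := frac (b * theta r); exists c, w.
  have {}E : theta r * theta w = theta s * theta c by rewrite -E !mulrA sb mul1r.
  by split=> //; rewrite -!thM'; apply/th_eq; rewrite !thM.
pose G l l' := exists a s, [/\ S s, l * theta s = theta a & l' * theta' s = theta' a].
have Gcommon l m l' m' : G l l' -> G m m' -> exists a b s, S s /\
    [/\ l * theta s = theta a, l' * theta' s = theta' a,
        m * theta s = theta b & m' * theta' s = theta' b].
  move=> [a [s [Ss la la']]] [b [t [St mb mb']]].
  have [c [w [Sw E E']]] := ore t s Ss; exists (a * c), (b * w), (t * w).
  split; first exact: SM.
  split; rewrite ?thM ?thM'.
  - by rewrite E mulrA la.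
  - by rewrite E' mulrA la'.
  - by rewrite mulrA mb.
  - by rewrite mulrA mb'.
have [||||||g gb gP] := @alg_iso_graph K L L' G.
- move=> k u v u' v' Gu Gv; have [a [b [s [Ss [e1 e2 e3 e4]]]]] := Gcommon _ _ _ _ Gu Gv.
  exists (k *: a + b), s; split=> //; rewrite linearP mulrDl.
    by rewrite -scalerAl e1 e3.
  by rewrite -scalerAl e2 e4.
- exists 1, 1; split=> //; by rewrite mul1r.
- move=> u v u' v' [a [s [Ss ea ea']]] [b [t [St eb eb']]].
  have [c [w [Sw E E']]] := ore b s Ss.
  exists (a * c), (t * w); split; first exact: SM.
    by rewrite !thM -mulrA [v * _]mulrA eb E mulrA ea.
  by rewrite !thM' -mulrA [v' * _]mulrA eb' E' mulrA ea'.
- move=> l; have [a [s [Ss e]]] := frac l; have [b [sb bs]] := inv' s Ss.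
  by exists (theta' a * b), a, s; rewrite -mulrA bs mulr1.
- move=> l; have [a [s [Ss e]]] := frac' l; have [b [sb bs]] := inv s Ss.
  by exists (theta a * b), a, s; rewrite -mulrA bs mulr1.
- move=> l l' [a [s [Ss e e']]]; split=> [l0|l0].
    apply: (cancr' s) => //; rewrite e' mul0r -(rmorph0 theta'); apply/th_eq.
    by rewrite rmorph0 -e l0 mul0r.
  apply: (cancr s) => //; rewrite e mul0r -(rmorph0 theta); apply/th_eq.
  by rewrite rmorph0 -e' l0 mul0r.
exists g => // a; have [b [s [Ss e e']]] := gP (theta a).
by apply: (cancr' s) => //; rewrite e' -thM'; apply/th_eq; rewrite thM.
Qed.

(** A skew field of fractions is the localization at the nonzero elements, so that
uniqueness is a case of the uniqueness of localizations. *)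
Lemma skew_fractions_localization (K : fieldType) (A Q : algType K)
    (theta : {lrmorphism A -> Q}) :
  is_skew_fractions theta -> is_right_localization [set s | s <> 0] theta.
Proof.
move=> [ti inv fr fl]; split=> [s s0|q|a].
- by apply: inv => ts0; apply: s0; apply: ti; rewrite ts0 rmorph0.
- by have [a [s [s0 e]]] := fr q; exists a, s.
split=> [ta0|[s [s0 as0]]].
  exists 1; split; last by rewrite mulr1; apply: ti; rewrite ta0 rmorph0.
  by apply/eqP; apply: oner_neq0.
have [b [sb bs]] : invertible (theta s).
  by apply: inv => ts0; apply: s0; apply: ti; rewrite ts0 rmorph0.
by rewrite -[theta a]mulr1 -sb mulrA -rmorphM as0 rmorph0 mul0r.
Qed.

Lemma iso_Frac_intro (K : fieldType) (A B : algType K) (theta : {lrmorphism A -> B}) :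
  is_skew_fractions theta -> iso_Frac B A.
Proof.
move=> H; split; first by exists B, theta.
move=> Q phi H'; have [ti inv fr fl] := H.
have [|g gb _] := right_localization_uniq _ (skew_fractions_localization H)
  (skew_fractions_localization H'); last by exists g.
split; first by rewrite inE /=; apply/eqP; apply: oner_neq0.
move=> s t; rewrite !inE /= => s0 t0 st0.
have nz (x : A) : x <> 0 -> theta x <> 0.
  by move=> x0 tx0; apply: x0; apply: ti; rewrite tx0 rmorph0.
have [b [_ bs]] := inv _ (nz _ s0).
apply: (nz _ t0); by rewrite -[theta t]mul1r -bs -mulrA -rmorphM st0 rmorph0 mulr0.
Qed.

Lemma right_module_localization_uniq (R RS : nzRingType) (S : set R)
    (phi : {rmorphism R -> RS}) (N : lmodType R^c) (L L' : lmodType RS^c)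
    (theta : {additive N -> L}) (theta' : {additive N -> L'}) :
  mulr_closed (mem S) -> right_ore S ->
  (forall s, S s -> invertible (phi s)) ->
  (forall q, exists a s, S s /\ q * phi s = phi a) ->
  is_right_module_localization S phi theta ->
  is_right_module_localization S phi theta' -> mod_iso L L'.
Proof.
move=> [_ SM] ore inv frac [lin fr ker] [lin' fr' ker'].
have {}SM s t : S s -> S t -> S (s * t) by have := SM s t; rewrite !inE.
have phM a b : phi (a * b) = phi a * phi b := rmorphM phi a b.
have th0 n : theta n = 0 <-> theta' n = 0 by rewrite ker ker'.
have act (P : lmodType RS^c) (a b : R) (p : P) :
    (phi b : RS^c) *: ((phi a : RS^c) *: p) = (phi (a * b) : RS^c) *: p.
  by rewrite scalerA rmorphM.
have canc (P : lmodType RS^c) s (p q : P) : S s ->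
    (phi s : RS^c) *: p = (phi s : RS^c) *: q -> p = q.
  move=> /inv[b [sb bs]] E.
  have : (b : RS^c) *: ((phi s : RS^c) *: p) = (b : RS^c) *: ((phi s : RS^c) *: q).
    by rewrite E.
  by rewrite !scalerA /GRing.mul /= sb !scale1r.
pose G l l' := exists n s, [/\ S s, (phi s : RS^c) *: l = theta n
  & (phi s : RS^c) *: l' = theta' n].
have [||||g gb _] := @mod_iso_graph _ L L' G; last by exists g.
- move=> q u v u' v' [n [s [Ss e e']]] [m [t [St f f']]].
  (* With q = b c^-1 and b x = s y one gets q (c x) = s y. *)
  have [b [c [Sc Ec]]] := frac q.
  have [y [x [Sx Ey]]] := ore b s Ss.
  have [z [w [Sw Ez]]] := ore (c * x) t St.
  have qE : (q : RS) * phi (c * x * w) = phi (s * (y * w)).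
    by rewrite !phM mulrA mulrA Ec -!phM Ey mulrA phM.
  exists ((y * w : R^c) *: n + (z : R^c) *: m), (c * x * w).
  split; first by apply: (SM) => //; apply: SM.
    rewrite scalerDr raddfD !lin -e -f !act -Ez; congr (_ + _).
    by rewrite scalerA /GRing.mul /= qE.
  rewrite scalerDr raddfD !lin' -e' -f' !act -Ez; congr (_ + _).
  by rewrite scalerA /GRing.mul /= qE.
- move=> l; have [n [s [Ss e]]] := fr l; have [b [sb bs]] := inv s Ss.
  exists ((b : RS^c) *: theta' n), n, s; split=> //.
  by rewrite scalerA /GRing.mul /= bs scale1r.
- move=> l; have [n [s [Ss e]]] := fr' l; have [b [sb bs]] := inv s Ss.
  exists ((b : RS^c) *: theta n), n, s; split=> //.
  by rewrite scalerA /GRing.mul /= bs scale1r.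
- move=> l l' [n [s [Ss e e']]]; split=> l0.
    by apply: (canc _ s) => //; rewrite e' scaler0; apply/th0; rewrite -e l0 scaler0.
  by apply: (canc _ s) => //; rewrite e scaler0; apply/th0; rewrite -e' l0 scaler0.
Qed.

(** * Simple modules *)

Section SimpleModules.
Variable P : pzRingType.

Lemma simple_intro (M : lmodType P) (m : M) :
  m <> 0 -> (forall x, exists r, x = r *: m) ->
  (forall x, x <> 0 -> exists r, r *: x = m) -> simple_module M.
Proof.
move=> m0 gen back; split; first by exists m.
move=> N [N0 NL]; rewrite inE in N0.
have NZ r x : N x -> N (r *: x).
  by move=> Nx; have := NL r x 0; rewrite !inE addr0; apply.
have [[x Nx x0]|H] := pselect (exists2 x, N x & x <> 0); [right|left].
  apply/seteqP; split=> // y _; have [r ->] := gen y.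
  by have [s Es] := back x x0; rewrite -Es; do 2!apply: (NZ).
apply/seteqP; split=> [x Nx|_ ->] //.
by apply: contrapT => x0; apply: H; exists x.
Qed.

Variables (Y : set P) (e : P).
Hypotheses (ee : e * e = e) (e0 : e <> 0)
  (eback : forall r, r * e <> 0 -> exists s, s * (r * e) = e)
  (Yspan : forall a, Y a -> exists n (x y : 'I_n -> P), a = \sum_i x i * e * y i)
  (Yinv : forall a, ~ Y a -> exists b, Y (b * a - 1)).
Variables (N1 N2 : lmodType P) (n1 : N1) (n2 : N2).
Hypotheses (s1 : simple_module N1) (n10 : n1 <> 0) (en1 : e *: n1 = n1)
  (s2 : simple_module N2) (n20 : n2 <> 0) (ann2 : forall r, r *: n2 = 0 <-> Y r).

(** If e acts as zero on M, then so does the ideal Y generated by e, and M is a module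
over the skew field P / Y.  Otherwise M contains a nonzero e m. *)
Lemma two_simple_modules (M : lmodType P) :
  simple_module M -> mod_iso M N1 \/ mod_iso M N2.
Proof.
move=> sM; have [[m em]|H] := pselect (exists m : M, e *: m <> 0); [left|right].
  apply: (simple_iso_idem (e := e) sM s1 em n10) => //.
  by rewrite scalerA ee.
have em (m : M) : e *: m = 0 by apply: contrapT => em; apply: H; exists m.
have Ym a (m : M) : Y a -> a *: m = 0.
  move=> /Yspan[n [x [y ->]]]; rewrite scaler_suml big1 // => i _.
  by rewrite -!scalerA em scaler0.
have [[m m0] _] := sM; apply: (simple_iso_ann sM s2 m0 n20) => r; rewrite ann2.
split=> [rm|/Ym->//]; apply: contrapT => /Yinv[b /Ym Yb]; apply: m0.
by have := Yb m; rewrite scalerBl -scalerA rm scaler0 scale1r sub0r => /eqP; rewrite oppr_eq0 => /eqP.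
Qed.

End SimpleModules.

(** * Divided powers and matrix units *)

(** The definition is locked because matching a scaled vector against a scaled
divided power would otherwise unfold it. *)
HB.lock Definition divpow (K : fieldType) (k : nat) : {poly K} := k`!%:R^-1 *: 'X^k.

Section Operators.
Variable K : fieldType.
Hypothesis charK0 : [pchar K] =i pred0.
Local Notation E := (End {poly K}).
Local Notation D := (opD K).
Local Notation I := (opI K).
Local Notation X := (opX K).

Lemma natrS_neq0 n : (n.+1%:R != 0 :> K).
Proof. by have /pcharf0P -> := charK0. Qed.

Lemma fact_neq0 n : (n`!%:R != 0 :> K).
Proof. by have /pcharf0P -> := charK0; rewrite -lt0n fact_gt0. Qed.

Lemma end_sumE (J : Type) (r : seq J) (P : pred J) (F : J -> E) v :
  (\sum_(i <- r | P i) F i) v = \sum_(i <- r | P i) F i v.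
Proof. by elim/big_rec2: _ => // i y f _ <-. Qed.

Lemma endZ (f : E) a v : f (a *: v) = a *: f v.
Proof. exact: linearZ. Qed.

Lemma end0 (f : E) : f 0 = 0.
Proof. exact: linear0. Qed.

Lemma end_expS (f : E) n v : (f ^+ n.+1) v = f ((f ^+ n) v).
Proof. by rewrite exprS. Qed.

Local Notation dp := (divpow K).
(** The coordinate of p on x^k / k!. *)
Definition dpcoef (k : nat) (p : {poly K}) : K := p`_k * k`!%:R.

Lemma coef_dp k i : (dp k)`_i = (i == k)%:R / k`!%:R.
Proof. by rewrite divpow.unlock coefZ coefXn mulrC. Qed.

Lemma dpcoef_linear k : linear_for *%R (dpcoef k).
Proof. by move=> a p q; rewrite /dpcoef coefD coefZ mulrDl mulrA. Qed.
HB.instance Definition _ k := GRing.isLinear.Build K {poly K} K _ (dpcoef k) (dpcoef_linear k).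

Lemma dpcoefZ k a p : dpcoef k (a *: p) = a * dpcoef k p.
Proof. by rewrite /dpcoef coefZ mulrA. Qed.

Lemma dpcoef_dp k j : dpcoef k (dp j) = (k == j)%:R.
Proof.
rewrite /dpcoef coef_dp; case: eqP => [->|]; last by rewrite !mul0r.
by rewrite divfK ?fact_neq0.
Qed.

Lemma dp_sum n (p : {poly K}) : (size p <= n)%N -> p = \sum_(k < n) dpcoef k p *: dp k.
Proof.
move=> sp; apply/polyP => i; rewrite coef_sum.
under eq_bigr do rewrite coefZ coef_dp.
have [lt|ge] := ltnP i n.
  rewrite (bigD1 (Ordinal lt)) //= eqxx mul1r /dpcoef mulfK ?fact_neq0 // big1 ?addr0 // => j ne.
  by rewrite eq_sym (negbTE (_ : nat_of_ord j != i)) ?mul0r ?mulr0.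
rewrite nth_default ?(leq_trans sp) // big1 // => j _.
by rewrite gtn_eqF ?mul0r ?mulr0 // (leq_trans (ltn_ord j)).
Qed.

(** Equalities of operators are checked on divided powers, on which D and I are
shifts. *)
Lemma end_ext (f g : E) : (forall k, f (dp k) = g (dp k)) -> f = g.
Proof.
move=> e; apply: EndP => v; rewrite (dp_sum (leqnn (size v))) !linear_sum.
by apply: eq_bigr => k _; rewrite endZ [in RHS]endZ e.
Qed.

Lemma dpcoefP (p q : {poly K}) : (forall k, dpcoef k p = dpcoef k q) -> p = q.
Proof.
move=> e; apply/polyP => k; have := e k; rewrite /dpcoef; apply: mulIf; exact: fact_neq0.
Qed.

Lemma opI_dp k : I (dp k) = dp k.+1.
Proof.
apply/polyP => -[|i]; rewrite /= coef_integ !coef_dp ?mul0r // eqSS.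
by rewrite -mulrA -invfM -natrM mulnC; case: eqP => [->|]; rewrite ?mul0r // factS.
Qed.

Lemma opD_dp0 : D (dp 0) = 0.
Proof. by apply/polyP => i; rewrite coef_deriv coef_dp mul0r mul0rn coef0. Qed.


Lemma opD_dp k : D (dp k.+1) = dp k.
Proof. by rewrite -opI_dp -end_mulE opDI. Qed.

Lemma opIn_dp n k : (I ^+ n) (dp k) = dp (n + k).
Proof. by elim: n => // n IH; rewrite end_expS IH opI_dp. Qed.

Lemma opDn_dp n k : (D ^+ n) (dp (n + k)) = dp k.
Proof. by elim: n => // n IH; rewrite exprSr end_mulE addSn opD_dp IH. Qed.

Lemma opDn_dp0 n k : (k < n)%N -> (D ^+ n) (dp k) = 0.
Proof.
elim: n k => // n IH [|k] lt; rewrite exprSr end_mulE; first by rewrite opD_dp0 end0.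
by rewrite opD_dp IH.
Qed.

Lemma opDnIn n : D ^+ n * I ^+ n = 1.
Proof. by apply: end_ext => k; rewrite end_mulE opIn_dp opDn_dp. Qed.

Lemma eij_dp i j k : eij K i j (dp k) = (j == k)%:R *: dp i.
Proof.
rewrite /eij end_addE end_oppE !end_mulE.
have [lt|le] := ltnP k j.
  by rewrite gtn_eqF // (opDn_dp0 lt) (opDn_dp0 (ltnW lt : (k < j.+1)%N)) end0 [in X in _ - X]end0 subr0 scale0r.
rewrite -{1}(subnKC le) opDn_dp opIn_dp.
move: le; rewrite leq_eqVlt => /orP[/eqP e|lt].
  by rewrite e eqxx subnn addn0 opDn_dp0 // end0 subr0 scale1r.
by rewrite ltn_eqF // -{2}(subnKC lt) opDn_dp opIn_dp scale0r addSn -addnS subnSK // subrr.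
Qed.

Lemma eijE i j p : eij K i j p = dpcoef j p *: dp i.
Proof.
rewrite {1}(dp_sum (leq_maxl (size p) j.+1)) linear_sum.
have lt : (j < maxn (size p) j.+1)%N by rewrite leq_max leqnn orbT.
under eq_bigr do rewrite endZ eij_dp.
rewrite (bigD1 (Ordinal lt)) //= eqxx scale1r big1 ?addr0 // => k ne.
by rewrite eq_sym (negbTE (_ : nat_of_ord k != j)) ?scale0r ?scaler0.
Qed.

Lemma eij_mul i j k l : eij K i j * eij K k l = (j == k)%:R *: eij K i l.
Proof.
by apply: EndP => p; rewrite end_scaleE end_mulE !eijE dpcoefZ dpcoef_dp !scalerA mulrC.
Qed.

(** This extracts a matrix entry of an arbitrary operator inside any ideal that
contains the operator. *)
Lemma eij_conj i j k l (a : E) : eij K i j * a * eij K k l = dpcoef j (a (dp k)) *: eij K i l.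
Proof.
by apply: EndP => p; rewrite end_scaleE !end_mulE !eijE endZ dpcoefZ !scalerA mulrC.
Qed.

Lemma E_neq0 (a : E) : a <> 0 -> exists j k, dpcoef j (a (dp k)) <> 0.
Proof.
move=> a0; apply: contrapT => H; apply: a0; apply: end_ext => k; apply: dpcoefP => j.
by rewrite end_0E linear0; apply: contrapT => H'; apply: H; exists j, k.
Qed.

(** * The ideal F *)

(** The projection onto the span of the u_k with k < N, along the image of I^N. *)
Lemma subIdE N : 1 - I ^+ N * D ^+ N = \sum_(k < N) eij K k k.
Proof.
elim: N => [|N IH]; first by rewrite mulr1 subrr big_ord0.
by rewrite big_ord_recr -IH /= /eij addrA subrK.
Qed.

Lemma idealF0 : idealF K 0.
Proof. by exists 0%N, (fun _ _ => 0); rewrite big_ord0. Qed.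

(** Killing I^N means vanishing on all u_k with k >= N, so that only finitely many
columns are nonzero; each column is a polynomial, hence finite. *)
Lemma idealFP (f : E) : idealF K f <-> exists N, f * I ^+ N = 0.
Proof.
split=> [[n [c ->]]|[N fN]].
  exists n; apply: end_ext => k; rewrite end_mulE opIn_dp end_sumE big1 // => i _.
  rewrite end_sumE big1 // => j _; rewrite end_scaleE eij_dp.
  by rewrite ltn_eqF ?scale0r ?scaler0 // (leq_trans (ltn_ord j)) // leq_addr.
(* M bounds the nonzero columns and the degrees of their entries. *)
pose M := maxn N (\max_(k < N) size (f (dp k))).
exists M, (fun i j => if (j < N)%N then dpcoef i (f (dp j)) else 0).
apply: end_ext => k; rewrite end_sumE.
under eq_bigr do rewrite end_sumE.
have [lt|le] := ltnP k N; last first.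
  rewrite -(subnKC le) -opIn_dp -end_mulE fN end_0E big1 // => i _.
  rewrite big1 // => j _; rewrite opIn_dp subnKC // end_scaleE eij_dp.
  case: ltnP => [ltj|_]; last by rewrite scale0r.
  by rewrite ltn_eqF ?scale0r ?scaler0 // (leq_trans ltj).
have sM : (size (f (dp k)) <= M)%N.
  by rewrite leq_max (leq_bigmax (Ordinal lt)) orbT.
have kM : (k < M)%N by rewrite (leq_trans lt) // leq_maxl.
rewrite {1}(dp_sum sM); apply: eq_bigr => i _.
under eq_bigr do rewrite end_scaleE eij_dp.
rewrite (bigD1 (Ordinal kM)) //= lt eqxx scale1r big1 ?addr0 // => j ne.
by rewrite (negbTE (_ : nat_of_ord j != k)) ?scale0r ?scaler0.
Qed.

Lemma idealFN (f : E) N M : (N <= M)%N -> f * I ^+ N = 0 -> f * I ^+ M = 0.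
Proof. by move=> le fN; rewrite -(subnKC le) exprD mulrA fN mul0r. Qed.

Lemma idealFL k (f g : E) : idealF K f -> idealF K g -> idealF K (k *: f + g).
Proof.
move=> /idealFP[N fN] /idealFP[M gM]; apply/idealFP; exists (maxn N M).
by rewrite mulrDl -scalerAl (idealFN _ fN) ?leq_maxl // (idealFN _ gM) ?leq_maxr // scaler0 addr0.
Qed.
Lemma idealFD (f g : E) : idealF K f -> idealF K g -> idealF K (f + g).
Proof. by move=> Ff Fg; rewrite -[f]scale1r; apply: idealFL. Qed.
Lemma idealFZ k (f : E) : idealF K f -> idealF K (k *: f).
Proof. by move=> Ff; rewrite -[_ *: _]addr0; apply: idealFL => //; apply: idealF0. Qed.
(** Here a is any endomorphism: the columns of a f are the images by a of those of f,
and a column is finite because it is a vector. *)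
Lemma idealF_mull (a f : E) : idealF K f -> idealF K (a * f).
Proof. by move=> /idealFP[N fN]; apply/idealFP; exists N; rewrite -mulrA fN mulr0. Qed.

Lemma idealF_eij i j : idealF K (eij K i j).
Proof.
apply/idealFP; exists j.+1; apply: end_ext => k.
by rewrite end_mulE opIn_dp eij_dp ltn_eqF ?scale0r // leq_addr.
Qed.

Lemma idealF_subId N : idealF K (1 - I ^+ N * D ^+ N).
Proof. by apply/idealFP; exists N; rewrite mulrBl mul1r -mulrA opDnIn mulr1 subrr. Qed.

Lemma idealF_finrank : idealF K `<=` finrank (V := {poly K}).
Proof.
move=> f /idealFP[N fN]; apply/finrankP; exists [seq f (dp k) | k <- iota 0 N] => v.
have -> : f v = f (v - (I ^+ N) ((D ^+ N) v)).
  by rewrite linearB /= -[X in _ - X]/((f * (I ^+ N)) ((D ^+ N) v)) fN end_0E subr0.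
have : v - (I ^+ N) ((D ^+ N) v) = (1 - I ^+ N * D ^+ N) v by [].
rewrite subIdE end_sumE => ->; exists (fun k => dpcoef k v).
rewrite size_map size_iota linear_sum; apply: eq_bigr => k _.
by rewrite eijE endZ (nth_map 0%N) ?size_iota // nth_iota.
Qed.

(** * Maps of finite rank *)

Local Notation C := (finrank (V := {poly K})).
Lemma finrank_mull (a f : E) : C f -> C (a * f).
Proof. by move=> Cf; have [[_ H] _] := finrank_ideal {poly K}; apply: H. Qed.
Lemma finrank_mulr (a f : E) : C f -> C (f * a).
Proof. by move=> Cf; have [_ [_ H]] := finrank_ideal {poly K}; apply: H. Qed.
Lemma finrankB (f g : E) : C f -> C g -> C (f - g).
Proof. by have [[[_ H] _] _] := finrank_ideal {poly K}; have := H f g; rewrite !inE. Qed.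
Lemma finrank0 : C 0.
Proof. by have [[[H _] _] _] := finrank_ideal {poly K}; rewrite inE in H. Qed.
Lemma finrankN (f : E) : C f -> C (- f).
Proof. by move=> Cf; rewrite -sub0r; apply: finrankB => //; apply: finrank0. Qed.
Lemma finrankD (f g : E) : C f -> C g -> C (f + g).
Proof. by move=> Cf Cg; rewrite -[g]opprK; apply: finrankB => //; apply: finrankN. Qed.
Lemma finrank1 : ~ C 1.
Proof.
move=> C1; apply: (@finrank_neqT K {poly K}); apply/seteqP; split=> // f _.
by rewrite -[f]mulr1; apply: finrank_mull.
Qed.

(** * Degrees *)

Lemma size_opI p : p != 0 -> size (I p) = (size p).+1.
Proof.
move=> p0; apply/eqP; rewrite eqn_leq; apply/andP; split.
  by apply/leq_sizeP => -[|j] le //; rewrite /= coef_integ nth_default ?mul0r.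
have l0 : p`_(size p).-1 != 0 by rewrite -lead_coefE lead_coef_eq0.
rewrite -size_poly_gt0 in p0.
rewrite ltnNge; apply/negP => /leq_sizeP /(_ (size p) (leqnn _)).
rewrite -{1}(prednK p0) /= coef_integ => /eqP.
by rewrite mulf_eq0 invr_eq0 (negbTE l0) (negbTE (natrS_neq0 _)).
Qed.

Lemma size_opIn n p : p != 0 -> size ((I ^+ n) p) = (n + size p)%N.
Proof.
move=> p0; elim: n => // n IH; rewrite end_expS size_opI ?IH //.
by rewrite -size_poly_gt0 IH addn_gt0 size_poly_gt0 p0 orbT.
Qed.

Lemma size_opD p : size (D p) = (size p).-1.
Proof.
have [lt|] := ltnP 1 (size p); last first.
  by move=> /size1_polyC ->; rewrite /= derivC size_poly0 size_polyC; case: (_ != _).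
have p0 : p != 0 by rewrite -size_poly_gt0 ltnW.
have l0 : p`_(size p).-1 != 0 by rewrite -lead_coefE lead_coef_eq0.
apply/eqP; rewrite eqn_leq -ltnS prednK ?(ltnW lt) // lt_size_deriv //=.
have [n En] : exists n, size p = n.+2 by exists (size p).-2; lia.
rewrite En /= in l0 *; rewrite ltnNge; apply/negP => /leq_sizeP /(_ n (leqnn _)) /eqP.
by rewrite coef_deriv -mulr_natr mulf_eq0 (negbTE l0) (negbTE (natrS_neq0 _)).
Qed.

Lemma size_opDn n p : size ((D ^+ n) p) = (size p - n)%N.
Proof.
elim: n => [|n IH]; first by rewrite subn0.
by rewrite end_expS size_opD IH subnS.
Qed.

Lemma opDn_size N (p : {poly K}) : (size p <= N)%N -> (D ^+ N) p = 0.
Proof. by move=> le; apply/eqP; rewrite -size_poly_eq0 size_opDn; apply/eqP; lia. Qed.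

(** * Polynomials in the Euler operator *)

(** The operator p(H) for H = x d/dx, which multiplies x^k by p(k). *)
Definition euler_fun (p f : {poly K}) : {poly K} := \poly_(k < size f) (p.[k%:R] * f`_k).

Lemma coef_euler_fun p f k : (euler_fun p f)`_k = p.[k%:R] * f`_k.
Proof. by rewrite coef_poly; case: ltnP => // le; rewrite nth_default ?mulr0. Qed.

Fact euler_fun_linear p : linear (euler_fun p).
Proof.
by move=> a f g; apply/polyP => k; rewrite coefD coefZ !coef_euler_fun coefD coefZ mulrDr mulrCA.
Qed.
Definition euler p : E := mkEnd (euler_fun_linear p).

Lemma coef_euler p f k : (euler p f)`_k = p.[k%:R] * f`_k.
Proof. exact: coef_euler_fun. Qed.

Lemma eulerL k p q : euler (k *: p + q) = k *: euler p + euler q.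
Proof.
apply: EndP => f; apply/polyP => i.
by rewrite end_addE end_scaleE coefD coefZ !coef_euler hornerD hornerZ mulrDl mulrA.
Qed.
HB.instance Definition _ := GRing.isLinear.Build K {poly K} E _ euler eulerL.

Lemma eulerZ k p : euler (k *: p) = k *: euler p. Proof. exact: linearZ. Qed.
Lemma euler_sum (J : Type) (r : seq J) (P : pred J) (F : J -> {poly K}) :
  euler (\sum_(i <- r | P i) F i) = \sum_(i <- r | P i) euler (F i).
Proof. exact: raddf_sum. Qed.

Lemma euler1 : euler 1 = 1.
Proof. by apply: EndP => f; apply/polyP => i; rewrite coef_euler hornerC mul1r. Qed.
Lemma eulerM p q : euler (p * q) = euler p * euler q.
Proof.
apply: EndP => f; apply/polyP => i.
by rewrite end_mulE !coef_euler hornerM mulrA.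
Qed.

Lemma euler_opI p : euler p * I = I * euler (p \Po ('X + 1)).
Proof.
apply: EndP => f; apply/polyP => i; rewrite !end_mulE !coef_euler.
case: i => [|i]; rewrite /= !coef_integ ?mulr0 // coef_euler_fun.
by rewrite horner_comp hornerD hornerX hornerC natr1 mulrA.
Qed.

Lemma opD_euler p : D * euler p = euler (p \Po ('X + 1)) * D.
Proof.
apply: EndP => f; apply/polyP => i; rewrite !end_mulE /= coef_euler_fun !coef_deriv coef_euler_fun.
by rewrite horner_comp hornerD hornerX hornerC natr1 mulrnAr.
Qed.

Lemma eulerX : euler 'X = X * D.
Proof.
apply: EndP => f; apply/polyP => i; rewrite end_mulE coef_euler hornerX /= coefXM.
by case: i => [|i]; rewrite ?mul0r // coef_deriv mulr_natl.
Qed.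

Lemma opXE : X = I * euler ('X + 1).
Proof.
apply: EndP => f; apply/polyP => i; rewrite end_mulE /= coef_integ coefXM.
case: i => //= i; rewrite coef_euler_fun hornerD hornerX hornerC natr1 mulrC mulKf //.
exact: natrS_neq0.
Qed.

Definition shiftp n (p : {poly K}) : {poly K} := iter n (comp_poly ('X + 1)) p.

Lemma size_shiftp n p : size (shiftp n p) = size p.
Proof. by elim: n => //= n <-; rewrite size_comp_poly2 // size_XaddC. Qed.

Lemma euler_opIn n p : euler p * I ^+ n = I ^+ n * euler (shiftp n p).
Proof.
elim: n => [|n IH]; first by rewrite mul1r mulr1.
by rewrite exprSr mulrA IH -!mulrA euler_opI.
Qed.

Lemma opDn_euler n p : D ^+ n * euler p = euler (shiftp n p) * D ^+ n.
Proof.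
elim: n => [|n IH]; first by rewrite mul1r mulr1.
by rewrite exprS -mulrA IH mulrA opD_euler -mulrA.
Qed.

(** * Lower triangular band operators *)

Definition lower_op n (p : nat -> {poly K}) : E := \sum_(i < n) I ^+ i * euler (p i).
(** The span of the I^i H^j with i < n and j < q.  Both bounds add up under
composition, by the rule p(H) I = I p(H + 1). *)
Definition lower_filt n q : set E :=
  [set t | exists p : nat -> {poly K}, (forall i, (size (p i) <= q)%N) /\ t = lower_op n p].
Definition lower_alg : set E := [set t | exists n q, lower_filt n q t].

Lemma lower_op_widen n m p : (n <= m)%N ->
  lower_op n p = lower_op m (fun i => if (i < n)%N then p i else 0).
Proof.
move=> le; rewrite /lower_op (big_ord_widen m (fun i => I ^+ i * euler (p i)) le) big_mkcond.
apply: eq_bigr => i _; case: ltnP => // _.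
by rewrite raddf0 mulr0.
Qed.

Lemma lower_filt_widen n m q r : (n <= m)%N -> (q <= r)%N -> lower_filt n q `<=` lower_filt m r.
Proof.
move=> nm qr t [p [sp ->]]; rewrite (lower_op_widen _ nm).
exists (fun i => if (i < n)%N then p i else 0); split=> // i; case: ifP => _; last by rewrite size_poly0.
exact: leq_trans (sp i) qr.
Qed.

Lemma lower_filtL n q k t u : lower_filt n q t -> lower_filt n q u -> lower_filt n q (k *: t + u).
Proof.
move=> [p [sp ->]] [r [sr ->]]; exists (fun i => k *: p i + r i); split.
  move=> i; rewrite (leq_trans (size_polyD _ _)) // geq_max sr andbT.
  by rewrite (leq_trans (size_scale_leq _ _)).
rewrite /lower_op scaler_sumr -big_split; apply: eq_bigr => i _ /=.
by rewrite eulerL mulrDr scalerAr.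
Qed.

Lemma lower_filt0 n q : lower_filt n q 0.
Proof.
exists (fun=> 0); split=> [i|]; first by rewrite size_poly0.
by rewrite /lower_op big1 // => i _; rewrite raddf0 mulr0.
Qed.

Lemma lower_filtD n q t u : lower_filt n q t -> lower_filt n q u -> lower_filt n q (t + u).
Proof. by move=> Tt Tu; rewrite -[t]scale1r; apply: lower_filtL. Qed.

Lemma lower_filt_monomial n q i (p : {poly K}) :
    (i < n)%N -> (size p <= q)%N -> lower_filt n q (I ^+ i * euler p).
Proof.
move=> lt sp; exists (fun j => if j == i then p else 0); split.
  by move=> j; case: ifP; rewrite ?size_poly0.
rewrite /lower_op (bigD1 (Ordinal lt)) //= eqxx big1 ?addr0 // => j ne.
by rewrite (negbTE (_ : nat_of_ord j != i)) // raddf0 mulr0.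
Qed.

Lemma lower_filtM n q m r t u :
    lower_filt n q t -> lower_filt m r u -> lower_filt (n + m) (q + r) (t * u).
Proof.
move=> [p [sp ->]] [s [ss ->]]; rewrite /lower_op mulr_suml.
apply: (big_ind (lower_filt (n + m) (q + r))) => [|x y|i _]; [exact: lower_filt0|exact: lower_filtD|].
rewrite mulr_sumr.
apply: (big_ind (lower_filt (n + m) (q + r))) => [|x y|j _]; [exact: lower_filt0|exact: lower_filtD|].
have -> : I ^+ i * euler (p i) * (I ^+ j * euler (s j)) =
    I ^+ (i + j) * euler (shiftp j (p i) * s j).
  by rewrite mulrA -[_ * I ^+ j]mulrA euler_opIn eulerM !mulrA -exprD.
apply: lower_filt_monomial; first by have := ltn_ord i; have := ltn_ord j; lia.
apply: leq_trans (size_polyMleq _ _) _; rewrite size_shiftp.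
by have := sp i; have := ss j; lia.
Qed.

Lemma lower_algL k t u : lower_alg t -> lower_alg u -> lower_alg (k *: t + u).
Proof.
move=> [n [q Tt]] [m [r Tu]]; exists (maxn n m), (maxn q r).
by apply: lower_filtL; [apply: lower_filt_widen Tt|apply: lower_filt_widen Tu]; lia.
Qed.
Lemma lower_algM t u : lower_alg t -> lower_alg u -> lower_alg (t * u).
Proof. by move=> [n [q Tt]] [m [r Tu]]; exists (n + m)%N, (q + r)%N; apply: lower_filtM. Qed.
Lemma lower_alg_monomial i p : lower_alg (I ^+ i * euler p).
Proof. by exists i.+1, (size p); apply: lower_filt_monomial. Qed.
Lemma lower_alg_opIn i : lower_alg (I ^+ i).
Proof. by rewrite -[I ^+ i]mulr1 -euler1; apply: lower_alg_monomial. Qed.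

(** Conjugation by the shift I only translates the polynomials p_i. *)
Lemma lower_alg_shift n t : lower_alg t -> exists2 u, lower_alg u & t * I ^+ n = I ^+ n * u.
Proof.
move=> [m [q [p [sp ->]]]]; exists (lower_op m (fun i => shiftp n (p i))).
  by exists m, q, (fun i => shiftp n (p i)); split=> // i; rewrite size_shiftp.
rewrite /lower_op mulr_suml mulr_sumr; apply: eq_bigr => i _.
by rewrite -mulrA euler_opIn !mulrA -!exprD addnC.
Qed.

(** * Growth of degrees *)

(** Characteristic zero: the integers are distinct in K. *)
Lemma poly_nat_roots (p : {poly K}) : p != 0 ->
  exists N, forall k, (N <= k)%N -> p.[k%:R] != 0.
Proof.
have [n] := ubnP (size p); elim: n p => // n IH p sp p0.
have [[k rk]|nr] := pselect (exists k, root p k%:R); last first.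
  by exists 0%N => k _; apply/negP => rk; apply: nr; exists k.
have [q pE] := factor_theorem _ _ rk.
have q0 : q != 0 by apply: contraNneq p0 => q0; rewrite pE q0 mul0r.
have [|N HN] := IH q _ q0; first by move: sp; rewrite pE size_Mmonic ?monicXsubC // size_XsubC addn2.
exists (maxn N k.+1) => j le; rewrite pE hornerM hornerXsubC mulf_neq0 ?HN //; first by lia.
have kj : (k < j)%N by lia.
rewrite -natrB ?(ltnW kj) //; have -> : (j - k)%N = (j - k).-1.+1 by lia.
exact: natrS_neq0.
Qed.

Lemma size_euler p f : (size (euler p f) <= size f)%N.
Proof. by apply/leq_sizeP => j le; rewrite coef_euler nth_default ?mulr0. Qed.

Lemma size_opIn_leq n (f : {poly K}) m : (size f <= m)%N -> (size ((I ^+ n) f) <= n + m)%N.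
Proof.
move=> le; have [->|f0] := eqVneq f 0; first by rewrite end0 size_poly0.
by rewrite size_opIn // leq_add2l.
Qed.

Lemma size_lower_op n p f : (size (lower_op n p f) <= (n + size f).-1)%N.
Proof.
rewrite /lower_op end_sumE; apply: leq_trans (size_sum _ _ _) _; apply/bigmax_leqP => i _.
apply: leq_trans (size_opIn_leq _ (size_euler _ _)) _.
by have := ltn_ord i; lia.
Qed.

(** On x^k with k beyond the roots of p_n, the top term I^n p_n(H) dominates. *)
Lemma lower_op_growth n (p : nat -> {poly K}) : p n != 0 ->
  exists N, forall f : {poly K}, (N < size f)%N -> size (lower_op n.+1 p f) = (n + size f)%N.
Proof.
move=> /poly_nat_roots[N HN]; exists N => f lt.
have f0 : f != 0 by rewrite -size_poly_gt0 (leq_ltn_trans _ lt).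
have sH : size (euler (p n) f) = size f.
  apply/eqP; rewrite eqn_leq size_euler leqNgt; apply/negP => lt'.
  have : (euler (p n) f)`_(size f).-1 = 0.
    by rewrite nth_default // -ltnS prednK // size_poly_gt0.
  move=> /eqP; rewrite coef_euler mulf_eq0 -lead_coefE lead_coef_eq0 (negbTE f0) orbF.
  by apply/negP; apply: HN; lia.
have sI : size ((I ^+ n) (euler (p n) f)) = (n + size f)%N.
  by rewrite size_opIn ?sH // -size_poly_gt0 sH size_poly_gt0.
rewrite /lower_op big_ord_recr /= addrC size_polyDl sI //.
by apply: leq_ltn_trans (size_lower_op n p f) _; lia.
Qed.

Lemma lower_op_top n p : (forall i, (i < n)%N -> p i = 0) \/
  exists m, [/\ (m < n)%N, p m != 0 & lower_op n p = lower_op m.+1 p].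
Proof.
elim: n => [|n IH]; first by left.
have [pn|pn] := eqVneq (p n) 0; last by right; exists n.
case: IH => [p0|[m [lt pm E]]]; [left|right].
  by move=> i; rewrite ltnS leq_eqVlt => /orP[/eqP->|/p0].
exists m; split=> //; first exact: ltnW.
by rewrite -E /lower_op big_ord_recr /= pn raddf0 mulr0 addr0.
Qed.

Lemma lower_alg_growth t : lower_alg t -> t <> 0 -> exists n N,
  forall f : {poly K}, (N < size f)%N -> size (t f) = (n + size f)%N.
Proof.
move=> [n [q [p [_ ->]]]] t0; have [p0|[m [lt pm E]]] := lower_op_top n p.
  by case: t0; rewrite /lower_op big1 // => i _; rewrite p0 ?raddf0 ?mulr0.
by have [N HN] := lower_op_growth pm; exists m, N => f; rewrite E; apply: HN.
Qed.

Lemma size_dp k : size (dp k) = k.+1.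
Proof. by rewrite divpow.unlock size_scale ?size_polyXn // invr_eq0 fact_neq0. Qed.

(** Linear independence of the I^i H^j: a nonzero top polynomial would force growth. *)
Lemma lower_op_eq0 n p : lower_op n p = 0 -> forall i, (i < n)%N -> p i = 0.
Proof.
move=> E; have [//|[m [lt pm E']]] := lower_op_top n p.
have [N HN] := lower_op_growth pm; have := HN (dp N).
by rewrite size_dp -E' E end_0E size_poly0 => /(_ (leqnn _)); lia.
Qed.

Lemma lower_alg_domain t u : lower_alg t -> lower_alg u -> t * u = 0 -> t = 0 \/ u = 0.
Proof.
move=> Tt Tu tu; have [->|/eqP t0] := eqVneq t 0; first by left.
have [->|/eqP u0] := eqVneq u 0; first by right.
have [n [N HN]] := lower_alg_growth Tt t0; have [m [M HM]] := lower_alg_growth Tu u0.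
have := HM (dp (maxn N M)); rewrite size_dp => /(_ _); move=> sE.
have {}sE := sE (leq_maxr _ _ : (M < (maxn N M).+1)%N).
have := HN (u (dp (maxn N M))); rewrite sE -end_mulE tu end_0E size_poly0.
by move=> H; suff /H : (N < m + (maxn N M).+1)%N; lia.
Qed.

(** * Operators that preserve degrees *)

(** The matrix of s is triangular with nonzero diagonal entries. *)
Lemma size_preserving_bij (s : E) : (forall f, size (s f) = size f) -> bijective s.
Proof.
move=> ss.
have sur n (q : {poly K}) : (size q <= n)%N -> exists f, s f = q.
  elim: n q => [|n IH] q sq.
    by exists 0; rewrite end0; apply/esym/eqP; rewrite -size_poly_eq0 -leqn0.
  have l0 : (s (dp n))`_n != 0.
    have : lead_coef (s (dp n)) != 0 by rewrite lead_coef_eq0 -size_poly_gt0 ss size_dp.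
    by rewrite lead_coefE ss size_dp.
  have [|f Ef] := IH (q - (q`_n / (s (dp n))`_n) *: s (dp n)).
    apply/leq_sizeP => j le; rewrite coefB coefZ.
    move: le; rewrite leq_eqVlt => /orP[/eqP<-|lt]; first by rewrite divfK ?subrr.
    have sn : (size (s (dp n)) <= n.+1)%N by rewrite ss size_dp.
    by rewrite (nth_default _ (leq_trans sq lt)) (nth_default _ (leq_trans sn lt)) mulr0 subrr.
  by exists (f + (q`_n / (s (dp n))`_n) *: dp n); rewrite linearD /= endZ Ef subrK.
have inj f g : s f = s g -> f = g.
  move=> /eqP; rewrite -subr_eq0 -linearB -size_poly_eq0 ss size_poly_eq0 subr_eq0.
  by move=> /eqP.
exists (fun q => sval (cid (sur _ q (leqnn _)))) => f; case: cid => g //=.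
exact: inj.
Qed.

(** * Subalgebras and their generators *)

Section Subalg.
Variable S : subalg E.
Lemma subalg1 : subalg_set S 1.
Proof. by have [] := subalg_closedP S; rewrite inE. Qed.
Lemma subalgL k a b : subalg_set S a -> subalg_set S b -> subalg_set S (k *: a + b).
Proof. by have [_ + _] := subalg_closedP S; move=> /(_ k a b); rewrite !inE; apply. Qed.
Lemma subalgM a b : subalg_set S a -> subalg_set S b -> subalg_set S (a * b).
Proof. by have [_ _] := subalg_closedP S; move=> /(_ a b); rewrite !inE; apply. Qed.
Lemma subalg0 : subalg_set S 0.
Proof. by have := subalgL (-1) subalg1 subalg1; rewrite scaleN1r addNr. Qed.
Lemma subalgX a n : subalg_set S a -> subalg_set S (a ^+ n).
Proof. by move=> Sa; elim: n => [|n IH]; [exact: subalg1|rewrite exprS; apply: subalgM]. Qed.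
Lemma subalgD a b : subalg_set S a -> subalg_set S b -> subalg_set S (a + b).
Proof. by move=> Sa Sb; rewrite -[a]scale1r; apply: subalgL. Qed.
Lemma subalgZ k a : subalg_set S a -> subalg_set S (k *: a).
Proof. by move=> Sa; rewrite -[_ *: _]addr0; apply: subalgL => //; apply: subalg0. Qed.
Lemma subalgB a b : subalg_set S a -> subalg_set S b -> subalg_set S (a - b).
Proof. by move=> Sa Sb; rewrite addrC -scaleN1r; apply: subalgL. Qed.
Lemma subalg_euler p : subalg_set S X -> subalg_set S D -> subalg_set S (euler p).
Proof.
move=> SX SD; elim/poly_ind: p => [|p c IH]; first by rewrite raddf0; apply: subalg0.
rewrite raddfD /=; apply: subalgD; first by rewrite eulerM eulerX; apply: subalgM => //; apply: subalgM.
by rewrite -alg_polyC linearZ /= euler1; apply/subalgZ/subalg1.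
Qed.
End Subalg.

Lemma I1X : subalg_set (I1 K) X. Proof. by apply: gen_sub; left; left. Qed.
Lemma I1D : subalg_set (I1 K) D. Proof. by apply: gen_sub; left; right. Qed.
Lemma I1I : subalg_set (I1 K) I. Proof. by apply: gen_sub; right. Qed.
Lemma weylA1X : subalg_set (weylA1 K) X. Proof. by apply: gen_sub; left. Qed.
Lemma weylA1D : subalg_set (weylA1 K) D. Proof. by apply: gen_sub; right. Qed.
Lemma weylA1_sub_I1 : weylA1 K `<=` I1 K.
Proof.
move=> f; apply; first exact: subalg_closedP.
by move=> _ [->|->]; [apply: I1X|apply: I1D].
Qed.

(** * Reduction of I_1 to band operators *)

Lemma lower_alg_I1 : lower_alg `<=` I1 K.
Proof.
move=> t [n [q [p [_ ->]]]]; rewrite /lower_op.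
apply: (big_ind (subalg_set (I1 K))) => [|a b|i _]; [exact: subalg0|exact: subalgD|].
by apply: subalgM; [apply: subalgX; exact: I1I|apply: subalg_euler; [apply: I1X|apply: I1D]].
Qed.

Lemma idealF_I1 : idealF K `<=` I1 K.
Proof.
move=> f [n [c ->]].
apply: (big_ind (subalg_set (I1 K))) => [|a b|i _]; [exact: subalg0|exact: subalgD|].
apply: (big_ind (subalg_set (I1 K))) => [|a b|j _]; [exact: subalg0|exact: subalgD|].
apply: subalgZ; rewrite /eij.
by apply: subalgB; apply: subalgM; apply: subalgX; first [exact: I1I|exact: I1D].
Qed.

(** The set of the a with a I^N in T for some N contains X = I (H + 1), D and I, and
it is closed under products because T I^N is contained in I^N T. *)
Lemma I1_opIn_lower a : subalg_set (I1 K) a -> exists N, lower_alg (a * I ^+ N).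
Proof.
move=> Ia; have H := Ia [set a | exists N, lower_alg (a * I ^+ N)].
have up b N M : lower_alg (b * I ^+ N) -> lower_alg (b * I ^+ (N + M)).
  by move=> Tb; rewrite exprD mulrA; apply: lower_algM => //; apply: lower_alg_opIn.
apply: H; last first.
  move=> _ [[->|->]|->].
  - by exists 0%N; rewrite mulr1 opXE; apply: (lower_alg_monomial 1).
  - by exists 1%N; rewrite opDI //; apply: (lower_alg_opIn 0).
  - by exists 0%N; rewrite mulr1; apply: (lower_alg_opIn 1).
split=> [|k b c|b c]; rewrite !inE.
- by exists 0%N; rewrite mulr1; apply: (lower_alg_opIn 0).
- move=> [N Tb] [M Tc]; exists (N + M)%N; rewrite mulrDl -scalerAl; apply: lower_algL.
    exact: up.
  by rewrite addnC; apply: up.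
move=> [N Tb] [M Tc]; exists (M + N)%N.
have [u Tu Eu] := lower_alg_shift N Tc.
by rewrite exprD mulrA -[b * c * _]mulrA -mulrA Eu mulrA; apply: lower_algM.
Qed.

(** * Invertibility modulo F *)

(** Say that a I^N raises large degrees by n.  Then a I^N D^n preserves large degrees,
and replacing it by the identity on the span of the u_k with k < M makes it
preserve all degrees. *)
Lemma I1_Fredholm a : subalg_set (I1 K) a -> ~ idealF K a ->
  exists r g, [/\ subalg_set (I1 K) r, idealF K g & I10 K (a * r + g)].
Proof.
move=> Ia nFa; have [N Tt] := I1_opIn_lower Ia.
have t0 : a * I ^+ N <> 0 by move=> t0; apply: nFa; apply/idealFP; exists N.
have [n [N0 HN]] := lower_alg_growth Tt t0.
(* For size f > M one has size (D^n f) > N0, where the growth of a I^N is known. *)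
pose M := (N0 + n)%N.
pose s : E := 1 + (a * I ^+ N * D ^+ n - 1) * (I ^+ M * D ^+ M).
exists (I ^+ N * D ^+ n * (I ^+ M * D ^+ M)), (1 - I ^+ M * D ^+ M).
have sE : a * (I ^+ N * D ^+ n * (I ^+ M * D ^+ M)) + (1 - I ^+ M * D ^+ M) = s.
  by rewrite /s mulrBl mul1r !mulrA addrCA.
split; last rewrite sE; last split.
- by do ?[apply: subalgM]; apply: subalgX; first [exact: I1I|exact: I1D].
- exact: idealF_subId.
- apply: subalgD; first exact: subalg1.
  apply: subalgM; last by apply: subalgM; apply: subalgX; first [exact: I1I|exact: I1D].
  apply: subalgB; last exact: subalg1.
  by do ?[apply: subalgM] => //; apply: subalgX; first [exact: I1I|exact: I1D].
apply: size_preserving_bij => f; rewrite -sE.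
have [le|lt] := leqP (size f) M.
  have -> : (a * (I ^+ N * D ^+ n * (I ^+ M * D ^+ M)) + (1 - I ^+ M * D ^+ M)) f =
     (a * I ^+ N * D ^+ n * I ^+ M) ((D ^+ M) f) + (f - (I ^+ M) ((D ^+ M) f)) by [].
  by rewrite (opDn_size le) end0 end0 add0r subr0.
have D0 : (D ^+ M) f != 0 by rewrite -size_poly_gt0 size_opDn subn_gt0.
set h := (I ^+ M * D ^+ M) f.
have sh : size h = size f.
  by rewrite /h end_mulE size_opIn // size_opDn; lia.
have -> : (a * (I ^+ N * D ^+ n * (I ^+ M * D ^+ M)) + (1 - I ^+ M * D ^+ M)) f =
   (a * I ^+ N) ((D ^+ n) h) + (f - h) by [].
have s1 : size ((D ^+ n) h) = (size f - n)%N by rewrite size_opDn sh.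
have s2 : size ((a * I ^+ N) ((D ^+ n) h)) = size f.
  by rewrite HN s1; lia.
rewrite size_polyDl // s2; apply: leq_ltn_trans lt.
rewrite -subn_eq0 -size_opDn size_poly_eq0.
have -> : (D ^+ M) (f - h) = (D ^+ M * (1 - I ^+ M * D ^+ M)) f by [].
by rewrite mulrBr mulr1 mulrA opDnIn mul1r subrr.
Qed.

Lemma I10_sub_I1 s : I10 K s -> subalg_set (I1 K) s. Proof. by case. Qed.

(** If a were not in F, then a bijective a r + g would have finite rank. *)
Lemma I1_finrank a : subalg_set (I1 K) a -> C a -> idealF K a.
Proof.
move=> Ia Ca; apply: contrapT => /(I1_Fredholm Ia)[r [g [Ir Fg [_ [s' sK Ks]]]]].
have fs p : (a * r + g) (s' p) = p by apply: Ks.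
have : C (a * r + g) by apply: finrankD; [apply: finrank_mulr|apply: idealF_finrank].
move=> /finrankP[l Hl]; apply: finrank1; apply/finrankP; exists l => v.
by rewrite end_1E -[v]fs; apply: Hl.
Qed.

(** * Common multiples by counting dimensions *)

Lemma lindep (J1 J2 : finType) (V : lmodType K) (x : J1 -> V) (e : J2 -> V) :
  (forall i, exists c : J2 -> K, x i = \sum_j c j *: e j) -> (#|J2| < #|J1|)%N ->
  exists2 c : J1 -> K, exists i, c i <> 0 & \sum_i c i *: x i = 0.
Proof.
move=> H lt; pose A := \matrix_(i < #|J1|, j < #|J2|)
  sval (cid (H (enum_val i))) (enum_val j).
have /rowV0Pn[v /sub_kermxP vA v0] : kermx A != 0.
  by rewrite kermx_eq0 /row_free neq_ltn (leq_ltn_trans (rank_leq_col A) lt).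
have [j vj] : exists j, v 0 j <> 0.
  apply: contrapT => H0; case/eqP: v0; apply/rowP => j; rewrite [RHS]mxE.
  by apply: contrapT => vj; apply: H0; exists j.
exists (fun i => v 0 (enum_rank i)); first by exists (enum_val j); rewrite enum_valK.
have xE i : x i = \sum_j A (enum_rank i) (enum_rank j) *: e j.
  under eq_bigr do rewrite mxE !enum_rankK.
  by case: cid.
under eq_bigr => i _ do rewrite xE scaler_sumr.
rewrite exchange_big big1 //= => k _.
under eq_bigr do rewrite scalerA.
rewrite -scaler_suml; have := congr1 (fun M : 'rV_#|J2| => M 0 (enum_rank k)) vA.
rewrite !mxE (reindex (@enum_rank J1)) /= => [->|]; first by rewrite scale0r.
by exists enum_val => i _; [rewrite enum_rankK|rewrite enum_valK].
Qed.

Definition lower_basis {n q : nat} (ij : 'I_n * 'I_q) : E := I ^+ ij.1 * euler 'X^(ij.2).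

Lemma lower_filt_coef n q t :
    lower_filt n q t -> exists c : 'I_n * 'I_q -> K, t = \sum_ij c ij *: lower_basis ij.
Proof.
move=> [p [sp ->]]; exists (fun ij : 'I_n * 'I_q => (p ij.1)`_(ij.2)).
rewrite -(pair_bigA _ (fun (i : 'I_n) (j : 'I_q) => (p i)`_j *: lower_basis (i, j))) /=.
apply: eq_bigr => i _.
have pE : p i = \sum_(j < q) (p i)`_j *: 'X^j.
  by rewrite -poly_def; apply/polyP => j; rewrite coef_poly; case: ltnP => // le;
    rewrite nth_default // (leq_trans (sp i)).
rewrite {1}pE euler_sum mulr_sumr; apply: eq_bigr => j _.
by rewrite eulerZ -scalerAr.
Qed.

Definition lower_comb {n q : nat} (c : 'I_n * 'I_q -> K) : E := \sum_ij c ij *: lower_basis ij.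

Lemma lower_comb_op n q (c : 'I_n * 'I_q -> K) :
  exists p : nat -> {poly K}, [/\ lower_comb c = lower_op n p, forall i, (size (p i) <= q)%N &
    forall (i : 'I_n) (j : 'I_q), (p i)`_j = c (i, j)].
Proof.
exists (fun i => if insub i is Some i' then \poly_(j < q)
   (if insub j is Some j' then c (i', j') else 0) else 0); split.
- have -> : lower_comb c = \sum_(i < n) \sum_(j < q) c (i, j) *: lower_basis (i, j).
    by rewrite pair_bigA; apply: eq_bigr => -[].
  apply: eq_bigr => i _; rewrite valK poly_def euler_sum mulr_sumr.
  by apply: eq_bigr => j _; rewrite valK eulerZ -scalerAr.
- by move=> i; case: insub => [i'|]; rewrite ?size_poly ?size_poly0.
- by move=> i j; rewrite valK coef_poly ltn_ord valK.
Qed.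

Lemma lower_comb_filt n q (c : 'I_n * 'I_q -> K) : lower_filt n q (lower_comb c).
Proof. by have [p [-> sp _]] := lower_comb_op c; exists p. Qed.

Lemma lower_comb_eq0 n q (c : 'I_n * 'I_q -> K) : lower_comb c = 0 -> forall ij, c ij = 0.
Proof.
have [p [-> sp pc]] := lower_comb_op c => /lower_op_eq0 p0 [i j].
by rewrite -pc p0 ?coef0.
Qed.

(** The images of f and g on a space of dimension n^2 lie in one of dimension
(n + m)^2, which is less than 2 n^2 for n = 3 m + 1. *)
Lemma lower_filt_meet (f g : E -> E) m :
  linear f -> linear g ->
  (forall n t, lower_filt n n t -> lower_filt (n + m) (n + m) (f t)) ->
  (forall n t, lower_filt n n t -> lower_filt (n + m) (n + m) (g t)) ->
  exists u v, [/\ lower_alg u, lower_alg v, u <> 0 \/ v <> 0 & f u = g v].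
Proof.
move=> lf lg Tf Tg; pose n := (3 * m).+1.
pose J := ('I_n * 'I_n)%type; pose J2 := ('I_(n + m) * 'I_(n + m))%type.
pose x (i : J + J) := match i with inl ij => f (lower_basis ij) | inr ij => - g (lower_basis ij) end.
have TB (ij : J) : lower_filt n n (lower_basis ij).
  by apply: lower_filt_monomial; rewrite ?size_polyXn.
have [|| c [i ci] Ec] := @lindep (J + J)%type J2 E x (@lower_basis _ _).
- case=> ij; apply: lower_filt_coef; first exact/Tf/TB.
  by rewrite /x -scaleN1r -[_ *: _]addr0; apply: lower_filtL; [exact/Tg/TB|exact: lower_filt0].
- by rewrite card_sum !card_prod !card_ord /n; nia.
pose F : {linear E -> E} := HB.pack f (GRing.isLinear.Build K E E _ f lf).
pose G : {linear E -> E} := HB.pack g (GRing.isLinear.Build K E E _ g lg).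
exists (lower_comb (fun ij : J => c (inl ij))), (lower_comb (fun ij : J => c (inr ij))).
split.
- by exists n, n; apply: lower_comb_filt.
- by exists n, n; apply: lower_comb_filt.
- apply: contrapT => /not_orP[/contrapT u0 /contrapT v0]; case: i ci => ij.
    by rewrite (lower_comb_eq0 u0).
  by rewrite (lower_comb_eq0 v0).
apply/eqP; rewrite -subr_eq0; apply/eqP.
have fE (h : {linear E -> E}) (c' : J -> K) : h (lower_comb c') = \sum_ij c' ij *: h (lower_basis ij).
  by rewrite linear_sum; apply: eq_bigr => ij _; rewrite linearZ.
rewrite -[RHS]Ec big_sumType /=; congr (_ + _); first exact: (fE F).
rewrite -[g _]/(G _) fE -sumrN; apply: eq_bigr => ij _.
by rewrite scalerN.
Qed.

Lemma lower_alg_right_ore a b : lower_alg a -> lower_alg b -> b <> 0 ->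
  exists u v, [/\ lower_alg u, lower_alg v, v <> 0 & a * v = b * u].
Proof.
move=> [n [q Ta]] [m [r Tb]] b0; pose M := (n + q + m + r)%N.
have Tab c : lower_filt M M c -> forall k t, lower_filt k k t -> lower_filt (k + M) (k + M) (c * t).
  by move=> Tc k t Tt; rewrite addnC; apply: lower_filtM.
have [|||| u [v [Tu Tv uv E1]]] := @lower_filt_meet (fun t => b * t) (fun t => a * t) M.
- by move=> k s t; rewrite mulrDr -scalerAr.
- by move=> k s t; rewrite mulrDr -scalerAr.
- by apply: Tab; apply: lower_filt_widen Tb; rewrite /M; lia.
- by apply: Tab; apply: lower_filt_widen Ta; rewrite /M; lia.
exists u, v; split=> // v0; move: E1; rewrite v0 mulr0 => bu.
have [//|u0] := lower_alg_domain (ex_intro _ m (ex_intro _ r Tb)) Tu bu.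
by case: uv.
Qed.

(** Counting is blind to the side, so right multiplications serve as well as left ones. *)
Lemma lower_alg_left_ore a b : lower_alg a -> lower_alg b -> b <> 0 ->
  exists u v, [/\ lower_alg u, lower_alg v, v <> 0 & v * a = u * b].
Proof.
move=> [n [q Ta]] [m [r Tb]] b0; pose M := (n + q + m + r)%N.
have Tab c : lower_filt M M c -> forall k t, lower_filt k k t -> lower_filt (k + M) (k + M) (t * c).
  by move=> Tc k t Tt; apply: lower_filtM.
have [|||| u [v [Tu Tv uv E1]]] := @lower_filt_meet (fun t => t * b) (fun t => t * a) M.
- by move=> k s t; rewrite mulrDl -scalerAl.
- by move=> k s t; rewrite mulrDl -scalerAl.
- by apply: Tab; apply: lower_filt_widen Tb; rewrite /M; lia.
- by apply: Tab; apply: lower_filt_widen Ta; rewrite /M; lia.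
exists u, v; split=> // v0; move: E1; rewrite v0 mul0r => bu.
have [u0|//] := lower_alg_domain Tu (ex_intro _ m (ex_intro _ r Tb)) bu.
by case: uv.
Qed.

Lemma lower_alg_notF t : lower_alg t -> t <> 0 -> ~ idealF K t.
Proof.
move=> Tt t0 /idealFP[N tN].
case: (lower_alg_domain Tt (lower_alg_opIn N) tN) => // IN0.
by have := opDnIn N; rewrite IN0 mulr0 => /esym/eqP; rewrite oner_eq0.
Qed.

Lemma I1_right_ore a b : subalg_set (I1 K) a -> subalg_set (I1 K) b -> ~ idealF K b ->
  exists u v, [/\ subalg_set (I1 K) u, subalg_set (I1 K) v, ~ idealF K v & a * v = b * u].
Proof.
move=> Ia Ib nFb; have [N Ta] := I1_opIn_lower Ia; have [M Tb] := I1_opIn_lower Ib.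
have b0 : b * I ^+ M <> 0 by move=> b0; apply: nFb; apply/idealFP; exists M.
have [u [v [Tu Tv v0 E1]]] := lower_alg_right_ore Ta Tb b0.
exists (I ^+ M * u), (I ^+ N * v); split; last by rewrite !mulrA.
- by apply: subalgM; [apply: subalgX; exact: I1I|exact: lower_alg_I1].
- by apply: subalgM; [apply: subalgX; exact: I1I|exact: lower_alg_I1].
apply: lower_alg_notF; first by apply: lower_algM => //; apply: lower_alg_opIn.
by move=> Iv0; apply: v0; rewrite -[v]mul1r -(opDnIn N) -mulrA Iv0 mulr0.
Qed.

(** Equality holds on the image of some I^N, whence the error in F. *)
Lemma I1_left_ore a b : subalg_set (I1 K) a -> subalg_set (I1 K) b -> ~ idealF K b ->
  exists u v, [/\ subalg_set (I1 K) u, subalg_set (I1 K) v, ~ idealF K v &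
    idealF K (v * a - u * b)].
Proof.
move=> Ia Ib nFb; have [N Ta] := I1_opIn_lower Ia; have [M Tb] := I1_opIn_lower Ib.
have Ta' : lower_alg (a * I ^+ (N + M)) by rewrite exprD mulrA; apply/lower_algM/lower_alg_opIn.
have Tb' : lower_alg (b * I ^+ (N + M)) by rewrite addnC exprD mulrA; apply/lower_algM/lower_alg_opIn.
have b0 : b * I ^+ (N + M) <> 0 by move=> b0; apply: nFb; apply/idealFP; exists (N + M)%N.
have [u [v [Tu Tv v0 E1]]] := lower_alg_left_ore Ta' Tb' b0.
exists u, v; split; [exact: lower_alg_I1|exact: lower_alg_I1|exact: lower_alg_notF|].
by apply/idealFP; exists (N + M)%N; rewrite mulrBl -!mulrA E1 subrr.
Qed.

(** * The Weyl algebra modulo F *)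

(** The commutator with X is locally nilpotent on A_1.  If a X^(N+1) = 0 and
ad^(n+1) a = 0, then a X satisfies the same with N, so a X = 0 by induction;
then ad a = - X a satisfies the same with n, so X a = 0, and X is injective. *)
Lemma weylA1_idealF0 a : subalg_set (weylA1 K) a -> idealF K a -> a = 0.
Proof.
pose ad (b : E) := b * X - X * b.
have adL k b c : ad (k *: b + c) = k *: ad b + ad c.
  by rewrite /ad mulrDl mulrDr -scalerAl -scalerAr scalerBr opprD addrACA.
have adM b c : ad (b * c) = ad b * c + b * ad c.
  by rewrite /ad mulrBl mulrBr !mulrA [RHS]addrC addrA subrK.
pose nil n (b : E) := iter n ad b = 0.
have nilL n k b c : nil n b -> nil n c -> nil n (k *: b + c).
  rewrite /nil => nb nc; suff -> : iter n ad (k *: b + c) = k *: iter n ad b + iter n ad c.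
    by rewrite nb nc scaler0 addr0.
  by elim: n {nb nc} => //= n ->; rewrite adL.
have nil0 n : nil n 0 by elim: n => //= n; rewrite /nil /= => ->; rewrite /ad mul0r mulr0 subr0.
have nilD n b c : nil n b -> nil n c -> nil n (b + c).
  by move=> nb nc; rewrite -[b]scale1r; apply: nilL.
have nilS n m b : (n <= m)%N -> nil n b -> nil m b.
  by move=> le nb; rewrite /nil -(subnK le) iterD nb; apply: nil0.
have nilM n m b c : nil n b -> nil m c -> nil (n + m)%N (b * c).
  elim: n m b c => [|n IHn] m b c nb nc; first by rewrite (nb : b = 0) mul0r; apply: nil0.
  elim: m c nc => [|m IHm] c nc; first by rewrite (nc : c = 0) mulr0; apply: nil0.
  rewrite /nil addnS iterSr adM; apply: nilD.
    by rewrite addSnnS; apply: IHn => //; rewrite /nil -iterSr.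
  by apply: IHm; rewrite /nil -iterSr.
move=> Aa; have [n na] : exists n, nil n a.
  apply: (Aa [set b | exists n, nil n b]).
    split=> [|k b c|b c]; rewrite !inE.
    - by exists 1%N; rewrite /nil /= /ad mul1r mulr1 subrr.
    - by move=> [n nb] [m mc]; exists (n + m)%N; apply: nilL; [apply: nilS nb|apply: nilS mc]; lia.
    - by move=> [n nb] [m mc]; exists (n + m)%N; apply: nilM.
  move=> _ [->|->]; first by exists 1%N; rewrite /nil /= /ad subrr.
  have adD : ad D = 1.
    rewrite /ad; have := opDnX K 0; rewrite !expr1 expr0 scale1r => ->.
    by rewrite addrC addKr.
  by exists 2%N; rewrite /nil /= adD /ad mul1r mulr1 subrr.
move=> /idealFP[N aN].
have {}aN : a * X ^+ N = 0.
  have -> : X ^+ N = I ^+ N * D ^+ N * X ^+ N.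
    apply: EndP => f; apply/eqP; rewrite -subr_eq0.
    have -> : (X ^+ N) f - (I ^+ N * D ^+ N * X ^+ N) f = (1 - I ^+ N * D ^+ N) ((X ^+ N) f) by [].
    rewrite subIdE end_sumE big1 // => k _; rewrite eijE.
    have -> : (X ^+ N) f = 'X^N * f.
      by elim: (N) => [|M IH]; rewrite ?mul1r // end_expS IH exprS -mulrA.
    by rewrite /dpcoef coefXnM ltn_ord mul0r scale0r.
  by rewrite !mulrA aN !mul0r.
have Xinj b : X * b = 0 -> b = 0.
  move=> Xb; apply: EndP => f; have : 'X * b f = 0 by rewrite -[LHS]/((X * b) f) Xb.
  by move=> /eqP; rewrite mulf_eq0 polyX_eq0 => /eqP.
elim: n N a {Aa} na aN => [|n IHn] N a; first by rewrite /nil.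
elim: N a => [|N IHN] a na; first by rewrite mulr1.
rewrite exprS mulrA => aN; have aX : a * X = 0.
  apply: IHN => //; rewrite -[a * X]scale1r -[_ *: _]addr0.
  have : iter n.+1 ad (a * X) = iter n.+1 ad a * X.
    elim: n.+1 => //= k ->; rewrite /ad mulrBl !mulrA; congr (_ - _).
  by rewrite /nil scale1r addr0 => ->; rewrite na mul0r.
apply: Xinj; apply/eqP; rewrite -oppr_eq0; apply/eqP.
have adE : ad a = - (X * a) by rewrite /ad aX sub0r.
rewrite -adE; apply: (IHn N.+1); first by rewrite /nil -iterSr.
by rewrite adE exprS mulrA mulNr -mulrA aX mulr0 oppr0 mul0r.
Qed.

(** The product lies in I_1 and has finite rank, hence is in F; for an arbitrary
endomorphism a it can leave F, see e00_1D_notF. *)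
Lemma idealF_mulr f a : idealF K f -> subalg_set (I1 K) a -> idealF K (f * a).
Proof.
move=> Ff Ia; apply: I1_finrank; last exact/finrank_mulr/idealF_finrank.
by apply: subalgM => //; apply: idealF_I1.
Qed.

(** Translation of the variable is undone by the opposite translation. *)
Lemma shiftp_surj n p : exists q, shiftp n q = p.
Proof.
elim: n p => [|n IH] p; first by exists p.
have [q Eq] := IH (p \Po ('X - 1)); exists q.
rewrite /shiftp iterS -/(shiftp n q) Eq -comp_polyA comp_polyB comp_polyX.
by rewrite -polyC1 comp_polyC addrK comp_polyXr.
Qed.

(** The subspace A_1 + F. *)
Definition weyl_modF (t : E) := exists2 a, subalg_set (weylA1 K) a & idealF K (t - a).

Lemma weyl_modF_sub t u : idealF K (t - u) -> weyl_modF u -> weyl_modF t.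
Proof.
move=> Ftu [a Aa Fua]; exists a => //.
by rewrite -[t](subrK u) -addrA; apply: idealFD.
Qed.

Lemma weyl_modF_sum n (t : 'I_n -> E) : (forall i, weyl_modF (t i)) -> weyl_modF (\sum_i t i).
Proof.
move=> H; apply: (big_ind weyl_modF) => // [|x y [a Aa Fa] [b Ab Fb]].
  by exists 0; [exact: subalg0|rewrite subr0; exact: idealF0].
by exists (a + b); [exact: subalgD|rewrite opprD addrACA; exact: idealFD].
Qed.

(** I^i p(H) D^M is congruent to D^(M-i) q(H), where q is a translate of p, since
I^i D^i is congruent to 1. *)
Lemma lower_op_opDn n p M : (n <= M)%N -> weyl_modF (lower_op n p * D ^+ M).
Proof.
move=> le; rewrite /lower_op mulr_suml; apply: weyl_modF_sum => i.
have [q Eq] := shiftp_surj M (p i).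
exists (D ^+ (M - i) * euler q).
  by apply: subalgM; [apply: subalgX; exact: weylA1D|apply: subalg_euler; [exact: weylA1X|exact: weylA1D]].
have iM : (i <= M)%N by have := ltn_ord i; lia.
rewrite -mulrA -Eq -opDn_euler -{1}(subnKC iM) exprD -opprB -mulrN1.
apply: idealF_mulr; last by rewrite -scaleN1r; apply/subalgZ/subalg1.
have -> : D ^+ (M - i) * euler q - I ^+ i * (D ^+ i * D ^+ (M - i) * euler q) =
    (1 - I ^+ i * D ^+ i) * (D ^+ (M - i) * euler q).
  by rewrite mulrBl mul1r !mulrA.
apply: idealF_mulr; first exact: idealF_subId.
by apply: subalgM; [apply: subalgX; exact: I1D|apply: subalg_euler; [exact: I1X|exact: I1D]].
Qed.

Lemma opDn_lower_op n p M N :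
    (n <= M)%N -> subalg_set (weylA1 K) (D ^+ M * lower_op n p * D ^+ N).
Proof.
move=> le; apply: subalgM; last by apply: subalgX; exact: weylA1D.
rewrite /lower_op mulr_sumr.
apply: (big_ind (subalg_set (weylA1 K))) => [|a b|i _]; [exact: subalg0|exact: subalgD|].
have iM : (i <= M)%N by have := ltn_ord i; lia.
have -> : D ^+ M * (I ^+ i * euler (p i)) = D ^+ (M - i) * euler (p i).
  by rewrite -{1}(subnK iM) exprD -mulrA [_ * (I ^+ i * _)]mulrA opDnIn mul1r.
by apply: subalgM; [apply: subalgX; exact: weylA1D|apply: subalg_euler; [exact: weylA1X|exact: weylA1D]].
Qed.

Lemma I1_weylr a : subalg_set (I1 K) a ->
  exists N, forall n, (N <= n)%N -> weyl_modF (a * D ^+ n).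
Proof.
move=> Ia; have [N [m [q [p [_ Ep]]]]] := I1_opIn_lower Ia; exists m => n le.
apply: (@weyl_modF_sub _ (a * I ^+ N * D ^+ (N + n))); last first.
  by rewrite Ep; apply: lower_op_opDn; lia.
have -> : a * D ^+ n - a * I ^+ N * D ^+ (N + n) = a * ((1 - I ^+ N * D ^+ N) * D ^+ n).
  by rewrite mulrBl mul1r mulrBr exprD !mulrA.
apply: idealF_mull; apply: idealF_mulr; first exact: idealF_subId.
by apply: subalgX; exact: I1D.
Qed.

Lemma I1_weyll a : subalg_set (I1 K) a ->
  exists N, forall n, (N <= n)%N -> weyl_modF (D ^+ n * a).
Proof.
move=> Ia; have [N [m [q [p [_ Ep]]]]] := I1_opIn_lower Ia; exists m => n le.
exists (D ^+ n * (a * I ^+ N) * D ^+ N); first by rewrite Ep; apply: opDn_lower_op.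
have -> : D ^+ n * a - D ^+ n * (a * I ^+ N) * D ^+ N = D ^+ n * a * (1 - I ^+ N * D ^+ N).
  by rewrite mulrBr mulr1 !mulrA.
exact/idealF_mull/idealF_subId.
Qed.

(** * Fractions with denominators in I_1^0 *)

Lemma I10_unit s : I10 K s -> s \is a GRing.unit.
Proof. by case=> _ bs; apply/asboolP. Qed.
Lemma I10V s : I10 K s -> s^-1 * s = 1.
Proof. by move=> /I10_unit; apply: mulVr. Qed.
Lemma I10K s : I10 K s -> s * s^-1 = 1.
Proof. by move=> /I10_unit; apply: divrr. Qed.

Lemma I10_intro s s' : subalg_set (I1 K) s -> s' * s = 1 -> s * s' = 1 -> I10 K s.
Proof.
move=> Is e1 e2; split=> //; exists s' => f.
  by rewrite -end_mulE e1.
by rewrite -end_mulE e2.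
Qed.

Lemma I101 : I10 K 1.
Proof. by apply: (@I10_intro _ 1); rewrite ?mulr1 //; apply: subalg1. Qed.

Lemma I10M s t : I10 K s -> I10 K t -> I10 K (s * t).
Proof.
move=> Hs Ht; apply: (@I10_intro _ (t^-1 * s^-1)).
- by apply: subalgM; [case: Hs|case: Ht].
- by rewrite mulrA -[_ * s]mulrA I10V // mulr1 I10V.
- by rewrite mulrA -[s * t * _]mulrA I10K // mulr1 I10K.
Qed.

(** For r v = s u with v outside F, correct v to s' = v w + g in I_1^0.  The error
r g is in F, and s^-1 r g is again in F, so it can be absorbed into r'. *)
Lemma I10_common_multiple r s : subalg_set (I1 K) r -> I10 K s ->
  exists r' s', [/\ subalg_set (I1 K) r', I10 K s' & r * s' = s * r'].
Proof.
move=> Ir Hs; have Is := I10_sub_I1 Hs.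
have nFs : ~ idealF K s.
  move=> Fs; apply: finrank1; rewrite -(I10V Hs); apply: finrank_mull.
  exact: idealF_finrank.
have [u [v [Iu Iv nFv E1]]] := I1_right_ore Ir Is nFs.
have [w [g [Iw Fg Hs']]] := I1_Fredholm Iv nFv.
exists (u * w + s^-1 * (r * g)), (v * w + g); split=> //.
  apply: subalgD; first exact: subalgM.
  by apply: idealF_I1; apply: idealF_mull; apply: idealF_mull.
by rewrite !mulrDr !mulrA E1 I10K // mul1r.
Qed.

Lemma I1_tI1 a : subalg_set (I1 K) a -> subalg_set (tI1 K) a.
Proof. exact: I1_sub_tI1. Qed.
Lemma I10V_tI1 s : I10 K s -> subalg_set (tI1 K) s^-1.
Proof. by move=> Hs; apply: gen_sub; right; exists s. Qed.

Lemma rfractionsP (Y : set E) q : rfractions Y q <-> exists2 s, I10 K s & Y (q * s).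
Proof.
split=> [[s [f [Hs Yf ->]]]|[s Hs Yqs]].
  by exists s => //; rewrite -mulrA I10V // mulr1.
by exists s, (q * s); split=> //; rewrite -mulrA I10K // mulr1.
Qed.

(** The right fractions are closed under the ring operations by the Ore condition. *)
Lemma tI1P q : subalg_set (tI1 K) q <-> exists2 s, I10 K s & subalg_set (I1 K) (q * s).
Proof.
split=> [|[s Hs Is]]; last first.
  rewrite -[q]mulr1 -(I10K Hs) mulrA; apply: subalgM; first exact: I1_tI1.
  exact: I10V_tI1.
move=> Tq; apply: (Tq [set q | exists2 s, I10 K s & subalg_set (I1 K) (q * s)]); last first.
  move=> q' [Iq|[s Hs <-]]; first by exists 1; rewrite ?mulr1 //; exact: I101.
  by exists s => //; rewrite I10V //; exact: subalg1.
split=> [|k b c|b c]; rewrite !inE.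
- by exists 1; rewrite ?mulr1; [exact: I101|exact: subalg1].
- move=> [s Hs Ib] [t Ht Ic].
  have [s' [t' [Is' Ht' E1]]] := I10_common_multiple (I10_sub_I1 Hs) Ht.
  exists (s * t'); first exact: I10M.
  rewrite mulrDl -scalerAl; apply: subalgL.
    by rewrite mulrA; apply: subalgM => //; exact: I10_sub_I1.
  by rewrite E1 mulrA; apply: subalgM.
- move=> [s Hs Ib] [t Ht Ic].
  have [c' [s' [Ic' Hs' E1]]] := I10_common_multiple Ic Hs.
  exists (t * s'); first exact: I10M.
  rewrite -mulrA [c * _]mulrA E1 mulrA; exact: subalgM.
Qed.

Lemma finrank_unitr q s : I10 K s -> C (q * s) -> C q.
Proof. by move=> Hs Cqs; rewrite -[q]mulr1 -(I10K Hs) mulrA; apply: finrank_mulr. Qed.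

Lemma rfractionsF q : rfractions (idealF K) q <-> subalg_set (tI1 K) q /\ C q.
Proof.
split=> [/rfractionsP[s Hs Fq]|[/tI1P[s Hs Is] Cq]].
  split; first by apply/tI1P; exists s => //; exact: idealF_I1.
  by apply: (finrank_unitr Hs); exact: idealF_finrank.
by apply/rfractionsP; exists s => //; apply: I1_finrank => //; apply: finrank_mulr.
Qed.

(** * The skew field of tI_1 modulo finite rank *)

Lemma tI1_rinv q : subalg_set (tI1 K) q -> ~ C q ->
  exists2 q', subalg_set (tI1 K) q' & C (q * q' - 1).
Proof.
move=> /tI1P[s Hs Is] nCq.
have nFqs : ~ idealF K (q * s).
  by move=> /idealF_finrank /(finrank_unitr Hs).
have [r [g [Ir Fg Ht]]] := I1_Fredholm Is nFqs.
set t := q * s * r + g in Ht.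
exists (s * r * t^-1).
  by apply: subalgM; [apply: subalgM; apply: I1_tI1 => //; exact: I10_sub_I1|exact: I10V_tI1].
have -> : q * (s * r * t^-1) - 1 = - (g * t^-1).
  have -> : q * (s * r * t^-1) = (t - g) * t^-1 by rewrite /t addrK !mulrA.
  by rewrite mulrBl I10K // addrAC subrr sub0r.
by apply/finrankN/finrank_mulr/idealF_finrank.
Qed.

Lemma finrank_trans (a b c : E) : C (a - b) -> C (b - c) -> C (a - c).
Proof. by move=> Cab Cbc; rewrite -[a](subrK b) -addrA; apply: finrankD. Qed.
Lemma finrank_sym (a b : E) : C (a - b) -> C (b - a).
Proof. by move=> Cab; rewrite -opprB; apply: finrankN. Qed.

(** In a monoid with zero in which every nonzero element has a right inverse, right
inverses are two-sided: q' has a right inverse too, and it is congruent to q. *)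
Lemma tI1_inv q : subalg_set (tI1 K) q -> ~ C q ->
  exists q', [/\ subalg_set (tI1 K) q', C (q * q' - 1) & C (q' * q - 1)].
Proof.
move=> Tq nCq; have [q' Tq' C1] := tI1_rinv Tq nCq.
have nCq' : ~ C q'.
  move=> Cq'; apply: finrank1; rewrite -[1](subrK (q * q')) -opprB.
  by apply: finrankD; [exact: finrankN|exact: finrank_mull].
have [q'' Tq'' C2] := tI1_rinv Tq' nCq'.
exists q'; split=> //.
(* q is congruent to q q' q'', hence to q''. *)
have Cqq : C (q - q'').
  apply: (@finrank_trans _ (q * (q' * q''))).
    by rewrite -{1}[q]mulr1 -mulrBr; apply/finrank_mull/finrank_sym.
  by rewrite mulrA -{2}[q'']mul1r -mulrBl; apply: finrank_mulr.
apply: (@finrank_trans _ (q' * q'')) => //.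
by rewrite -mulrBr; apply: finrank_mull.
Qed.

Lemma weylA1_finrank0 a : subalg_set (weylA1 K) a -> C a -> a = 0.
Proof.
by move=> Aa Ca; apply: weylA1_idealF0 => //; apply: I1_finrank => //; exact: weylA1_sub_I1.
Qed.

Lemma finrank_opDn_mull n q : C (D ^+ n * q) -> C q.
Proof.
move=> CD; have -> : q = I ^+ n * (D ^+ n * q) + (1 - I ^+ n * D ^+ n) * q.
  by rewrite mulrBl mul1r mulrA addrC subrK.
apply: finrankD; first exact: finrank_mull.
by apply/finrank_mulr/idealF_finrank/idealF_subId.
Qed.

Lemma finrank_opDn_mulr n q : C (q * D ^+ n) -> C q.
Proof. by move=> CD; rewrite -[q]mulr1 -(opDnIn n) mulrA; apply: finrank_mulr. Qed.

(** From q = a s^-1 with a, s in I_1: multiply both by a power of D that brings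
them into A_1 + F. *)
Lemma tI1_weylr q : subalg_set (tI1 K) q -> exists a s,
  [/\ subalg_set (weylA1 K) a, subalg_set (weylA1 K) s, s <> 0 & C (q * s - a)].
Proof.
move=> /tI1P[s Hs Iqs].
have [N HN] := I1_weylr Iqs; have [M HM] := I1_weylr (I10_sub_I1 Hs).
have [a Aa Fa] := HN (N + M)%N (leq_addr _ _).
have [t At Ft] := HM (N + M)%N (leq_addl _ _).
exists a, t; split=> //.
  move=> t0; move: Ft; rewrite t0 subr0 => /idealF_finrank/finrank_opDn_mulr Cs.
  by apply: finrank1; rewrite -(I10V Hs); apply: finrank_mull.
apply: finrank_trans (idealF_finrank Fa).
by rewrite -mulrA -mulrBr; apply/finrank_mull/finrank_sym/idealF_finrank.
Qed.

(** The left Ore property of I_1 modulo F turns the right fraction q into a left one. *)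
Lemma tI1_weyll q : subalg_set (tI1 K) q -> exists a s,
  [/\ subalg_set (weylA1 K) a, subalg_set (weylA1 K) s, s <> 0 & C (s * q - a)].
Proof.
move=> /tI1P[s Hs Iqs].
have nFs : ~ idealF K s.
  move=> /idealF_finrank Cs.
  by apply: finrank1; rewrite -(I10V Hs); apply: finrank_mull.
have [u [v [Iu Iv nFv E1]]] := I1_left_ore Iqs (I10_sub_I1 Hs) nFs.
have [N HN] := I1_weyll Iu; have [M HM] := I1_weyll Iv.
have [a Aa Fa] := HN (N + M)%N (leq_addr _ _).
have [t At Ft] := HM (N + M)%N (leq_addl _ _).
exists a, t; split=> //.
  move=> t0; apply: nFv; apply: I1_finrank => //; apply: (@finrank_opDn_mull (N + M)).
  by move: Ft; rewrite t0 subr0 => /idealF_finrank.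
have Cvq : C (v * q - u).
  by apply: (finrank_unitr Hs); rewrite mulrBl -mulrA; exact: idealF_finrank.
apply: finrank_trans (idealF_finrank Fa).
apply: (@finrank_trans _ (D ^+ (N + M) * v * q)).
  by rewrite -mulrBl; apply/finrank_mulr/finrank_sym/idealF_finrank.
by rewrite -mulrA -mulrBr; apply: finrank_mull.
Qed.

(** ker q lies in the image of q' q - 1, and the image of q together with that of
q q' - 1 is everything. *)
Lemma inv_fredholm (V : infLmodType K) (q q' : End V) :
  finrank (q * q' - 1) -> finrank (q' * q - 1) -> fredholm q.
Proof.
move=> /finrankP[s Hs] /finrankP[t Ht]; split.
  apply: (@sub_findim _ _ _ t) => [|v /= qv].
    split=> [|a u v]; rewrite !inE /=; first exact: linear0.
    by move=> qu qv; rewrite linearP qu qv scaler0 addr0.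
  have := Ht (- v); rewrite end_addE end_oppE end_mulE end_1E linearN qv.
  by rewrite oppr0 linear0 sub0r opprK.
exists s => v; exists (q (q' v)); first by exists (q' v).
have := Hs (- v); rewrite end_addE end_oppE end_mulE end_1E opprK !linearN /=.
by rewrite addrC.
Qed.

(** * F against its fractions *)

Lemma lfractions_idealF : lfractions (idealF K) = idealF K.
Proof.
apply/seteqP; split=> [_ [s [f [_ Ff ->]]]|f Ff]; first exact: idealF_mull.
by exists 1, f; split=> //; [exact: I101|rewrite invr1 mul1r].
Qed.

(** The map 1 - D is triangular with ones on the diagonal; its inverse is the sum of the D^i. *)
Lemma I10_1D : I10 K (1 - D).
Proof.
split; first by apply: subalgB; [exact: subalg1|exact: I1D].
apply: size_preserving_bij => f; have [->|f0] := eqVneq f 0.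
  by rewrite end0 size_poly0.
rewrite end_addE end_oppE size_polyDl // size_polyN size_opD.
by rewrite prednK ?size_poly_gt0.
Qed.

Lemma I10_1D_dp k : (eij K 0 0 * (1 - D)^-1) (dp k) = dp 0.
Proof.
rewrite end_mulE; elim: k => [|k IH].
  have {1}-> : dp 0 = (1 - D) (dp 0) by rewrite end_addE end_oppE opD_dp0 subr0 end_1E.
  by rewrite -end_mulE -end_mulE -mulrA I10V ?mulr1 ?eij_dp ?scale1r //; exact: I10_1D.
rewrite -[RHS]IH; apply/eqP; rewrite -subr_eq0 -linearB -linearB.
have -> : dp k.+1 - dp k = (1 - D) (dp k.+1) by rewrite end_addE end_oppE opD_dp end_1E.
rewrite -end_mulE -end_mulE -mulrA I10V ?mulr1 ?eij_dp ?scale0r //; exact: I10_1D.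
Qed.

(** The row 0 of (1 - D)^-1 has all its entries equal to 1, whereas a matrix in F
has finitely many nonzero entries. *)
Lemma e00_1D_notF : ~ idealF K (eij K 0 0 * (1 - D)^-1).
Proof.
move=> /idealFP[N HN]; have := I10_1D_dp (N + 0); rewrite -opIn_dp -end_mulE HN end_0E.
by move=> /esym/eqP; rewrite -size_poly_eq0 size_dp.
Qed.

Lemma idealF_proper : idealF K `<` rfractions (idealF K).
Proof.
split=> [f Ff|H]; first by apply/rfractionsP; exists 1; rewrite ?mulr1 //; exact: I101.
apply: e00_1D_notF; apply: H; apply/rfractionsP; exists (1 - D); first exact: I10_1D.
by rewrite -mulrA I10V ?mulr1; [exact: idealF_eij|exact: I10_1D].
Qed.

(** * Elements of subalgebras as operators *)

Lemma alg_valS (S : subalg E) (a : alg_of S) : subalg_set S (alg_val a).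
Proof. by have := alg_valP a; rewrite inE. Qed.

Lemma alg_ofP (S : subalg E) q : subalg_set S q -> exists a : alg_of S, alg_val a = q.
Proof. by move=> /mem_set Sq; exists (AlgOf Sq). Qed.

Section Values.
Variable S : subalg E.
Implicit Types a b : alg_of S.

Lemma alg_val_inj : injective (@alg_val K E S).
Proof. exact: val_inj. Qed.
Lemma alg_val0 : alg_val (0 : alg_of S) = 0. Proof. by []. Qed.
Lemma alg_val1 : alg_val (1 : alg_of S) = 1. Proof. by []. Qed.
Lemma alg_valB a b : alg_val (a - b) = alg_val a - alg_val b. Proof. by []. Qed.
Lemma alg_valD a b : alg_val (a + b) = alg_val a + alg_val b. Proof. by []. Qed.
Lemma alg_valM a b : alg_val (a * b) = alg_val a * alg_val b. Proof. by []. Qed.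
Lemma alg_valZ (k : K) a : alg_val (k *: a) = k *: alg_val a. Proof. by []. Qed.
Lemma alg_val_sum n (a : 'I_n -> alg_of S) :
  alg_val (\sum_i a i) = \sum_i alg_val (a i).
Proof. by elim/big_ind2: _ => // x x' y y'; rewrite alg_valD => -> ->. Qed.
End Values.

Local Notation A := (alg_of (I1 K)).
Local Notation R := (alg_of (tI1 K)).
Local Notation val := (@alg_val K E _).
Local Notation I10A := (inside (I1 K) (I10 K)).

(** * The Ore localization of I_1 *)

Lemma I10_mulr_closed : mulr_closed (mem I10A).
Proof.
split=> [|a b]; rewrite !inE; first exact: I101.
exact: I10M.
Qed.

Lemma I10_right_ore : right_ore I10A.
Proof.
move=> r s Ss; have [r' [s' [Ir' Hs' E1]]] := I10_common_multiple (alg_valS r) Ss.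
have [x Ex] := alg_ofP Ir'; have [y Ey] := alg_ofP (I10_sub_I1 Hs').
exists x, y; split; first by rewrite /inside /= Ey.
by apply: alg_val_inj; rewrite !alg_valM Ey E1 -Ex.
Qed.

(** A relation s' e_00 = r' (1 - D) would put e_00 (1 - D)^-1 = s'^-1 r' in F, because
r' has finite rank and s'^-1 F is contained in F. *)
Lemma I10_not_left_ore : ~ left_ore I10A.
Proof.
move=> H; have [r Er] := alg_ofP (idealF_I1 (idealF_eij 0 0)).
have [s Es] := alg_ofP (I10_sub_I1 I10_1D).
have [|r' [s' [Hs' E1]]] := H r s; first by rewrite /inside /= Es; exact: I10_1D.
have {}E1 : val s' * eij K 0 0 = val r' * (1 - D).
  by rewrite -Er -Es -!alg_valM E1.
have rE : val r' = val s' * eij K 0 0 * (1 - D)^-1.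
  by rewrite E1 -mulrA I10K ?mulr1 //; exact: I10_1D.
apply: e00_1D_notF.
have -> : eij K 0 0 * (1 - D)^-1 = (val s')^-1 * val r'.
  by rewrite rE -mulrA mulKr //; exact: I10_unit.
apply: idealF_mull; apply: I1_finrank; first exact: alg_valS.
rewrite rE.
by apply/finrank_mulr/finrank_mull/idealF_finrank/idealF_eij.
Qed.

Lemma tI1_localization : is_right_localization I10A (I1_incl K).
Proof.
split=> [s Hs|l|a].
- have [b Eb] := alg_ofP (I10V_tI1 Hs); exists b; split; apply: alg_val_inj.
    by rewrite alg_valM Eb; exact: I10K.
  by rewrite alg_valM Eb; exact: I10V.
- have /tI1P[s Hs Is] := alg_valS l.
  have [a Ea] := alg_ofP Is; have [t Et] := alg_ofP (I10_sub_I1 Hs).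
  exists a, t; split; first by rewrite /inside /= Et.
  by apply: alg_val_inj; rewrite alg_valM Et -Ea.
split=> [a0|[s [Hs as0]]].
  exists 1; split; first exact: I101.
  by rewrite mulr1; apply: alg_val_inj; exact: (congr1 val a0).
have {}as0 : val a * val s = 0 by rewrite -alg_valM as0.
by apply: alg_val_inj; rewrite -[LHS]mulr1 -(I10K Hs) mulrA as0 mul0r.
Qed.

Lemma I10_ore_localization : [/\ mulr_closed (mem I10A), right_ore I10A, ~ left_ore I10A
    & iso_right_localization I10A (I1_incl K)].
Proof.
split; [exact: I10_mulr_closed|exact: I10_right_ore|exact: I10_not_left_ore|].
split; first by exists R, (I1_incl K); exact: tI1_localization.
move=> L theta H.
have [g gb gP] := right_localization_uniq I10_mulr_closed H tI1_localization.
by exists g.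
Qed.

(** * Two-sided ideals of tI_1 *)

Local Notation J := (sub_finrank_algideal (tI1 K)).
Local Notation inJ := (algideal_set (sub_finrank_algideal (tI1 K))).

Lemma inside_rfractionsF : inside (tI1 K) (rfractions (idealF K)) = algideal_set J.
Proof.
apply/seteqP; split=> a; rewrite /inside /=; first by move=> /rfractionsF[].
by move=> Ca; apply/rfractionsF; split=> //; exact: alg_valS.
Qed.

Lemma tI1_finrankE : tI1 K `&` C = rfractions (idealF K).
Proof. by apply/seteqP; split=> q; rewrite rfractionsF. Qed.

Lemma inJE (a : R) : inJ a = C (val a). Proof. by []. Qed.

Lemma eij_tI1 i j : subalg_set (tI1 K) (eij K i j).
Proof. by apply: I1_tI1; apply: idealF_I1; exact: idealF_eij. Qed.

Definition eR i j : R := AlgOf (mem_set (eij_tI1 i j)).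

Lemma val_eR i j : val (eR i j) = eij K i j. Proof. by []. Qed.

Lemma inJ_inverse (q : R) : ~ C (val q) ->
  exists q' : R, inJ (q * q' - 1) /\ inJ (q' * q - 1).
Proof.
move=> nC; have [q' [Tq' C1 C2]] := tI1_inv (alg_valS q) nC.
have [x Ex] := alg_ofP Tq'; exists x.
by rewrite !inJE !alg_valB !alg_valM alg_val1 Ex.
Qed.

Lemma eR_conj (a : R) : a <> 0 -> exists j k (c : K), c != 0 /\
  forall i l, eR i j * a * eR k l = c *: eR i l.
Proof.
move=> a0; have [|j [k /eqP c0]] := @E_neq0 (val a).
  by move=> va0; apply: a0; apply: alg_val_inj.
exists j, k, (dpcoef j (val a (dp k))); split=> // i l.
by apply: alg_val_inj; rewrite alg_valZ !alg_valM !val_eR eij_conj.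
Qed.

(** A product f s^-1 has the rows of index less than n as its only nonzero rows, where
n bounds the rows of f. *)
Lemma inJ_row_unit (a : R) : inJ a -> exists n, a = (\sum_(i < n) eR i i) * a.
Proof.
rewrite -inside_rfractionsF => /rfractionsP[s Hs Fas].
have [n [c Ec]] := Fas; exists n; apply: alg_val_inj.
rewrite alg_valM alg_val_sum.
under eq_bigr do rewrite val_eR.
rewrite -subIdE mulrBl mul1r.
suff -> : I ^+ n * D ^+ n * val a = 0 by rewrite subr0.
rewrite -[val a]mulr1 -(I10K Hs) [val a * _]mulrA Ec mulrA.
suff -> : I ^+ n * D ^+ n * (\sum_(i < n) \sum_(j < n) c i j *: eij K i j) = 0.
  by rewrite mul0r.
rewrite -mulrA; suff -> : D ^+ n * (\sum_(i < n) \sum_(j < n) c i j *: eij K i j) = 0.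
  by rewrite mulr0.
rewrite mulr_sumr big1 // => i _; rewrite mulr_sumr big1 // => j _.
rewrite -scalerAr; apply/eqP; rewrite scaler_eq0; apply/orP; right; apply/eqP.
by apply: end_ext => k; rewrite end_mulE eij_dp endZ opDn_dp0 // scaler0.
Qed.

(** A nonzero matrix entry of an element of Y yields all the matrix units. *)
Lemma two_sided_eR (Y : set R) : two_sided_ideal Y -> Y <> [set 0] ->
  forall i j, Y (eR i j).
Proof.
move=> [[[Y0 YB] YL] [_ YR]] Yn0 i l.
have [a Ya a0] : exists2 a, Y a & a <> 0.
  apply: contrapT => H; apply: Yn0; apply/seteqP; split=> [a Ya|_ ->].
    by apply: contrapT => a0; apply: H; exists a.
  by rewrite inE in Y0.
have [j [k [c [c0 E1]]]] := eR_conj a0.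
have -> : eR i l = (c^-1 *: eR i j) * a * eR k l.
  by rewrite -!scalerAl E1 scalerA mulVf // scale1r.
exact/YR/YL.
Qed.

Lemma inJ_sub_two_sided (Y : set R) : two_sided_ideal Y -> Y <> [set 0] -> inJ `<=` Y.
Proof.
move=> HY Yn0 a Ja; have YE := two_sided_eR HY Yn0.
have [[[Y0 YB] YL] [_ YR]] := HY; rewrite inE in Y0.
have YD b c : Y b -> Y c -> Y (b + c).
  move=> Yb Yc; have YN : Y (- c) by have := YB 0 c; rewrite !inE sub0r; apply.
  by have := YB b (- c); rewrite !inE opprK; apply.
have [n ->] := inJ_row_unit Ja; apply: YR.
by apply: (big_ind Y) => // i _.
Qed.

Lemma inJ_ideal : two_sided_ideal inJ. Proof. exact: algideal_ideal. Qed.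

Lemma inJ_eR i j : inJ (eR i j).
Proof. exact/idealF_finrank/idealF_eij. Qed.

Lemma eR_neq0 i j : eR i j <> 0.
Proof.
move=> /(congr1 val) e; have := eij_dp i j j; rewrite -val_eR e alg_val0.
rewrite end_0E eqxx scale1r => /esym/eqP.
by rewrite -size_poly_eq0 size_dp.
Qed.

Lemma proper_two_sided_idealP (Y : set R) :
  proper_two_sided_ideal Y <-> Y = inside (tI1 K) (rfractions (idealF K)).
Proof.
rewrite inside_rfractionsF; split=> [[HY Yn0 YnT]|->]; last first.
  split; [exact: inJ_ideal| |exact: algideal_neqT].
  by move=> J0; have := inJ_eR 0 0; rewrite J0 => /eR_neq0.
have JY := inJ_sub_two_sided HY Yn0.
apply/seteqP; split=> // a Ya; apply: contrapT => nJa.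
have [q' [_ Jq]] := inJ_inverse nJa; apply: YnT; apply/seteqP; split=> // r _.
have [[[Y0 YB] YL] [_ YR]] := HY.
have Y1 : Y 1.
  have := YB (q' * a) (q' * a - 1); rewrite !inE subKr; apply.
    exact: YL.
  exact: JY.
by rewrite -[r]mulr1; apply: YL.
Qed.

Lemma inJ_square : ideal_prod inJ inJ = inJ.
Proof.
have [[[J0 JB] JL] [_ JR]] := inJ_ideal; rewrite inE in J0.
apply/seteqP; split=> [_ [n [a [b [Ja Jb ->]]]]|a Ja].
  apply: (big_ind inJ) => // [x y Jx Jy|i _]; last exact: JR.
  exact: algidealD.
have [n Ea] := inJ_row_unit Ja.
exists 1%N, (fun=> \sum_(i < n) eR i i), (fun=> a); split=> //.
  by move=> _; apply: (big_ind inJ) => // [x y Jx Jy|i _]; [exact: algidealD|exact: inJ_eR].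
by rewrite big_ord1.
Qed.

Lemma tI1_proper_ideal : [/\ rfractions (idealF K) `<=` tI1 K,
      forall Y : set R,
        proper_two_sided_ideal Y <-> Y = inside (tI1 K) (rfractions (idealF K))
    & ideal_prod (inside (tI1 K) (rfractions (idealF K)))
                 (inside (tI1 K) (rfractions (idealF K)))
      = inside (tI1 K) (rfractions (idealF K))].
Proof.
split; [by move=> q /rfractionsF[]|exact: proper_two_sided_idealP|].
by rewrite inside_rfractionsF inJ_square.
Qed.

(** * The quotient as skew field of fractions of A_1 *)

Lemma weylA1_sub_tI1 : weylA1 K `<=` tI1 K.
Proof. by move=> a /weylA1_sub_I1 /I1_tI1. Qed.

Definition weyl_quot : {lrmorphism alg_of (weylA1 K) -> quot_alg J} :=
  quot_class J \o alg_incl weylA1_sub_tI1.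

Lemma quot_class0 (a : R) : quot_class J a = 0 <-> inJ a.
Proof.
have -> : (0 : quot_alg J) = quot_class J 0 by rewrite (linear0 (quot_class J)).
by rewrite quot_classP subr0.
Qed.

Lemma weyl_quot_fractions : is_skew_fractions weyl_quot.
Proof.
split=> [a b|q q0|q|q].
- move=> /quot_classP Cab; apply: alg_val_inj; apply/eqP; rewrite -subr_eq0; apply/eqP.
  by apply: weylA1_finrank0 => //; apply: subalgB; exact: alg_valS.
- have [a Ea] := quot_class_surj q; rewrite Ea in q0 *.
  have [|q' [C1 C2]] := inJ_inverse (q := a); first by move/quot_class0.
  by exists (quot_class J q'); rewrite -!quot_classM; split; apply/quot_classP.
- have [x ->] := quot_class_surj q.
  have [a [s [Aa As s0 Cqs]]] := tI1_weylr (alg_valS x).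
  have [a' Ea] := alg_ofP Aa; have [s' Es] := alg_ofP As.
  exists a', s'; split; first by move=> s'0; apply: s0; rewrite -Es s'0.
  rewrite /weyl_quot /= -quot_classM; apply/quot_classP.
  by rewrite inJE alg_valB alg_valM /= Ea Es.
- have [x ->] := quot_class_surj q.
  have [a [s [Aa As s0 Cqs]]] := tI1_weyll (alg_valS x).
  have [a' Ea] := alg_ofP Aa; have [s' Es] := alg_ofP As.
  exists a', s'; split; first by move=> s'0; apply: s0; rewrite -Es s'0.
  rewrite /weyl_quot /= -quot_classM; apply/quot_classP.
  by rewrite inJE alg_valB alg_valM /= Ea Es.
Qed.

Lemma quot_iso_Frac : iso_Frac (quot_alg J) (alg_of (weylA1 K)).
Proof. exact: iso_Frac_intro weyl_quot_fractions. Qed.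

(** * The image in the Calkin algebra *)

Lemma tI1_fredholm f : subalg_set (tI1 K) f -> ~ C f -> fredholm f.
Proof. by move=> Tf nCf; have [q' [_ C1 C2]] := tI1_inv Tf nCf; apply: inv_fredholm C1 C2. Qed.

Local Notation cimage := (calkin_image (tI1 K)).
Local Notation cl := (@calkin_class K {poly K}).

Lemma calkin_eq f g : cl f = cl g <-> C (f - g).
Proof. exact: quot_classP. Qed.
Lemma calkin0 : cl 0 = 0.
Proof. exact: (linear0 (quot_class (finrank_algideal {poly K}))). Qed.
Lemma calkinM f g : cl (f * g) = cl f * cl g.
Proof. exact: quot_classM. Qed.
Lemma calkinL k f g : cl (k *: f + g) = k *: cl f + cl g.
Proof. exact: (linearP (quot_class (finrank_algideal {poly K}))). Qed.

Lemma cim_subalg : is_subalg cimage.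
Proof.
split=> [|k a b|a b]; rewrite !inE.
- by exists 1 => //; exact: subalg1.
- by move=> [f Tf <-] [g Tg <-]; exists (k *: f + g); [exact: subalgL|exact: calkinL].
- by move=> [f Tf <-] [g Tg <-]; exists (f * g); [exact: subalgM|exact: calkinM].
Qed.

(** The image of tI_1 is already a skew field, hence closed under the inverses that
are adjoined. *)
Lemma cim_frac : frac_family (tI1 K) cimage.
Proof.
split=> // [_ [f Tf <-]|a b [f Tf <-] f0 ab ba].
  have [Cf|nCf] := pselect (C f); [right|left].
    by rewrite /set1 /= -calkin0; apply/calkin_eq; rewrite subr0.
  by exists f => //; exact: tI1_fredholm.
have [|q' [Tq' C1 C2]] := tI1_inv Tf.
  by move=> Cf; apply: f0; rewrite -calkin0; apply/calkin_eq; rewrite subr0.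
exists q' => //; rewrite -[b]mul1r -[1]/(cl 1).
have <- : cl (q' * f) = cl 1 by apply/calkin_eq.
by rewrite calkinM -mulrA ab mulr1.
Qed.

Lemma fracV_tI1 : [/\ frac_defined (tI1 K),
      alg_iso (alg_of (fracV (tI1 K))) (quot_alg J)
    & iso_Frac (quot_alg J) (alg_of (weylA1 K))].
Proof.
split; last exact: quot_iso_Frac.
  split; first exact: tI1_fredholm.
  by exists cimage; split; [exact: cim_subalg|exact: cim_frac].
have fracE x : subalg_set (fracV (tI1 K)) x <-> cimage x.
  split=> [Fx|cx B Bs [_ cB _]]; last exact: cB.
  by apply: Fx; [exact: cim_subalg|exact: cim_frac].
have [||||||f fb _] := @alg_iso_graph K (alg_of (fracV (tI1 K))) (quot_alg J)
   (fun u v => exists a : R, alg_val u = cl (val a) /\ v = quot_class J a); last by exists f.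
- move=> k u v u' v' [a [ea ->]] [b [eb ->]]; exists (k *: a + b).
  by rewrite linearP -[alg_val (k *: u + v)]/(k *: alg_val u + alg_val v) ea eb -calkinL.
- by exists 1.
- move=> u v u' v' [a [ea ->]] [b [eb ->]]; exists (a * b).
  by rewrite quot_classM -[alg_val (u * v)]/(alg_val u * alg_val v) ea eb -calkinM.
- move=> u; have := alg_valP u; rewrite inE => /fracE[f Tf ef].
  by have [a Ea] := alg_ofP Tf; exists (quot_class J a), a; rewrite Ea.
- move=> v; have [a ->] := quot_class_surj v.
  have /mem_set Fa : subalg_set (fracV (tI1 K)) (cl (val a)).
    by apply/fracE; exists (val a) => //; exact: alg_valS.
  by exists (AlgOf Fa), a.
- move=> u v [a [ea ->]]; rewrite quot_class0; split=> [u0|Ja].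
    by have /calkin_eq := etrans (esym ea) (etrans (congr1 _ u0) (esym calkin0)); rewrite subr0.
  by apply: val_inj; rewrite /= ea -[RHS]calkin0; apply/calkin_eq; rewrite subr0.
Qed.

(** * Simple left modules *)

Lemma eR_mul i j k l : eR i j * eR k l = (j == k)%:R *: eR i l.
Proof. by apply: alg_val_inj; rewrite alg_valM alg_valZ !val_eR eij_mul. Qed.

Lemma eR_mul_mid i j l : eR i j * eR j l = eR i l.
Proof. by rewrite eR_mul eqxx scale1r. Qed.

(** The left ideal generated by e_00 is minimal. *)
Lemma eR00_left_inverse (r : R) : r * eR 0 0 <> 0 -> exists s, s * (r * eR 0 0) = eR 0 0.
Proof.
move=> /eR_conj[j [k [c [c0 E1]]]]; exists (c^-1 *: eR 0 j).
have := E1 0%N 0%N; rewrite -!mulrA eR_mul.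
have [_|_] := eqVneq 0%N k; last first.
  rewrite scale0r !mulr0 => /esym/eqP; rewrite scaler_eq0 (negbTE c0) /=.
  by move=> /eqP/eR_neq0.
by rewrite scale1r -scalerAl => ->; rewrite scalerA mulVf // scale1r.
Qed.

Lemma eR00_right_inverse (r : R) : eR 0 0 * r <> 0 -> exists s, eR 0 0 * r * s = eR 0 0.
Proof.
move=> /eR_conj[j [k [c [c0 E1]]]]; exists (c^-1 *: eR k 0).
have := E1 0%N 0%N; rewrite !mulrA eR_mul.
have [_|_] := eqVneq j 0%N; last first.
  rewrite scale0r !mul0r => /esym/eqP; rewrite scaler_eq0 (negbTE c0) /=.
  by move=> /eqP/eR_neq0.
by rewrite scale1r -scalerAr => ->; rewrite scalerA mulVf // scale1r.
Qed.

(** C is generated by e_00 as a two-sided ideal. *)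
Lemma inJ_span (a : R) : inJ a ->
  exists n (x y : 'I_n -> R), a = \sum_i x i * eR 0 0 * y i.
Proof.
move=> /inJ_row_unit[n {1}->]; exists n, (fun i => eR i 0), (fun i => eR 0 i * a).
by rewrite mulr_suml; apply: eq_bigr => i _; rewrite eR_mul_mid mulrA eR_mul_mid.
Qed.

Lemma inJ_mulr (a b : R) : inJ a -> inJ (a * b).
Proof. by have [_ [_ H]] := inJ_ideal; apply: H. Qed.
Lemma inJ_mull (a b : R) : inJ b -> inJ (a * b).
Proof. by have [[_ H] _] := inJ_ideal; apply: H. Qed.
Lemma inJ1 : ~ inJ 1.
Proof. exact: finrank1. Qed.

Local Notation Kx := (nat_module (tI1 K) : lmodType R).
Local Notation FracL := (quot_lmod J).
Local Notation FracR := (quot_rmod J).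

Lemma Kx_gen (p : Kx) : exists r : R, p = r *: (dp 0 : Kx).
Proof.
exists (\sum_(k < size (p : {poly K})) dpcoef k p *: eR k 0).
rewrite scaler_suml {1}(dp_sum (leqnn (size (p : {poly K})))).
apply: eq_bigr => k _; rewrite -[RHS]/(dpcoef k p *: eij K k 0 (dp 0)).
by rewrite eij_dp scale1r.
Qed.

Lemma dp_neq0 k : dp k <> 0.
Proof. by move=> e; have := size_dp k; rewrite e size_poly0. Qed.

Lemma Kx_neq0 : (dp 0 : Kx) <> 0.
Proof. exact: dp_neq0. Qed.

Lemma eR00_Kx : eR 0 0 *: (dp 0 : Kx) = dp 0.
Proof. by rewrite -[LHS]/(eij K 0 0 (dp 0)) eij_dp scale1r. Qed.

Lemma Kx_simple : simple_module Kx.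
Proof.
apply: (simple_intro (m := dp 0 : Kx)); [exact: Kx_neq0|exact: Kx_gen|].
move=> x x0; have [j cj] : exists j, dpcoef j x != 0.
  apply: contrapT => H; apply: x0; apply: dpcoefP => j; rewrite linear0.
  by apply: contrapT => cj; apply: H; exists j; apply/eqP.
exists ((dpcoef j x)^-1 *: eR 0 j).
by rewrite -[LHS]/((dpcoef j x)^-1 *: eij K 0 j x) eijE scalerA mulVf // scale1r.
Qed.

Definition clL (a : R) : FracL := qmod_class _ (a : R^o).

Lemma clL_surj (x : FracL) : exists a, x = clL a.
Proof. by have [a ->] := qmod_class_surj x; exists a. Qed.
Lemma clLP a b : clL a = clL b <-> inJ (a - b).
Proof. exact: qmod_classP. Qed.
Lemma clLZ (r a : R) : r *: clL a = clL (r * a).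
Proof. by rewrite /clL -linearZ. Qed.
Lemma clL_eq0 a : clL a = 0 <-> inJ a.
Proof.
have -> : 0 = clL 0 by rewrite /clL linear0.
by rewrite clLP subr0.
Qed.
Lemma clL1_neq0 : clL 1 <> 0.
Proof. by rewrite clL_eq0; exact: inJ1. Qed.

Lemma FracL_ann (r : R) : r *: clL 1 = 0 <-> inJ r.
Proof. by rewrite clLZ mulr1 clL_eq0. Qed.

Lemma FracL_simple : simple_module FracL.
Proof.
apply: (simple_intro clL1_neq0) => x; have [a ->] := clL_surj x.
  by exists a; rewrite clLZ mulr1.
rewrite clL_eq0 => /inJ_inverse[b [_ Jb]]; exists b.
by rewrite clLZ clLP.
Qed.

Lemma FracL_e00 (x : FracL) : eR 0 0 *: x = 0.
Proof.
have [a ->] := clL_surj x; rewrite clLZ clL_eq0.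
by apply: inJ_mulr; exact: inJ_eR.
Qed.

Lemma not_mod_iso_act (P : pzRingType) (M N : lmodType P) (e : P) (m : M) :
  m <> 0 -> e *: m = m -> (forall n : N, e *: n = 0) -> ~ mod_iso M N.
Proof.
move=> m0 em eN [f [g fK gK]]; apply: m0; rewrite -[m]fK.
by rewrite -em linearZ_LR eN -(linear0 f) fK.
Qed.

Lemma tI1_simple_left_modules : [/\ simple_module Kx /\ simple_module FracL,
       ~ mod_iso Kx FracL,
       forall M : lmodType R,
         simple_module M -> mod_iso M Kx \/ mod_iso M FracL
     & faithful_module Kx /\ ~ faithful_module FracL].
Proof.
split.
- by split; [exact: Kx_simple|exact: FracL_simple].
- exact: (not_mod_iso_act Kx_neq0 eR00_Kx FracL_e00).
- apply: (@two_simple_modules _ inJ (eR 0 0) _ _ _ _ _ _ _ _ Kx_simple Kx_neq0 eR00_Kx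
    FracL_simple _ FracL_ann).
  + exact: eR_mul_mid.
  + exact: eR00_left_inverse.
  + exact: inJ_span.
  + by move=> a /inJ_inverse[b [_ Jb]]; exists b.
  + exact: clL1_neq0.
split; first by move=> r r0; apply: alg_val_inj; apply: EndP => v; exact: (r0 v).
move=> H; have e0 : eR 0 0 = 0 by apply: H => x; exact: FracL_e00.
exact: (eR_neq0 e0).
Qed.

(** * Simple right modules *)

Definition clR (a : R) : FracR := qmod_class _ (a : (R^c)^o).

Lemma clR_surj (x : FracR) : exists a, x = clR a.
Proof. by have [a ->] := qmod_class_surj x; exists a. Qed.
Lemma clRP a b : clR a = clR b <-> inJ (a - b).
Proof. exact: qmod_classP. Qed.
Lemma clRZ (a r : R) : (r : R^c) *: clR a = clR (a * r).
Proof. by rewrite /clR -linearZ. Qed.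
Lemma clR_eq0 a : clR a = 0 <-> inJ a.
Proof.
have -> : 0 = clR 0 by rewrite /clR linear0.
by rewrite clRP subr0.
Qed.
Lemma clR1_neq0 : clR 1 <> 0.
Proof. by rewrite clR_eq0; exact: inJ1. Qed.

Lemma FracR_ann (r : R^c) : r *: clR 1 = 0 <-> inJ r.
Proof. by rewrite clRZ mul1r clR_eq0. Qed.

Lemma FracR_simple : simple_module FracR.
Proof.
apply: (simple_intro clR1_neq0) => x; have [a ->] := clR_surj x.
  by exists a; rewrite clRZ mul1r.
rewrite clR_eq0 => /inJ_inverse[b [Jb _]]; exists b.
by rewrite clRZ clRP.
Qed.

Lemma FracR_e00 (x : FracR) : (eR 0 0 : R^c) *: x = 0.
Proof.
have [a ->] := clR_surj x; rewrite clRZ clR_eq0.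
by apply: inJ_mull; exact: inJ_eR.
Qed.

(** The quotient of tI_1 by this right ideal is isomorphic to e_00 tI_1; as a quotient
it receives I_1 / I I_1 without any choice of coordinates. *)
Definition e00_ann : set R := [set q | eR 0 0 * q = 0].
Fact e00_ann_submod : @submod_closed R^c (R^c)^o (mem e00_ann).
Proof.
split=> [|r a b]; rewrite !inE /e00_ann /=; first by rewrite mulr0.
by move=> a0 b0; rewrite mulrDr -[_ *: _]/((a : R) * r) mulrA a0 b0 mul0r addr0.
Qed.
Definition rowmod : lmodType R^c := quot_mod (Submod e00_ann_submod).
Definition rowcl (a : R) : rowmod := qmod_class (Submod e00_ann_submod) (a : (R^c)^o).

Lemma rowclP a b : rowcl a = rowcl b <-> eR 0 0 * a = eR 0 0 * b.
Proof.
rewrite /rowcl qmod_classP /= /e00_ann /=; rewrite mulrBr.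
by split=> [/eqP|->]; rewrite ?subrr // subr_eq0 => /eqP.
Qed.
Lemma rowclD a b : rowcl (a + b) = rowcl a + rowcl b.
Proof. exact: qmod_classD. Qed.
Lemma rowclZ a (r : R) : (r : R^c) *: rowcl a = rowcl (a * r).
Proof. by rewrite /rowcl -linearZ. Qed.
Lemma rowcl_eq0 a : rowcl a = 0 <-> eR 0 0 * a = 0.
Proof.
have -> : 0 = rowcl 0 by rewrite /rowcl linear0.
by rewrite rowclP mulr0.
Qed.
Lemma rowcl_surj (x : rowmod) : exists a, x = rowcl a.
Proof. by have [a ->] := @qmod_class_surj R^c (R^c)^o (Submod e00_ann_submod) x; exists a. Qed.

Lemma rowcl1_neq0 : rowcl 1 <> 0.
Proof. by rewrite rowcl_eq0 mulr1; exact: eR_neq0. Qed.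
Lemma eR00_rowmod : (eR 0 0 : R^c) *: rowcl 1 = rowcl 1.
Proof. by rewrite rowclZ mul1r rowclP mulr1 eR_mul_mid. Qed.

Lemma rowmod_simple : simple_module rowmod.
Proof.
apply: (simple_intro rowcl1_neq0) => x; have [a ->] := rowcl_surj x.
  by exists a; rewrite rowclZ mul1r.
rewrite rowcl_eq0 => /eR00_right_inverse[s Es]; exists s.
by rewrite rowclZ rowclP mulrA Es mulr1.
Qed.

Lemma rowmod_faithful : faithful_module rowmod.
Proof.
move=> r Hr; apply: contrapT => /eR_conj[j [k [c [c0 E1]]]].
have : eR 0 j * (r : R) * eR k 0 = 0.
  have := Hr (rowcl (eR 0 j)); rewrite rowclZ rowcl_eq0 mulrA eR_mul_mid => ->.
  by rewrite mul0r.
rewrite E1 => /eqP; rewrite scaler_eq0 (negbTE c0) => /eqP.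
exact: eR_neq0.
Qed.

Lemma tI1_simple_right (M : lmodType R^c) :
  simple_module M -> mod_iso M rowmod \/ mod_iso M FracR.
Proof.
apply: (@two_simple_modules R^c (inJ : set R^c) (eR 0 0 : R^c) _ _ _ _ _ _ _ _ rowmod_simple rowcl1_neq0 eR00_rowmod
    FracR_simple _ FracR_ann).
- exact: eR_mul_mid.
- exact: eR00_right_inverse.
- move=> a /inJ_span[n [x [y ->]]]; exists n, y, x.
  by apply: eq_bigr => i _; rewrite -[RHS]/((x i : R) * (eR 0 0 * y i)) mulrA.
- by move=> a /inJ_inverse[b [Jb _]]; exists b.
- exact: clR1_neq0.
Qed.

Local Notation intmod := (I1_mod_int K).
Local Notation intcl := (qmod_class (int_I1_mod K)).

Lemma val_I1_incl (a : A) : val (I1_incl K a) = val a. Proof. by []. Qed.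

(** Because e_00 = 1 - I D: if e_00 a = 0, then a = I (D a). *)
Lemma e00_I1_kernel (a : A) : eR 0 0 * I1_incl K a = 0 <-> intcl a = 0.
Proof.
have -> : (0 : intmod) = intcl 0 by rewrite linear0.
rewrite qmod_classP subr0; split=> [e0|[b ->]].
  have {}e0 : eij K 0 0 * val a = 0 by rewrite -val_eR -val_I1_incl -alg_valM e0.
  have [d Ed] := alg_ofP I1D; exists (d * a); apply: alg_val_inj.
  rewrite 2!alg_valM Ed mulrA -[val (opI1 K)]/I.
  apply/eqP; rewrite -subr_eq0 -[X in X - _]mul1r -mulrBl.
  by have := subIdE 1; rewrite big_ord1 !expr1 => ->; rewrite e0.
apply: alg_val_inj; rewrite alg_valM alg_val0 val_eR val_I1_incl alg_valM mulrA -[val (opI1 K)]/I.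
suff -> : eij K 0 0 * I = 0 by rewrite mul0r.
by apply: end_ext => k; rewrite end_mulE opI_dp eij_dp scale0r.
Qed.

(** The value does not depend on the representative, by rowmod_of_I1_class. *)
Definition rowmod_of_I1_fun (n : intmod) : rowmod := rowcl (I1_incl K (repr n)).

Lemma rowmod_of_I1_class (a : A) : rowmod_of_I1_fun (intcl a) = rowcl (I1_incl K a).
Proof.
apply/rowclP/eqP; rewrite -subr_eq0 -mulrBr -raddfB; apply/eqP/e00_I1_kernel.
rewrite raddfB /=; apply/eqP; rewrite subr_eq0; apply/eqP.
exact: reprK.
Qed.

Lemma intmod_surj (n : intmod) : exists a : A, n = intcl a.
Proof. by have [a ->] := @qmod_class_surj A^c (A^c)^o (int_I1_mod K) n; exists a. Qed.

Lemma intclZ (a r : A) : (r : A^c) *: intcl a = intcl (a * r).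
Proof. by rewrite -linearZ. Qed.

Lemma I1_inclM (a b : A) : I1_incl K (a * b) = I1_incl K a * I1_incl K b.
Proof. exact: rmorphM. Qed.

Fact rowmod_of_I1_additive : zmod_morphism rowmod_of_I1_fun.
Proof.
move=> m n; have [a ->] := intmod_surj m; have [b ->] := intmod_surj n.
rewrite -linearB !rowmod_of_I1_class; apply/eqP; rewrite eq_sym subr_eq -rowclD.
by rewrite raddfB subrK.
Qed.
Definition rowmod_of_I1 : {additive intmod -> rowmod} :=
  HB.pack rowmod_of_I1_fun (GRing.isZmodMorphism.Build intmod rowmod rowmod_of_I1_fun rowmod_of_I1_additive).

(** There is no torsion: e_00 a s = 0 with s invertible forces e_00 a = 0. *)
Lemma rowmod_localization :
  is_right_module_localization I10A (I1_incl K) rowmod_of_I1.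
Proof.
have th a : rowmod_of_I1 (intcl a) = rowcl (I1_incl K a) := rowmod_of_I1_class a.
split=> [r n|l|n].
- by have [a ->] := intmod_surj n; rewrite intclZ !th rowclZ I1_inclM.
- have [q ->] := rowcl_surj l; have /tI1P[s Hs Is] := alg_valS q.
  have [a Ea] := alg_ofP Is; have [t Et] := alg_ofP (I10_sub_I1 Hs).
  exists (intcl a), t; split; first by rewrite /inside /= Et.
  rewrite th rowclZ; congr rowcl; apply: alg_val_inj.
  by rewrite alg_valM [val (I1_incl K t)]Et -Ea.
have [a ->] := intmod_surj n; rewrite th rowcl_eq0; split=> [/e00_I1_kernel a0|[s Hs sa]].
  by exists 1; [exact: I101|rewrite a0 scaler0].
move: sa; rewrite intclZ => /e00_I1_kernel; rewrite I1_inclM mulrA => H.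
have [b [sb _]] : invertible (I1_incl K s) by have [inv _ _] := tI1_localization; apply: inv.
by rewrite -[LHS]mulr1 -sb mulrA H mul0r.
Qed.

Lemma I10_localization_iso (N N' : lmodType A^c) (L : lmodType R^c) :
  mod_iso N' N -> I10_localization N L -> I10_localization N' L.
Proof.
move=> [g [h gK hK]] [theta [lin fr ker]].
pose f (n : N') := theta (g n).
have fa : zmod_morphism f by move=> m n; rewrite /f !raddfB.
exists (HB.pack_for {additive N' -> L} f (GRing.isZmodMorphism.Build N' L f fa)).
split=> [r n|l|n].
- by rewrite /= /f linearZ_LR lin.
- by have [n [s [Ss e]]] := fr l; exists (h n), s; rewrite /= /f hK.
rewrite /= /f ker.
have gZ (s : A) : (s : A^c) *: g n = g ((s : A^c) *: n) by rewrite linearZ_LR.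
split=> -[s Ss e]; exists s => //; last by rewrite gZ e linear0.
by apply: (can_inj gK); rewrite -gZ e linear0.
Qed.

Lemma Kd_iso : mod_iso (Kd_mod charK0) intmod.
Proof.
pose f : Kd_mod charK0 -> intmod := @Kd_class K.
have fl : linear f.
  move=> r p q; rewrite /f Kd_classD; congr (_ + _).
  exact: (Kd_class_invK charK0 (r *: Kd_class p)).
exists (HB.pack_for {linear Kd_mod charK0 -> intmod} f (GRing.isLinear.Build _ _ _ _ f fl)).
exact: Kd_class_bij charK0.
Qed.

Lemma localization_uniq (L L' : lmodType R^c) :
  I10_localization intmod L -> I10_localization intmod L' -> mod_iso L L'.
Proof.
move=> [th Hth] [th' Hth']; have [inv fr _] := tI1_localization.
exact: (right_module_localization_uniq I10_mulr_closed I10_right_ore inv fr Hth Hth').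
Qed.

Lemma tI1_simple_right_modules : (exists L, I10_localization intmod L) /\
   (exists L, I10_localization (Kd_mod charK0) L) /\
   forall L L' : lmodType R^c,
     I10_localization intmod L ->
     I10_localization (Kd_mod charK0) L' ->
     mod_iso L L' /\
     [/\ simple_module L /\ simple_module FracR,
         ~ mod_iso L FracR,
         forall M : lmodType R^c,
           simple_module M -> mod_iso M L \/ mod_iso M FracR
       & faithful_module L /\ ~ faithful_module FracR].
Proof.
have loc0 : I10_localization intmod rowmod by exists rowmod_of_I1; exact: rowmod_localization.
split; first by exists rowmod.
split; first by exists rowmod; apply: I10_localization_iso loc0; exact: Kd_iso.
move=> L L' HL HL'.
have HL'' : I10_localization intmod L'.
  by apply: I10_localization_iso HL'; apply: mod_iso_sym; exact: Kd_iso.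
split; first exact: localization_uniq.
have L0L := localization_uniq loc0 HL.
split.
- by split; [exact: simple_mod_iso L0L rowmod_simple|exact: FracR_simple].
- move=> LF; apply: (not_mod_iso_act rowcl1_neq0 eR00_rowmod FracR_e00).
  exact: mod_iso_trans L0L LF.
- move=> M /tI1_simple_right[ML|MF]; [left|by right].
  exact: mod_iso_trans ML L0L.
split; first exact: faithful_mod_iso L0L rowmod_faithful.
move=> H; have e0 : eR 0 0 = 0 by apply: H => x; exact: FracR_e00.
exact: (eR_neq0 e0).
Qed.

(** * Sums of left ideals *)

(** The operator with column i equal to p and all other columns zero. *)
Definition colop i (p : {poly K}) : E := \sum_(k < size p) dpcoef k p *: eij K k i.

Lemma colop_dp i p k : colop i p (dp k) = (i == k)%:R *: p.
Proof.
rewrite /colop end_sumE [in RHS](dp_sum (leqnn (size p))) scaler_sumr.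
by apply: eq_bigr => j _; rewrite end_scaleE eij_dp !scalerA mulrC.
Qed.

Lemma EcolP i f : Ecol K i f <-> forall k, k <> i -> f (dp k) = 0.
Proof.
split=> [[n [c ->]] k ki|H].
  rewrite end_sumE big1 // => j _; rewrite end_scaleE eij_dp.
  by rewrite eq_sym (introF eqP ki) scale0r scaler0.
exists (size (f (dp i))), (fun j => dpcoef j (f (dp i))); rewrite -/(colop i (f (dp i))).
apply: end_ext => k; rewrite colop_dp.
by have [<-|/eqP ik] := eqVneq i k; rewrite ?scale1r // scale0r H // => ki; apply: ik.
Qed.

Lemma Ecol_colop i p : Ecol K i (colop i p).
Proof. by exists (size p), (fun k => dpcoef k p). Qed.

Lemma Ecol_idealF i : Ecol K i `<=` idealF K.
Proof.
move=> f /EcolP H; apply/idealFP; exists i.+1; apply: end_ext => k.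
by rewrite end_mulE opIn_dp H // => e; have := leq_addr k i.+1; rewrite e ltnn.
Qed.

Lemma Ecol_mull i a f : Ecol K i f -> Ecol K i (a * f).
Proof. by move=> /EcolP H; apply/EcolP => k ki; rewrite end_mulE H // end0. Qed.

Lemma Ecol_direct_sum : direct_sum (Ecol K) (idealF K).
Proof.
split.
  apply/seteqP; split=> [f /idealFP[N fN]|_ [n [u [Hu ->]]]]; last first.
    apply: (big_ind (idealF K)) => [|x y|i _]; [exact: idealF0|exact: idealFD|].
    exact: Ecol_idealF (Hu i).
  exists N, (fun i => f * eij K i i); split=> [i|].
    by apply: Ecol_mull; apply/EcolP => k ki; rewrite eij_dp eq_sym (introF eqP ki) scale0r.
  by rewrite -mulr_sumr -subIdE mulrBr mulr1 mulrA fN mul0r subr0.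
move=> n u Hu su i lt; apply: end_ext => k; rewrite end_0E.
have [->|/eqP ki] := eqVneq k i; last by have /EcolP := Hu i; apply.
have := congr1 (fun f : E => f (dp i)) su; rewrite /= end_sumE.
rewrite (bigD1 (Ordinal lt)) //= big1 ?addr0 // => j ji.
by have /EcolP := Hu j; apply=> e; case/eqP: ji; apply: val_inj.
Qed.

Lemma colop_tI1 i p : subalg_set (tI1 K) (colop i p).
Proof. by apply: I1_tI1; apply: idealF_I1; exact: Ecol_idealF (Ecol_colop i p). Qed.
Definition colr i (p : Kx) : R^o := AlgOf (mem_set (colop_tI1 i p)).

Fact colr_linear i : linear (colr i).
Proof.
move=> r p q; apply: alg_val_inj; apply: end_ext => k.
rewrite -[LHS]/(colop i (r *: p + q) (dp k)) colop_dp.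
rewrite -[RHS]/(val r (colop i p (dp k)) + colop i q (dp k)) !colop_dp endZ -scalerDr.
by [].
Qed.

(** The column i of an operator is its value at u_i, so that p |-> colop i p is an
isomorphism from K[x] compatible with composition. *)
Lemma Ecol_left_ideal i : [/\ Ecol K i `<=` tI1 K,
    left_ideal (inside (tI1 K) (Ecol K i)),
    Ecol K i <> [set 0],
    Ecol K i = [set f * eij K 0 i | f in idealF K]
  & exists2 f : {linear Kx -> R^o}, injective f & range f = inside (tI1 K) (Ecol K i)].
Proof.
split.
- by move=> f /Ecol_idealF /idealF_I1 /I1_tI1.
- split; last by move=> r a; exact: (@Ecol_mull i (val r) (val a)).
  split=> [|a b]; rewrite !inE; first by apply/EcolP => k _; exact: end_0E.
  move=> /EcolP Ha /EcolP Hb; change (Ecol K i (val a - val b)); apply/EcolP => k ki.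
  by rewrite end_addE end_oppE Ha // Hb // subrr.
- move=> H; have : Ecol K i (eij K 0 i).
    by apply/EcolP => k ki; rewrite eij_dp eq_sym (introF eqP ki) scale0r.
  by rewrite H => e0; have := eR_neq0 (alg_val_inj (e0 : val (eR 0 i) = val 0)).
- apply/seteqP; split=> [f Hf|_ [f Ff <-]].
    exists (f * eij K i 0).
      by apply: idealF_mull; exact: idealF_eij.
    rewrite -mulrA eij_mul eqxx scale1r; apply: end_ext => k.
    rewrite end_mulE eij_dp endZ; move/EcolP: Hf => Hf.
    by have [->|/eqP ki] := eqVneq i k; rewrite ?scale1r // scale0r Hf // => e; apply: ki.
  apply: Ecol_mull; apply/EcolP => k ki.
  by rewrite eij_dp eq_sym (introF eqP ki) scale0r.
exists (HB.pack_for {linear Kx -> R^o} (colr i) (GRing.isLinear.Build _ _ _ _ (colr i) (colr_linear i))).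
  move=> p q /= /(congr1 (fun x : R => val x (dp i))).
  by rewrite -[LHS]/(colop i p (dp i)) -[RHS]/(colop i q (dp i)) !colop_dp eqxx !scale1r.
apply/seteqP; split=> [_ [p _ <-]|a Ha]; first exact: Ecol_colop.
exists (val a (dp i)) => //=; apply: alg_val_inj; apply: end_ext => k.
rewrite -[LHS]/(colop i (val a (dp i)) (dp k)) colop_dp.
move/EcolP: Ha => Ha.
by have [->|/eqP ki] := eqVneq i k; rewrite ?scale1r // scale0r Ha // => e; apply: ki.
Qed.

(** The operators that vanish on u_k for all k >= n form a strictly increasing
sequence of left ideals. *)
Lemma not_left_noetherian : ~ left_noetherian R.
Proof.
move=> /(_ (fun n => [set a : R | val a * I ^+ n = 0])) [n|n a /= a0|N HN].
- split; last by move=> r a /= a0; change (val r * val a * I ^+ n = 0); rewrite -mulrA a0 mulr0.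
  split=> [|a b]; rewrite !inE /=; first exact: mul0r.
  by move=> a0 b0; change ((val a - val b) * I ^+ n = 0); rewrite mulrBl a0 b0 subrr.
- exact: idealFN (leqnSn n) a0.
have : [set a : R | val a * I ^+ N.+1 = 0] (eR 0 N).
  apply: end_ext => k; rewrite end_mulE opIn_dp.
  rewrite -[LHS]/(eij K 0 N (dp (N.+1 + k))) eij_dp.
  by rewrite ltn_eqF ?scale0r // leq_addr.
rewrite (HN N.+1 (leqnSn N)) /= => /(congr1 (fun f : E => f (dp 0))).
rewrite -[LHS]/(eij K 0 N ((I ^+ N) (dp 0))) opIn_dp addn0 eij_dp eqxx scale1r.
exact: dp_neq0.
Qed.

(** * Sums of right ideals *)

(** The operators with image in the kernel of D^n form a strictly increasing sequence
of right ideals. *)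
Lemma not_right_noetherian : ~ right_noetherian R.
Proof.
move=> /(_ (fun n => [set a : R | D ^+ n * val a = 0])) [n|n a /= a0|N HN].
- split; last by move=> r a /= a0; change (D ^+ n * (val a * val r) = 0); rewrite mulrA a0 mul0r.
  split=> [|a b]; rewrite !inE /=; first exact: mulr0.
  by move=> a0 b0; change (D ^+ n * (val a - val b) = 0); rewrite mulrBr a0 b0 subrr.
- by rewrite exprS -mulrA a0 mulr0.
have : [set a : R | D ^+ N.+1 * val a = 0] (eR N 0).
  apply: end_ext => k; rewrite end_mulE -[val (eR N 0)]/(eij K N 0) eij_dp.
  by rewrite endZ opDn_dp0 // scaler0.
rewrite (HN N.+1 (leqnSn N)) /= => /(congr1 (fun f : E => f (dp 0))).
rewrite -[LHS]/((D ^+ N) (eij K N 0 (dp 0))) eij_dp eqxx scale1r.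
have := opDn_dp N 0; rewrite addn0 => ->; exact: dp_neq0.
Qed.

(** Multiplication by e_ii isolates the component of index i, since e_ii e_jj = 0 for
j different from i. *)
Lemma row_direct_sum (U : nat -> set E) (W : set E) :
  W 0 -> (forall f g, W f -> W g -> W (f + g)) -> (forall i, U i `<=` W) ->
  (forall i f, U i f -> eij K i i * f = f) ->
  (forall i f, W f -> U i (eij K i i * f)) ->
  (forall f, W f -> exists n, f = (\sum_(i < n) eij K i i) * f) ->
  direct_sum U W.
Proof.
move=> W0 WD UW UE WU WS; split.
  apply/seteqP; split=> [f Wf|_ [n [u [Hu ->]]]]; last first.
    by apply: (big_ind W) => // i _; exact: UW (Hu i).
  have [n En] := WS f Wf; exists n, (fun i => eij K i i * f); split=> [i|].
    exact: WU.
  by rewrite {1}En mulr_suml.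
move=> n u Hu su i lt; rewrite -(UE _ _ (Hu i)).
have : eij K i i * (\sum_(j < n) u j) = 0 by rewrite su mulr0.
rewrite mulr_sumr (bigD1 (Ordinal lt)) //= big1 ?addr0 // => j ji.
rewrite -(UE _ _ (Hu j)) mulrA eij_mul (introF eqP) ?scale0r ?mul0r // => e.
by case/eqP: ji; apply: val_inj.
Qed.

Lemma rfractionsF_rows q : rfractions (idealF K) q ->
  exists n, q = (\sum_(i < n) eij K i i) * q.
Proof.
move=> Fq; have [a Ea] := alg_ofP (proj1 ((rfractionsF q).1 Fq)).
have Ja : inJ a by rewrite -inside_rfractionsF /inside /= Ea.
have [n En] := inJ_row_unit Ja; exists n; rewrite -Ea {1}En.
by rewrite alg_valM alg_val_sum.
Qed.

Lemma idealF_rfractions : idealF K `<=` rfractions (idealF K).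
Proof. by case: idealF_proper. Qed.

Lemma ErowP i f : Erow K i f <-> idealF K f /\ eij K i i * f = f.
Proof.
split=> [[n [c ->]]|[[n [c ->]] <-]].
  split.
    apply: (big_ind (idealF K)) => [|x y|j _]; [exact: idealF0|exact: idealFD|].
    by apply: idealFZ; exact: idealF_eij.
  rewrite mulr_sumr; apply: eq_bigr => j _.
  by rewrite -scalerAr eij_mul eqxx scale1r.
exists n, (fun b => \sum_(a < n) (i == a)%:R * c a b).
rewrite mulr_sumr; under [RHS]eq_bigr do rewrite scaler_suml.
rewrite [RHS]exchange_big; apply: eq_bigr => a _; rewrite mulr_sumr.
by apply: eq_bigr => b _; rewrite -scalerAr eij_mul scalerA mulrC.
Qed.

(** For q = a s^-1 the condition e_ii q = q reads e_ii a = a, and then a = e_ii a is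
in F since F is an ideal of I_1. *)
Lemma rfractions_ErowP i q :
  rfractions (Erow K i) q <-> subalg_set (tI1 K) q /\ eij K i i * q = q.
Proof.
split=> [/rfractionsP[s Hs /ErowP[Fqs E1]]|[/tI1P[s Hs Is] E1]].
  split; first by apply/tI1P; exists s => //; exact: idealF_I1.
  have -> : q = q * s * s^-1 by rewrite -mulrA I10K // mulr1.
  by rewrite mulrA E1.
apply/rfractionsP; exists s => //; apply/ErowP; rewrite mulrA E1; split=> //.
by rewrite -E1 -mulrA; apply: idealF_mulr => //; exact: idealF_eij.
Qed.

Lemma Erow_direct_sum : direct_sum (Erow K) (idealF K).
Proof.
apply: row_direct_sum; [exact: idealF0|exact: idealFD| | | |].
- by move=> i f /ErowP[].
- by move=> i f /ErowP[].
- move=> i f Ff; apply/ErowP; split; first exact: idealF_mull.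
  by rewrite mulrA eij_mul eqxx scale1r.
- by move=> f /idealF_rfractions /rfractionsF_rows.
Qed.

Lemma rfractions_Erow_direct_sum :
  direct_sum (fun i => rfractions (Erow K i)) (rfractions (idealF K)).
Proof.
apply: row_direct_sum.
- by apply: idealF_rfractions; exact: idealF0.
- move=> f g /rfractionsF[Tf Cf] /rfractionsF[Tg Cg]; apply/rfractionsF.
  by split; [exact: subalgD|exact: finrankD].
- move=> i q /rfractions_ErowP[Tq E1]; apply/rfractionsF; split=> //.
  by rewrite -E1; apply/finrank_mulr/idealF_finrank/idealF_eij.
- by move=> i q /rfractions_ErowP[].
- move=> i q /rfractionsF[Tq _]; apply/rfractions_ErowP.
  split; first by apply: subalgM => //; exact: eij_tI1.
  by rewrite mulrA eij_mul eqxx scale1r.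
- exact: rfractionsF_rows.
Qed.

Lemma rfractions_Erow_right_ideal i : [/\ rfractions (Erow K i) `<=` tI1 K,
    right_ideal (inside (tI1 K) (rfractions (Erow K i))),
    rfractions (Erow K i) <> [set 0]
  & Erow K i = [set eij K i 0 * f | f in idealF K]].
Proof.
split.
- by move=> q /rfractions_ErowP[].
- split; last first.
    move=> r a /rfractions_ErowP[Ta E1]; change (rfractions (Erow K i) (val a * val r)); apply/rfractions_ErowP.
    split; first by apply: subalgM => //; exact: alg_valS.
    by rewrite mulrA E1.
  split=> [|a b]; rewrite !inE.
    by apply/rfractions_ErowP; split; [exact: subalg0|exact: mulr0].
  move=> /rfractions_ErowP[_ Ea] /rfractions_ErowP[_ Eb].
  change (rfractions (Erow K i) (val a - val b)); apply/rfractions_ErowP.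
  split; first by apply: subalgB; exact: alg_valS.
  by rewrite mulrBr Ea Eb.
- move=> H; have : rfractions (Erow K i) (eij K i i).
    apply/rfractions_ErowP; split; first exact: eij_tI1.
    by rewrite eij_mul eqxx scale1r.
  by rewrite H => e0; have := eR_neq0 (alg_val_inj (e0 : val (eR i i) = val 0)).
apply/seteqP; split=> [f /ErowP[Ff E1]|_ [f Ff <-]].
  exists (eij K 0 i * f); first exact: idealF_mull.
  by rewrite mulrA eij_mul eqxx scale1r.
apply/ErowP; split; first exact: idealF_mull.
by rewrite mulrA eij_mul eqxx scale1r.
Qed.


End Operators.

Theorem theorem8p3 (K : fieldType) (charK0 : [pchar K] =i pred0) :
  (* (1) *)
  (lfractions (idealF K) = idealF K /\
   idealF K `<` rfractions (idealF K)) /\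
  (* (2) *)
  [/\ mulr_closed (mem (inside (I1 K) (I10 K))),
      right_ore (inside (I1 K) (I10 K)),
      ~ left_ore (inside (I1 K) (I10 K))
    & iso_right_localization (inside (I1 K) (I10 K)) (I1_incl K)] /\
  (* (3) *)
  [/\ rfractions (idealF K) `<=` tI1 K,
      forall J : set (alg_of (tI1 K)),
        proper_two_sided_ideal J <-> J = inside (tI1 K) (rfractions (idealF K))
    & ideal_prod (inside (tI1 K) (rfractions (idealF K)))
                 (inside (tI1 K) (rfractions (idealF K)))
      = inside (tI1 K) (rfractions (idealF K))] /\
  (* (4) *)
  (exists J : algideal (alg_of (tI1 K)),
     algideal_set J = inside (tI1 K) (rfractions (idealF K)) /\
     iso_Frac (quot_alg J) (alg_of (weylA1 K))) /\
  (* (5) *)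
  tI1 K `&` finrank (V := {poly K}) = rfractions (idealF K) /\
  (* (6) *)
  [/\ frac_defined (tI1 K),
      alg_iso (alg_of (fracV (tI1 K))) (quot_alg (sub_finrank_algideal (tI1 K)))
    & iso_Frac (quot_alg (sub_finrank_algideal (tI1 K))) (alg_of (weylA1 K))] /\
  (* (7a) *)
  (let Kx : lmodType (alg_of (tI1 K)) := nat_module (tI1 K) in
   let Frac := quot_lmod (sub_finrank_algideal (tI1 K)) in
   [/\ simple_module Kx /\ simple_module Frac,
       ~ mod_iso Kx Frac,
       forall M : lmodType (alg_of (tI1 K)),
         simple_module M -> mod_iso M Kx \/ mod_iso M Frac
     & faithful_module Kx /\ ~ faithful_module Frac]) /\
  (* (7b) *)
  ((exists L, I10_localization (I1_mod_int K) L) /\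
   (exists L, I10_localization (Kd_mod charK0) L) /\
   forall L L' : lmodType (alg_of (tI1 K))^c,
     I10_localization (I1_mod_int K) L ->
     I10_localization (Kd_mod charK0) L' ->
     let Frac := quot_rmod (sub_finrank_algideal (tI1 K)) in
     mod_iso L L' /\
     [/\ simple_module L /\ simple_module Frac,
         ~ mod_iso L Frac,
         forall M : lmodType (alg_of (tI1 K))^c,
           simple_module M -> mod_iso M L \/ mod_iso M Frac
       & faithful_module L /\ ~ faithful_module Frac]) /\
  (* (8), left ideals *)
  [/\ direct_sum (Ecol K) (idealF K),
      forall i, [/\ Ecol K i `<=` tI1 K,
                    left_ideal (inside (tI1 K) (Ecol K i)),
                    Ecol K i <> [set 0],
                    Ecol K i = [set f * eij K 0 i | f in idealF K]
                  & exists2 f : {linear nat_module (tI1 K) -> (alg_of (tI1 K))^o},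
                      injective f & range f = inside (tI1 K) (Ecol K i)]
    & ~ left_noetherian (alg_of (tI1 K))] /\
  (* (8), right ideals *)
  [/\ direct_sum (Erow K) (idealF K),
      direct_sum (fun i => rfractions (Erow K i)) (rfractions (idealF K)),
      forall i, [/\ rfractions (Erow K i) `<=` tI1 K,
                    right_ideal (inside (tI1 K) (rfractions (Erow K i))),
                    rfractions (Erow K i) <> [set 0]
                  & Erow K i = [set eij K i 0 * f | f in idealF K]]
    & ~ right_noetherian (alg_of (tI1 K))].
Proof.
split; first by split; [exact: lfractions_idealF|exact: idealF_proper].
split; first exact: I10_ore_localization.
split; first exact: tI1_proper_ideal.
split.
  exists (sub_finrank_algideal (tI1 K)); split; first by rewrite inside_rfractionsF.
  exact: quot_iso_Frac.
split; first exact: tI1_finrankE.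
split; first exact: fracV_tI1.
split; first exact: tI1_simple_left_modules.
split; first exact: tI1_simple_right_modules.
split.
  by split; [exact: Ecol_direct_sum|exact: Ecol_left_ideal|exact: not_left_noetherian].
by split; [exact: Erow_direct_sum|exact: rfractions_Erow_direct_sum|exact: rfractions_Erow_right_ideal
  |exact: not_right_noetherian].
Qed.
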